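(* Let $n\ge3$ and $2\le k\le n-1$. Suppose that $D\subset\mathbb R^n$ is a smooth bounded, strictly star-shaped domain with strictly $(k-1)$-convex boundary, $\Omega:=\mathbb R^n\setminus\overline D$, $\varphi\in C^\infty(\partial D)$, $A\in\mathcal A_k$ and $b\in\mathbb R^n$. Let $$\underline c:=\max_{\partial D}(\varphi-Q_0)-\frac{A_\partial^+}{\gamma\,\mathcal H_0}.$$ If $c<\underline c$, then there is no $u\in C^2(\overline\Omega)$ satisfying $$\lambda(D^2u)\in\Gamma_k,\qquad\sigma_k(\lambda(D^2u))\ge1\quad\text{in }\Omega,$$ and $$u=\varphi\ \text{ on }\partial D,\qquad u(x)=Q_c(x)+o(1)\ \text{ as }|x|\to\infty.$$
   Context: For a real symmetric $n\times n$ matrix $M$, $\lambda(M)$ is its vector of eigenvalues; $\sigma_j$ is the $j$-th elementary symmetric function; $\Gamma_k=\{\lambda\in\mathbb R^n:\sigma_j(\lambda)>0,\ j=1,\dots,k\}$; $\mathcal A_k=\{A\in\mathrm{Sym}(n):\lambda(A)\in\Gamma_k,\ \sigma_k(\lambda(A))=1\}$. $Q_c(x):=\frac12x^TAx+b\cdot x+c$, so $Q_0(x)=\frac12x^TAx+b\cdot x$. Let $\nu$ be the exterior unit normal to $\partial D$, pointing from $D$ into $\Omega$, and let $\kappa(\xi)\in\mathbb R^{n-1}$ be the principal curvatures of $\partial D$ at $\xi$ (eigenvalues of $II(\tau,\eta)=\langle D_\tau\nu,\eta\rangle$ on $T_\xi\partial D$, positive for spheres). $\partial D$ is strictly $(k-1)$-convex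 if for every $\xi\in\partial D$, $\sigma_j(\kappa(\xi))>0$ for $j=1,\dots,k-1$. $D$ is strictly star-shaped if there is $x_0\in D$ with $(x-x_0)\cdot\nu(x)>0$ for all $x\in\partial D$. $\mathcal H_0:=\min_{\xi\in\partial D}\sigma_1(\kappa(\xi))>0$. For symmetric $M$, $\operatorname{tr}_{T_\xi\partial D}M:=\operatorname{tr}M-\nu(\xi)^TM\nu(\xi)$, and $A_\partial^+:=\max\{0,\sup_{\xi\in\partial D}\operatorname{tr}_{T_\xi\partial D}A\}$. $F(M):=\sigma_k(\lambda(M))$; $G^{ij}:=\frac{\partial F}{\partial m_{ij}}\big|_{M=A}$ (a positive definite matrix); $L_Av:=\sum_{i,j}G^{ij}v_{ij}$. $h$ is the unique solution, smooth up to $\partial D$, of $L_Ah=0$ in $\Omega$, $h=1$ on $\partial D$, $h(x)\to0$ as $|x|\to\infty$; and $\gamma:=\min_{\partial D}(-\partial_\nu h)>0$. *)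

(* Defs.v *)
From HB Require Import structures.
From mathcomp Require Import all_boot all_order all_algebra.
From mathcomp Require Import all_classical all_reals all_analysis.

Set Implicit Arguments.
Unset Strict Implicit.
Unset Printing Implicit Defensive.

Import Order.TTheory GRing.Theory Num.Theory.
Import numFieldNormedType.Exports.

Local Open Scope classical_set_scope.
Local Open Scope ring_scope.

Section Euclidean.
Context {R : realType} {n : nat}.
Implicit Types (x y : 'rV[R]_n) (D U : set 'rV[R]_n) (f g : 'rV[R]_n -> R).

Definition dotv x y : R := (x *m y^T) 0 0.

(* The library norm `|x| on 'rV_n is the sup norm. *)
Definition enorm x : R := Num.sqrt (dotv x x).

Definition at_infinity : set_system 'rV[R]_n :=
  filter_from [set: R] (fun r => [set x | r < enorm x]).

Global Instance at_infinity_filter : Filter at_infinity.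
Proof.
apply: filter_fromT_filter; first by exists 0.
move=> r s; exists (Num.max r s) => x /=.
by rewrite gt_max => /andP[].
Qed.

Definition boundary D : set 'rV[R]_n := closure D `\` D°.

Definition basis_vec (i : 'I_n) : 'rV[R]_n := delta_mx 0 i.

(* partial [:: i1; ...; im] f = d_i1 (... (d_im f)) *)
Definition partial (s : seq 'I_n) f : 'rV[R]_n -> R :=
  foldr (fun i g => fun x => 'D_(basis_vec i) g x) f s.

Definition gradient f x : 'rV[R]_n := \row_i partial [:: i] f x.

Definition hessian f x : 'M[R]_n := \matrix_(i, j) partial [:: i; j] f x.

(* C^m on an open set U (f is irrelevant outside U). *)
Definition C_on (m : nat) U f : Prop :=
  forall s : seq 'I_n, (size s <= m)%N ->
    (forall x, U x -> {for x, continuous (partial s f)}) /\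
    ((size s < m)%N ->
      forall x i, U x -> derivable (partial s f) x (basis_vec i)).

(* C^m up to the boundary of the open set U: f is continuous on closure U, it is
   C^m in U, and its derivatives of order <= m extend continuously to
   closure U. *)
Definition C_upto (m : nat) U f : Prop :=
  [/\ {within closure U, continuous f},
      C_on m U f &
      forall s : seq 'I_n, (size s <= m)%N ->
        exists g, {within closure U, continuous g} /\
                  forall x, U x -> g x = partial s f x].

Definition smooth_on U f : Prop := forall m, C_on m U f.

Definition smooth_upto U f : Prop := forall m, C_upto m U f.

Definition smooth_on_boundary D f : Prop :=
  forall xi, boundary D xi ->
    exists U g, [/\ open U, U xi, smooth_on U g &
                    forall x, U x -> boundary D x -> f x = g x].

Definition defining_function D U rho : Prop :=
  [/\ open U, smooth_on U rho,
      forall x, U x -> gradient rho x != 0 &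
      forall x, U x -> (D x <-> rho x < 0)].

Definition smooth_boundary D : Prop :=
  forall xi, boundary D xi -> exists U rho, U xi /\ defining_function D U rho.

Definition smooth_bounded_domain D : Prop :=
  [/\ open D, connected D, D !=set0, bounded_set D & smooth_boundary D].

(* Exterior unit normal; the value does not depend on the defining function. *)
Definition unit_normal D xi : 'rV[R]_n :=
  xget 0 [set v | exists U rho, [/\ U xi, defining_function D U rho &
    v = (enorm (gradient rho xi))^-1 *: gradient rho xi]].

(* One-sided, as f need only be meaningful on the closure of the exterior
   domain, into which the normal points. *)
Definition normal_derivative D f xi : R :=
  lim ((fun t : R => t^-1 * (f (xi + t *: unit_normal D xi) - f xi))
         @ (0 : R)^'+).

Definition strictly_star_shaped D : Prop :=
  exists x0, D x0 /\
    forall x, boundary D x -> 0 < dotv (x - x0) (unit_normal D x).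

Definition tr_tangent D xi (M : 'M[R]_n) : R :=
  \tr M - dotv (unit_normal D xi *m M) (unit_normal D xi).

Definition quadratic (A : 'M[R]_n) (b : 'rV[R]_n) (c : R) x : R :=
  2^-1 * dotv (x *m A) x + dotv b x + c.

End Euclidean.

Section Eigenvalues.
Context {R : realType}.

(* The eigenvalues with multiplicity, in an unspecified order (only symmetric
   functions of them are used); they exist when M is symmetric. *)
Definition eigenvalues n (M : 'M[R]_n) : 'rV[R]_n :=
  xget 0 [set l : 'rV[R]_n | char_poly M = \prod_(i < n) ('X - (l 0 i)%:P)].

Definition sigma n (j : nat) (l : 'rV[R]_n) : R :=
  \sum_(S : {set 'I_n} | #|S| == j) \prod_(i in S) l 0 i.

Definition Gamma n (k : nat) : set 'rV[R]_n :=
  [set l | forall j, (1 <= j <= k)%N -> 0 < sigma j l].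

Definition calA n (k : nat) : set 'M[R]_n :=
  [set A | [/\ A^T = A, Gamma k (eigenvalues A) & sigma k (eigenvalues A) = 1]].

Definition Fk n (k : nat) (M : 'M[R]_n) : R := sigma k (eigenvalues M).

(* Fk lives on symmetric matrices, and the matrix G of its differential is the
   symmetric one with dF(B) = \sum_(i, j) G i j * B i j for symmetric B; hence
   G i j is the derivative in the direction of the symmetric part of E_ij. *)
Definition linearized n (k : nat) (A : 'M[R]_n) : 'M[R]_n :=
  \matrix_(i, j)
    derive1
      (fun t : R => Fk k (A + t *: (2^-1 *: (delta_mx i j + delta_mx j i)))) 0.

Definition linearized_op n (k : nat) (A : 'M[R]_n) (v : 'rV[R]_n -> R)
    (x : 'rV[R]_n) : R :=
  \sum_i \sum_j linearized k A i j * hessian v x i j.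

End Eigenvalues.

Section Curvature.
Context {R : realType} {n : nat}.
Implicit Types (D : set 'rV[R]_n) (xi tau eta : 'rV[R]_n).

(* Tangential derivatives of the normal are those of any extension of it off the
   boundary which is differentiable at xi; they do not depend on the
   extension. *)
Definition normal_extension D xi : 'rV[R]_n -> 'rV[R]_n :=
  xget (fun=> 0) [set N : 'rV[R]_n -> 'rV[R]_n | differentiable N xi /\
    \forall x \near xi, boundary D x -> N x = unit_normal D x].

Definition second_fundamental_form D xi tau eta : R :=
  dotv ('D_tau (normal_extension D xi) xi) eta.

(* The rows form an orthonormal basis of the tangent space. *)
Definition tangent_frame D xi : 'M[R]_(n.-1, n) :=
  xget 0 [set E | E *m E^T = 1%:M /\ E *m (unit_normal D xi)^T = 0].

Definition principal_curvatures D xi : 'rV[R]_n.-1 :=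
  eigenvalues (\matrix_(i < n.-1, j < n.-1)
    second_fundamental_form D xi
      (row i (tangent_frame D xi)) (row j (tangent_frame D xi))).

(* Strict m-convexity of the boundary. *)
Definition strictly_convex_boundary (m : nat) D : Prop :=
  forall xi, boundary D xi -> Gamma m (principal_curvatures D xi).

(* The extrema below are over the boundary, which is compact and nonempty for a
   bounded domain, so that sup and inf of continuous functions are attained. *)
Definition H0 D : R :=
  inf [set sigma 1 (principal_curvatures D xi) | xi in boundary D].

Definition A_plus D (A : 'M[R]_n) : R :=
  Num.max 0 (sup [set tr_tangent D xi A | xi in boundary D]).

Definition exterior D : set 'rV[R]_n := ~` closure D.

Definition exterior_potential k D (A : 'M[R]_n) (h : 'rV[R]_n -> R) : Prop :=
  [/\ smooth_upto (exterior D) h,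
      forall x, exterior D x -> linearized_op k A h x = 0,
      forall x, boundary D x -> h x = 1 &
      h @ at_infinity --> (0 : R)].

Definition gamma D (h : 'rV[R]_n -> R) : R :=
  inf [set - normal_derivative D h xi | xi in boundary D].

Definition c_lower D (phi : 'rV[R]_n -> R) (A : 'M[R]_n) (b : 'rV[R]_n)
    (h : 'rV[R]_n -> R) : R :=
  sup [set phi xi - quadratic A b 0 xi | xi in boundary D]
  - A_plus D A / (gamma D h * H0 D).

End Curvature.

(* Main.v *)
Require Import Defs.
From HB Require Import structures.
From mathcomp Require Import all_boot all_order all_algebra.
From mathcomp Require Import all_classical all_reals all_analysis.
From mathcomp Require Import perm complex ring lra zify.

Set Implicit Arguments.
Unset Strict Implicit.
Unset Printing Implicit Defensive.

Import Order.TTheory GRing.Theory Num.Theory.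
Import numFieldNormedType.Exports.

Local Open Scope classical_set_scope.
Local Open Scope ring_scope.

(** Why the theorem is true.  Suppose that a subsolution [u] with these boundary
    values and this behaviour at infinity exists, and let [w = u - Q_c] be its
    excess over the quadratic.  Let [M] be the maximum of [w] on the boundary,
    attained at [xi0].  The assumption on [c] says exactly that
    [M > A_plus / (gamma * H0)], so [M] is positive.

    First, [w <= M h] in the exterior.  The function [sigma_k] is a hyperbolic
    polynomial on symmetric matrices, and Garding's inequality for it says that
    the linearization [G] at [A] satisfies [G : (H - A) >= 0] whenever [H] is in
    the cone and [sigma_k H >= 1] ([linearized_garding]).  Hence [w] is a
    subsolution of the linearized equation, which [h] solves, and the comparison
    principle ([exterior_comparison]) applies.  Equality holds at [xi0], so that
    the normal derivative of [w] there is at most [- M gamma].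

    Second, [h <= 1] gives [w <= M], that is, [u] lies below a quadratic
    polynomial with Hessian [A] which touches it at [xi0].  Following the boundary
    away from [xi0] in a tangent direction [tau] and comparing to second order
    ([boundary_second_order]) yields
    [tau D^2u tau - tau A tau <= II (tau, tau) * d_nu w].  Summing over a tangent
    frame, the tangential trace of [D^2u] at [xi0] is at most
    [A_plus - M gamma H0 < 0].  But matrices in [Gamma_2] have nonnegative trace
    on every hyperplane ([Gamma2_trace_bound]), a contradiction.

    Garding's inequality is proved by continuation of roots: along a path of
    polynomials of constant degree without roots on a line, the roots stay on
    their side of the line ([root_continuation]).  Since real symmetric matrices
    have real eigenvalues, and since derivatives of real-rooted polynomials are
    real-rooted, this shows that [t |-> sigma_k (B + t A)] has only negative roots
    for [A] and [B] in the cone ([pencil_negative_roots]).  The concavity that is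
    needed is then the inequality between arithmetic and geometric means, and
    strict ellipticity follows from the location of the roots of
    [s |-> sigma_k (A + s V)] for semidefinite [V] ([pencil_psd_deriv_gt0]).

    That [gamma] is positive comes from Hopf's lemma at the boundary, once [h < 1]
    in the exterior.  For this strong maximum principle a chain of balls is
    replaced by rays: those from a star center never return to the domain, and
    [h] is small at infinity ([strong_maximum]).  That [H0] is positive and is a
    lower bound for the mean curvature follows from the expression of the second
    fundamental form by a defining function ([second_fundamental_form_diag]). *)

(** * Euclidean vectors and norms *)

Section DotProduct.
Variables (R : realType) (n : nat).
Implicit Types (x y z v : 'rV[R]_n) (M : 'M[R]_n).

Lemma dotvE x y : dotv x y = \sum_i x 0 i * y 0 i.
Proof. by rewrite /dotv mxE; apply: eq_bigr => i _; rewrite mxE. Qed.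

Lemma dotvC x y : dotv x y = dotv y x.
Proof. by rewrite !dotvE; apply: eq_bigr => i _; rewrite mulrC. Qed.

Lemma dotvDl x y z : dotv (x + y) z = dotv x z + dotv y z.
Proof. by rewrite /dotv mulmxDl mxE. Qed.

Lemma dotvDr x y z : dotv z (x + y) = dotv z x + dotv z y.
Proof. by rewrite dotvC dotvDl !(dotvC z). Qed.

Lemma dotvZl a x y : dotv (a *: x) y = a * dotv x y.
Proof. by rewrite /dotv -scalemxAl mxE. Qed.

Lemma dotvZr a x y : dotv x (a *: y) = a * dotv x y.
Proof. by rewrite dotvC dotvZl dotvC. Qed.

Lemma dotvNl x y : dotv (- x) y = - dotv x y.
Proof. by rewrite -scaleN1r dotvZl mulN1r. Qed.

Lemma dotvNr x y : dotv x (- y) = - dotv x y.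
Proof. by rewrite dotvC dotvNl dotvC. Qed.

Lemma dotvBl x y z : dotv (x - y) z = dotv x z - dotv y z.
Proof. by rewrite dotvDl dotvNl. Qed.

Lemma dotvBr x y z : dotv z (x - y) = dotv z x - dotv z y.
Proof. by rewrite dotvDr dotvNr. Qed.

Lemma dotv0l x : dotv 0 x = 0.
Proof. by rewrite /dotv mul0mx mxE. Qed.

Lemma dotv0r x : dotv x 0 = 0.
Proof. by rewrite dotvC dotv0l. Qed.

Lemma dotvv_ge0 x : 0 <= dotv x x.
Proof. by rewrite dotvE sumr_ge0 // => i _; rewrite -expr2 sqr_ge0. Qed.

Lemma dotvv_eq0 x : (dotv x x == 0) = (x == 0).
Proof.
apply/eqP/eqP => [|->]; last by rewrite dotv0l.
rewrite dotvE => /psumr_eq0P h; apply/rowP => i; rewrite mxE.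
have /(_ _ i isT)/eqP := h; rewrite mulf_eq0 orbb => h'; apply/eqP/h' => m _.
by rewrite -expr2 sqr_ge0.
Qed.

Lemma dotvv_gt0 x : (0 < dotv x x) = (x != 0).
Proof. by rewrite lt_neqAle dotvv_ge0 andbT [0 == _]eq_sym dotvv_eq0. Qed.

Lemma dotv_cauchy_schwarz x y : dotv x y ^+ 2 <= dotv x x * dotv y y.
Proof.
have [->|] := eqVneq y 0; first by rewrite !dotv0r expr0n mulr0.
rewrite -dotvv_gt0 => y0.
have := dotvv_ge0 (dotv y y *: x - dotv x y *: y).
rewrite !(dotvBl, dotvBr, dotvZl, dotvZr) (dotvC y x).
move: (dotv x x) (dotv y y) (dotv x y) y0 => a b c b0 h.
by rewrite -subr_ge0 -(pmulr_rge0 _ b0); apply: le_trans h _; nra.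
Qed.

Lemma dotv_mulmx M x y : dotv (x *m M) y = \sum_i \sum_j x 0 i * M i j * y 0 j.
Proof.
rewrite dotvE exchange_big; apply: eq_bigr => j _.
by rewrite mxE mulr_suml; apply: eq_bigr => i _.
Qed.

Lemma dotv_mulmxT M x y : dotv (x *m M^T) y = dotv (y *m M) x.
Proof.
rewrite !dotv_mulmx exchange_big; apply: eq_bigr => i _; apply: eq_bigr => j _ /=.
by rewrite mxE; ring.
Qed.

Lemma enorm_ge0 x : 0 <= enorm x.
Proof. exact: sqrtr_ge0. Qed.

Lemma sqr_enorm x : enorm x ^+ 2 = dotv x x.
Proof. by rewrite sqr_sqrtr // dotvv_ge0. Qed.

Lemma enorm_eq0 x : (enorm x == 0) = (x == 0).
Proof. by rewrite -dotvv_eq0 -sqr_enorm expf_eq0. Qed.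

Lemma enorm_gt0 x : (0 < enorm x) = (x != 0).
Proof. by rewrite lt_neqAle enorm_ge0 andbT eq_sym enorm_eq0. Qed.

Lemma enormZ a x : enorm (a *: x) = `|a| * enorm x.
Proof. by rewrite /enorm dotvZl dotvZr mulrA -expr2 sqrtrM ?sqr_ge0 // sqrtr_sqr. Qed.

Lemma norm_rV_le x c : 0 <= c -> (`|x| <= c) <-> (forall i, `|x 0 i| <= c).
Proof.
move=> c0; rewrite [`|x|]/Num.Def.normr /= mx_normrE; split=> [/bigmax_leP[_ h] i|h].
  exact: (h (0, i)).
by apply/bigmax_leP; split=> // -[i j] _ /=; rewrite (ord1 i).
Qed.

Lemma coord_le_norm x i : `|x 0 i| <= `|x|.
Proof. by have [h _] := norm_rV_le x (normr_ge0 x); apply: h. Qed.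

Lemma dotv_le_norm x y : `|dotv x y| <= n%:R * `|x| * `|y|.
Proof.
rewrite dotvE; apply: le_trans (ler_norm_sum _ _ _) _.
rewrite -mulrA mulr_natl; have <- : \sum_(i < n) `|x| * `|y| = `|x| * `|y| *+ n.
  by rewrite sumr_const card_ord.
apply: ler_sum => i _.
by rewrite normrM ler_pM // coord_le_norm.
Qed.

Lemma dotvv_le_norm x : dotv x x <= n%:R * `|x| ^+ 2.
Proof. by apply: le_trans (ler_norm _) _; rewrite expr2 mulrA dotv_le_norm. Qed.

Lemma norm_le_enorm x : `|x| <= enorm x.
Proof.
apply/(norm_rV_le _ (enorm_ge0 x)) => j; rewrite -sqrtr_sqr ler_sqrt ?dotvv_ge0 // dotvE.
rewrite (bigD1 j) //= -expr2 lerDl sumr_ge0 // => l _.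
by rewrite -expr2 sqr_ge0.
Qed.

Lemma sqr_norm_le x : `|x| ^+ 2 <= dotv x x.
Proof. by rewrite -sqr_enorm lerXn2r ?nnegrE ?enorm_ge0 // norm_le_enorm. Qed.

Lemma mulmx_norm_bound M : exists2 K : R, 0 < K &
  forall x y, `|dotv (x *m M) y| <= K * `|x| * `|y|.
Proof.
exists (1 + \sum_i \sum_j `|M i j|).
  by rewrite ltr_pwDl // sumr_ge0 // => i _; rewrite sumr_ge0.
move=> x y; rewrite dotv_mulmx; apply: le_trans (ler_norm_sum _ _ _) _.
apply: (@le_trans _ _ ((\sum_i \sum_j `|M i j|) * `|x| * `|y|)); last first.
  by rewrite !ler_wpM2r // lerDr.
rewrite !mulr_suml; apply: ler_sum => i _.
apply: le_trans (ler_norm_sum _ _ _) _; rewrite !mulr_suml; apply: ler_sum => j _.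
rewrite !normrM [`|x 0 i| * _]mulrC -!mulrA ler_wpM2l // ler_pM //; exact: coord_le_norm.
Qed.

End DotProduct.

(** * Elementary symmetric functions of a matrix *)

Section SymmetricMatrixFunctions.

Lemma coef_comp_scaleX (T : comNzRingType) (p : {poly T}) (c : T) j :
  (p \Po (c *: 'X))`_j = p`_j * c ^+ j.
Proof.
rewrite coef_comp_poly; under eq_bigr => i _ do rewrite exprZn coefZ coefXn.
have [jp|pj] := ltnP j (size p); last first.
  rewrite (nth_default _ pj) mul0r big1 // => i _.
  by rewrite gtn_eqF ?mulr0 ?mulr0 // (leq_trans (ltn_ord i)).
rewrite (bigD1 (Ordinal jp)) //= eqxx mulr1 big1 ?addr0 // => i.
by rewrite -val_eqE /= eq_sym => /negPf ->; rewrite !mulr0.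
Qed.

(** Up to sign this is a coefficient of the characteristic polynomial.  The formula
    makes sense over every commutative ring, hence for complex matrices and for
    matrices of polynomials, where no eigenvalues are available. *)
Definition esf (T : comNzRingType) n (k : nat) (M : 'M[T]_n) : T :=
  (-1) ^+ k * (char_poly M)`_(n - k).

Lemma esf_map (T U : comNzRingType) (f : {rmorphism T -> U}) n k (M : 'M[T]_n) :
  esf k (map_mx f M) = f (esf k M).
Proof.
by rewrite /esf -map_char_poly coef_map rmorphM rmorphXn rmorphN1.
Qed.

Lemma esf0 (T : comNzRingType) n (M : 'M[T]_n) : esf 0 M = 1.
Proof.
rewrite /esf expr0 mul1r subn0.
have := monicP (char_poly_monic M).
by rewrite /lead_coef size_char_poly.
Qed.

Lemma esf1 (T : comNzRingType) n (M : 'M[T]_n) : (0 < n)%N -> esf 1 M = \tr M.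
Proof.
by move=> n0; rewrite /esf expr1 mulN1r subn1 char_poly_trace // opprK.
Qed.

Lemma esf2 (T : comNzRingType) n (M : 'M[T]_n.+2) : esf 2 M = (char_poly M)`_n.
Proof. by rewrite /esf sqrrN expr1n mul1r subn2. Qed.

Lemma esf_sigma (R : realType) n k (M : 'M[R]_n) (l : 'rV[R]_n) :
  (k <= n)%N -> char_poly M = \prod_(i < n) ('X - (l 0 i)%:P) ->
  esf k M = sigma k l.
Proof.
rewrite /esf => kn ->.
have -> : \prod_(i < n) ('X - (l 0 i)%:P) =
          \prod_(p <- [tuple l 0 i | i < n]) ('X - p%:P).
  by rewrite big_tuple; apply: eq_bigr => i _; rewrite tnth_mktuple.
rewrite coef_prod_XsubC; last by rewrite size_tuple leq_subr.
rewrite mulrA -exprD.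
have key m (t : seq R) (j : nat) : size t = m -> (j <= m)%N ->
   \sum_(I in {set 'I_(size t)} | #|I| == (size t - (m - j))%N)
     \prod_(i in I) t`_i =
   \sum_(I : {set 'I_m} | #|I| == j) \prod_(i in I) t`_i.
  move=> st; subst m => jm.
  by apply: eq_bigl => I; rewrite subKn.
rewrite (key n) ?size_tuple // ?size_tuple subKn // -signr_odd oddD addbb mul1r.
apply: eq_bigr => I _; apply: eq_bigr => i _.
by rewrite -tnth_nth tnth_mktuple.
Qed.

Lemma esf_scale (F : fieldType) n k (c : F) (M : 'M[F]_n) :
  (k <= n)%N -> c != 0 -> esf k (c *: M) = c ^+ k * esf k M.
Proof.
move=> kn c0; rewrite /esf.
have E : char_poly (c *: M) \Po (c *: 'X) = c ^+ n *: char_poly M.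
  have -> : char_poly (c *: M) \Po (c *: 'X) =
            \det (map_mx (comp_poly (c *: 'X)) (char_poly_mx (c *: M))).
    by rewrite det_map_mx.
  have -> : map_mx (comp_poly (c *: 'X)) (char_poly_mx (c *: M)) =
            c%:P *: char_poly_mx M.
    apply/matrixP => i j; rewrite !mxE rmorphB /= rmorphMn /= comp_polyX comp_polyC.
    by rewrite mulrBr mul_polyC scalerMnr polyCM.
  by rewrite detZ -polyC_exp mul_polyC.
have H j : (char_poly (c *: M))`_j * c ^+ j = c ^+ n * (char_poly M)`_j.
  by rewrite -coefZ -E coef_comp_scaleX.
have := H (n - k)%N.
have -> : c ^+ n = c ^+ k * c ^+ (n - k) by rewrite -exprD subnKC.
rewrite mulrAC => /mulIf -> //; first by rewrite mulrCA.
by rewrite expf_neq0.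
Qed.

Lemma char_poly_shift (T : comNzRingType) n (M : 'M[T]_n) (s : T) :
  char_poly (M + s%:M) = char_poly M \Po ('X - s%:P).
Proof.
rewrite /char_poly -det_map_mx; congr (\det _).
apply/matrixP => i j; rewrite !mxE rmorphB /= rmorphMn /= comp_polyX comp_polyC.
by rewrite polyCD polyCMn; case: (i == j); rewrite ?mulr1n ?mulr0n; ring.
Qed.

End SymmetricMatrixFunctions.

(** * Pencils of matrices *)

Section Pencils.

(** Degree bookkeeping in the two variables of a polynomial with polynomial
    coefficients: this gives the degree of [pencil] without expanding minors. *)
Definition total_degree_le (T : comNzRingType) (m : nat) (q : {poly {poly T}}) :=
  forall j, (size (q`_j)%R <= m.+1 - j)%N.

Lemma total_degree_leM (T : comNzRingType) a b (p q : {poly {poly T}}) :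
  total_degree_le a p -> total_degree_le b q -> total_degree_le (a + b) (p * q).
Proof.
move=> hp hq j; rewrite coefM.
apply: leq_trans (size_sum _ _ _) _; apply/bigmax_leqP => i _.
have := hp i; have := hq (j - i)%N; have := ltn_ord i => ij.
have [->|p0] := eqVneq p`_i 0; first by rewrite mul0r size_poly0.
have [->|q0] := eqVneq q`_(j - i) 0; first by rewrite mulr0 size_poly0.
move: p0 q0; rewrite -!size_poly_gt0 => p0 q0 h1 h2.
apply: leq_trans (size_polyMleq _ _) _.
by move: (size p`_i) (size q`_(j - i)) p0 q0 h1 h2 ij => x y; lia.
Qed.

Lemma total_degree_le_prod (T : comNzRingType) (I : Type) (r : seq I)
    (F : I -> {poly {poly T}}) :
  (forall i, total_degree_le 1 (F i)) ->
  total_degree_le (size r) (\prod_(i <- r) F i).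
Proof.
move=> hF; elim: r => [|i r IH].
  rewrite big_nil /= => j; rewrite coef1.
  by case: j => [|j] /=; rewrite ?size_poly1 ?size_poly0.
by rewrite big_cons /= -add1n; exact: total_degree_leM.
Qed.

Lemma size_esf_le (T : comNzRingType) n k (N : 'M[{poly T}]_n) :
  (k <= n)%N -> (forall i j, (size (N i j) <= 2)%N) ->
  (size (esf k N) <= k.+1)%N.
Proof.
move=> kn hN.
have hd : total_degree_le n (char_poly N).
  move=> j; rewrite /char_poly /determinant coef_sum.
  apply: leq_trans (size_sum _ _ _) _; apply/bigmax_leqP => s _.
  rewrite mulr_sign.
  have hp : total_degree_le n (\prod_i char_poly_mx N i (s i)).
    rewrite -[X in total_degree_le X]card_ord cardE -big_enum /=.
    apply: total_degree_le_prod => i l; rewrite !mxE coefB coefMn coefX coefC.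
    case: l => [|[|l]] /=; rewrite ?mul0rn ?sub0r ?subr0 ?size_polyN ?size_poly0 //.
    by case: (i == s i) => /=; rewrite ?mulr1n ?mulr0n ?size_poly1 ?size_poly0.
  by case: (odd_perm s); rewrite ?coefN ?size_polyN; exact: hp.
have := hd (n - k)%N; rewrite /esf.
rewrite -signr_odd mulr_sign => h.
by case: ifP => _; rewrite ?size_polyN; apply: leq_trans h _; lia.
Qed.

(** A genuine polynomial rather than the function [t |-> esf k (M + t A)], so that
    its degree, roots and formal derivative can be used. *)
Definition pencil (T : comNzRingType) n k (M A : 'M[T]_n) : {poly T} :=
  esf k (map_mx polyC M + 'X *: map_mx polyC A).

Lemma horner_pencil (T : comNzRingType) n k (M A : 'M[T]_n) t :
  (pencil k M A).[t] = esf k (M + t *: A).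
Proof.
rewrite /pencil -[LHS]/(horner_eval t _) -esf_map; congr (esf k _).
by apply/matrixP => i j; rewrite !mxE /= /horner_eval hornerD hornerM hornerX !hornerC.
Qed.

Lemma size_pencil (T : comNzRingType) n k (M A : 'M[T]_n) :
  (k <= n)%N -> (size (pencil k M A) <= k.+1)%N.
Proof.
move=> kn; apply: size_esf_le => // i j; rewrite !mxE.
apply: leq_trans (size_polyD _ _) _; rewrite geq_max; apply/andP; split.
  by apply: leq_trans (size_polyC_leq1 _) _.
by rewrite mulrC; apply: leq_trans (size_polyMleq _ _) _;
   rewrite size_polyX addn2 /= ltnS size_polyC_leq1.
Qed.

Lemma poly_eq_nat (F : numFieldType) (p q : {poly F}) :
  (forall m : nat, p.[m.+1%:R] = q.[m.+1%:R]) -> p = q.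
Proof.
move=> h; apply/eqP; rewrite -subr_eq0; apply: contraT => nz.
pose rs := [seq m.+1%:R : F | m <- iota 0 (size (p - q))].
have := @max_poly_roots _ (p - q) rs nz.
rewrite size_map size_iota ltnn; apply.
  by apply/allP => x /mapP[m _ ->]; rewrite rootE hornerD hornerN h subrr.
by rewrite map_inj_uniq ?iota_uniq // => i j /eqP; rewrite eqr_nat => /eqP[].
Qed.

(** The homogeneity of [esf k] exchanges the two matrices of a pencil and reverses
    its coefficients: the leading coefficient becomes a constant one. *)
Lemma coef_pencil (F : numFieldType) n k (M A : 'M[F]_n) :
  (k <= n)%N -> (pencil k M A)`_k = esf k A.
Proof.
move=> kn; pose q := pencil k A M.
have -> : pencil k M A = \poly_(i < k.+1) q`_(k - i).
  apply: poly_eq_nat => m; rewrite horner_pencil.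
  set t := _%:R; have t0 : t != 0 by rewrite pnatr_eq0.
  have -> : M + t *: A = t *: (A + t^-1 *: M).
    by rewrite scalerDr scalerA divff // scale1r addrC.
  rewrite esf_scale // -horner_pencil -/q horner_poly.
  rewrite (@horner_coef_wide _ k.+1) ?size_pencil // mulr_sumr.
  rewrite (reindex_inj rev_ord_inj) /=; apply: eq_bigr => i _.
  rewrite subSS mulrCA; congr (_ * _).
  have ik : (i <= k)%N by rewrite -ltnS.
  by rewrite exprVn -expfB_cond ?subKn ?leq_subr // (negPf t0) add0n leq_subr.
by rewrite coef_poly leqnn subnn -horner_coef0 horner_pencil scale0r addr0.
Qed.

Lemma pencil_factor (F : numFieldType) n k (M A : 'M[F]_n) :
  (forall p : {poly F}, {r | p = lead_coef p *: \prod_(z <- r) ('X - z%:P)}) ->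
  (k <= n)%N -> esf k A != 0 ->
  exists2 rs : seq F, size rs = k &
    pencil k M A = esf k A *: \prod_(z <- rs) ('X - z%:P).
Proof.
move=> closed kn a0; have [rs E] := closed (pencil k M A).
have szp : size (pencil k M A) = k.+1.
  apply/eqP; rewrite eqn_leq size_pencil //= ltnNge; apply/negP => h.
  by move: a0; rewrite -(coef_pencil M) // nth_default ?eqxx.
have lc : lead_coef (pencil k M A) = esf k A.
  by rewrite /lead_coef szp /= coef_pencil.
exists rs; last by rewrite -lc.
by move: szp; rewrite E lc size_scale // size_prod_XsubC => -[].
Qed.

End Pencils.

(** * Real-rooted polynomials *)

Section RealRootedPolynomials.
Variable R : rcfType.
Local Notation C := R[i].
Implicit Types p q : {poly C}.

Definition real_rooted p := forall z : C, root p z -> complex.Im z = 0.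

Lemma log_deriv (rs : seq C) (z : C) : z \notin rs ->
  (\prod_(r <- rs) ('X - r%:P))^`().[z] =
  (\prod_(r <- rs) ('X - r%:P)).[z] * \sum_(r <- rs) (z - r)^-1.
Proof.
elim: rs => [|r rs IH]; first by rewrite !big_nil derivC horner0 mulr0.
rewrite inE negb_or => /andP[zr zrs]; rewrite !big_cons derivM derivXsubC mul1r.
rewrite hornerD hornerM IH // !hornerM hornerXsubC mulrDr.
by rewrite mulrAC mulfV ?subr_eq0 // mul1r mulrA.
Qed.

Lemma Im_inv_sub (z r : C) : complex.Im r = 0 -> complex.Im z != 0 ->
  complex.Im z * complex.Im (z - r)^-1 < 0.
Proof.
case: z r => a b [c d] /= -> b0; rewrite subr0.
rewrite mulrN oppr_lt0 mulrA -expr2 divr_gt0 ?exprn_even_gt0 //.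
by rewrite ltr_wpDl ?sqr_ge0 // exprn_even_gt0.
Qed.

(** At a non-real point, every summand of the logarithmic derivative has
    imaginary part of the sign opposite to that of the point, hence no
    cancellation is possible. *)
Lemma real_rooted_deriv p : (1 < size p)%N -> real_rooted p -> real_rooted p^`().
Proof.
move=> sp hp z rz; have [//|Iz] := eqVneq (complex.Im z) 0.
have [rs E] := closed_field_poly_normal p.
have p0 : p != 0 by rewrite -size_poly_gt0; apply: leq_trans sp.
have lc0 : lead_coef p != 0 by rewrite lead_coef_eq0.
have rsP r : r \in rs -> complex.Im r = 0.
  by move=> rr; apply: hp; rewrite E rootZ // root_prod_XsubC.
have zrs : z \notin rs by apply: contra Iz => /rsP ->.
have : \sum_(r <- rs) (z - r)^-1 = 0.
  move: rz; rewrite E derivZ rootZ // rootE log_deriv // mulf_eq0.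
  by rewrite -rootE root_prod_XsubC (negPf zrs) => /eqP.
move=> S0; have : complex.Im z * complex.Im (\sum_(r <- rs) (z - r)^-1) < 0.
  have : (0 < size rs)%N by move: sp; rewrite E size_scale // size_prod_XsubC.
  elim: rs rsP {E zrs S0} => // r rs IH rsP _; rewrite big_cons raddfD mulrDr /=.
  have h := Im_inv_sub (rsP r (mem_head _ _)) Iz.
  case: rs IH rsP => [|r' rs] IH rsP; first by rewrite big_nil raddf0 mulr0 addr0.
  by rewrite ltr_wnDl ?ltW //; apply: IH => // x xr; apply: rsP; rewrite inE xr orbT.
by rewrite S0 raddf0 mulr0 ltxx.
Qed.

Lemma size_derivn_char0 p m : (size p^`(m) = size p - m)%N.
Proof.
elim: m => [|m IH]; first by rewrite derivn0 subn0.
rewrite derivnS; have [s1|s1] := leqP (size p^`(m)) 1.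
  rewrite (_ : p^`(m)^`() = 0) ?size_poly0; first by lia.
  by rewrite (size1_polyC s1) derivC.
have pm0 : p^`(m) != 0 by rewrite -size_poly_gt0; apply: leq_trans s1.
apply/eqP; rewrite eqn_leq; apply/andP; split.
  by have := lt_size_deriv pm0; rewrite IH; lia.
rewrite leqNgt; apply/negP => h.
have : (p^`(m)^`())`_(size p^`(m)).-2 = 0 by rewrite nth_default // -ltnS; apply: leq_trans h _; lia.
rewrite coef_deriv; move/eqP; rewrite mulrn_eq0 /= => /eqP h2.
move: pm0; rewrite -lead_coef_eq0 /lead_coef -[X in _`_X]prednK ?h2 ?eqxx //; lia.
Qed.

Lemma real_rooted_nderivn p m : (m < (size p).-1)%N -> real_rooted p ->
  real_rooted p^`N(m).
Proof.
move=> mp hp z rz.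
have : root p^`(m) z.
  by rewrite nderivn_def rootE hornerMn (eqP rz) mul0rn.
move: z {rz}; rewrite -/(real_rooted _).
elim: m mp => [|m IH] mp; first by rewrite derivn0.
rewrite derivnS; apply: real_rooted_deriv; last by apply: IH; lia.
by rewrite size_derivn_char0; lia.
Qed.

End RealRootedPolynomials.

Lemma coef_comp_XaddC (T : comNzRingType) (p : {poly T}) c j :
  (p \Po ('X + c%:P))`_j = p^`N(j).[c].
Proof.
have -> : p \Po ('X + c%:P) = \sum_(i < size p) (p^`N(i).[c])%:P * 'X^i.
  rewrite /comp_poly addrC (@nderiv_taylor _ (p^:P)); last exact: commr_polyX.
  rewrite size_map_polyC; apply: eq_bigr => i _.
  by rewrite nderivn_map horner_map.
rewrite coef_sum; under eq_bigr => i _ do rewrite mul_polyC coefZ coefXn.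
have [jp|pj] := ltnP j (size p); last first.
  rewrite nderivn_poly0 // horner0 big1 // => i _.
  by rewrite gtn_eqF ?mulr0 // (leq_trans (ltn_ord i)).
rewrite (bigD1 (Ordinal jp)) //= eqxx mulr1 big1 ?addr0 // => i.
by rewrite -val_eqE /= eq_sym => /negPf ->; rewrite mulr0.
Qed.

(** Moving along the identity differentiates the characteristic polynomial; this is
    how the Gauss-Lucas theorem enters. *)
Lemma esf_shift (T : comNzRingType) n k (M : 'M[T]_n) s :
  esf k (M + s%:M) = (-1) ^+ k * (char_poly M)^`N(n - k).[- s].
Proof. by rewrite /esf char_poly_shift -polyCN coef_comp_XaddC. Qed.

Section SymmetricPencils.
Variable R : rcfType.
Local Notation C := R[i].
Local Notation toC := (real_complex R).
Local Notation "M ^C" := (map_mx toC M).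

(** For an eigenvector [v] the Hermitian form of [M] at [v] is real, and it is the
    eigenvalue times the squared norm of [v]. *)
Lemma symmetric_real_rooted n (M : 'M[R]_n) : M^T = M ->
  real_rooted (char_poly M^C).
Proof.
move=> sM z; rewrite -eigenvalue_root_char => /eigenvalueP[v vM v0].
pose N := \sum_i v 0 i * conjc (v 0 i).
have N0 : N != 0.
  apply: contra v0 => /eqP h; apply/eqP/rowP => i; rewrite mxE.
  have /(_ i isT)/eqP := psumr_eq0P (fun i _ => mulcJ_ge0 (v 0 i)) h.
  by rewrite mulf_eq0 conjc_eq0 orbb => /eqP.
pose Q := \sum_i \sum_j v 0 i * (M i j)%:C%C * conjc (v 0 j).
have QzN : Q = z * N.
  rewrite /Q exchange_big mulr_sumr /=; apply: eq_bigr => j _.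
  rewrite -mulr_suml mulrA; congr (_ * _).
  by have /rowP/(_ j) := vM; rewrite !mxE => <-; apply: eq_bigr => i _; rewrite mxE.
have conjQ : conjc Q = Q.
  rewrite /Q rmorph_sum exchange_big /=; apply: eq_bigr => i _.
  rewrite rmorph_sum /=; apply: eq_bigr => j _.
  have cM (x y : C) : conjc (x * y) = conjc x * conjc y by exact: rmorphM.
  rewrite !cM conjcK conjc_real [LHS]mulrC [conjc _ * _]mulrC mulrA.
  by rewrite -[in LHS]sM mxE.
have conjN : conjc N = N.
  rewrite /N rmorph_sum; apply: eq_bigr => i _ /=.
  by rewrite rmorphM /= conjcK mulrC.
have zz : conjc z = z by apply: (mulIf N0); rewrite -QzN -{1}conjN -rmorphM -QzN.
case: z zz {vM QzN} => a b [] /eqP; rewrite eq_sym -addr_eq0 -mulr2n mulrn_eq0 /=.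
by move/eqP.
Qed.

Lemma esf_shift_real n k (M : 'M[R]_n) (s : C) : M^T = M -> (1 <= k <= n)%N ->
  esf k (M^C + s%:M) = 0 -> complex.Im s = 0.
Proof.
move=> sM /andP[k1 kn] /eqP; rewrite esf_shift mulf_eq0 signr_eq0 /= => h.
have := @real_rooted_nderivn R (char_poly M^C) (n - k) _ _ (- s) h.
rewrite size_char_poly raddfN /= => H; apply/eqP; rewrite -oppr_eq0.
by apply/eqP/H; [lia | exact: symmetric_real_rooted].
Qed.

(** The condition of the cone on coefficients of the characteristic polynomial, which
    vary continuously with the matrix, instead of on eigenvalues. *)
Definition in_cone n k (M : 'M[R]_n) :=
  M^T = M /\ forall j, (1 <= j <= k)%N -> 0 < esf j M.

(** The Taylor coefficients of [s |-> esf k (M + s)] at 0 are nonnegative multiples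
    of the [esf j M] with [j <= k]. *)
Lemma esf_shift_pos n k (M : 'M[R]_n) (s : R) : (k <= n)%N ->
  in_cone k M -> 0 <= s -> 0 < esf k (M + s%:M).
Proof.
move=> kn [_ hM] s0; rewrite esf_shift.
rewrite (@horner_coef_wide _ k.+1); last first.
  have := size_char_poly M; set p := char_poly M => sp.
  apply/leq_sizeP => j kj; rewrite coef_nderivn nth_default ?mul0rn // sp; lia.
rewrite mulr_sumr big_ord_recl /= expr0 mulr1 ltr_wpDr //; last first.
  rewrite coef_nderivn addn0 binn mulr1n -/(esf k M).
  have [->|k0] := posnP k; first by rewrite esf0.
  by apply: hM; rewrite k0 leqnn.
apply: sumr_ge0 => i _; rewrite coef_nderivn mulrnAl mulrnAr mulrn_wge0 //.
rewrite /bump /= add1n; have ik : (i.+1 <= k)%N by [].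
have -> : (n - k + i.+1 = n - (k - i.+1))%N by lia.
have -> : (-1) ^+ k * ((char_poly M)`_(n - (k - i.+1)) * (- s) ^+ i.+1) =
    esf (k - i.+1) M * s ^+ i.+1.
  have E : (-1) ^+ k = (-1) ^+ (k - i.+1) * (-1) ^+ i.+1 :> R.
    by rewrite -exprD subnK.
  rewrite /esf {}E [(- s) ^+ _]exprNn; set c := (-1) ^+ (k - i.+1).
  have := sqrr_sign R i.+1; set e := (-1) ^+ i.+1 => ee.
  by rewrite -[RHS]mulr1 -ee; move: (s ^+ _) (_`__) => y x; ring.
rewrite mulr_ge0 ?exprn_ge0 //.
have [->|k0] := posnP (k - i.+1)%N; first by rewrite esf0.
by apply/ltW/hM; lia.
Qed.
End SymmetricPencils.

#[global] Opaque esf.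

(** * Continuation of roots *)

Section RootContinuation.
Variable R : realType.
Local Notation C := R[i].
Local Notation toC := (real_complex R).
Local Notation normc := (@Normc.normc R).

(** The unit interval is connected. *)
Lemma locally_constant_segment (S : R -> Prop) :
  (forall a, 0 <= a <= 1 -> exists2 d : R, 0 < d &
     forall b, 0 <= b <= 1 -> `|b - a| < d -> (S a <-> S b)) ->
  S 0 -> S 1.
Proof.
move=> loc S0.
pose E : set R := [set a | 0 <= a <= 1 /\ forall b, 0 <= b <= a -> S b].
have E0 : E 0 by split=> [|b]; [lra | move=> ?; have -> : b = 0 by lra].
have supE : has_sup E by split; [exists 0 | exists 1 => a [? _]; lra].
have T01 : 0 <= sup E <= 1.
  by rewrite (ub_le_sup supE.2 E0) /=; apply: ge_sup; [exists 0|move=> a [? _]; lra].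
have [d d0 hd] := loc _ T01.
have [a [a01 Ea] aT] := sup_adherent d0 supE.
have aT' : a <= sup E by apply: ub_le_sup => //; exact: supE.2.
have ST : S (sup E).
  apply/(hd a a01); last by apply: Ea; lra.
  by rewrite distrC ger0_norm; lra.
pose b := Num.min 1 (sup E + d / 2).
have [b1 bT] : b <= 1 /\ b <= sup E + d / 2 by rewrite /b; split; rewrite ge_min lexx ?orbT.
have Eb : E b.
  have b0 : 0 <= b by rewrite /b le_min; apply/andP; split; lra.
  split=> [|c /andP[c0 cb]]; first by rewrite b0.
  have [ca|ac] := leP c a; first by apply: Ea; rewrite c0.
  by apply/(hd c) => //; [lra | rewrite ltr_norml; lra].
have : b <= sup E by apply: ub_le_sup => //; exact: supE.2.
rewrite /b ge_min => /orP[h|]; last by lra.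
by have <- : sup E = 1 by lra.
Qed.

Lemma normc_real (a : R) : normc (toC a) = `|a|.
Proof. by rewrite /Normc.normc /= expr0n addr0 sqrtr_sqr. Qed.

Lemma normc_ge0 z : 0 <= normc z.
Proof. by case: z => a b /=; rewrite sqrtr_ge0. Qed.

Lemma normcX z k : normc (z ^+ k) = normc z ^+ k.
Proof. by elim: k => [|k IH]; rewrite ?expr0 ?Normc.normc1 // !exprS Normc.normcM IH. Qed.

Lemma normc_ge_Im (z : C) : `|complex.Im z| <= normc z.
Proof.
case: z => a b /=; rewrite -[X in X <= _]ger0_norm // -sqrtr_sqr.
by rewrite ler_sqrt ?real_normK ?num_real ?lerDr ?addr_ge0 ?sqr_ge0.
Qed.

Lemma normcB_triangle (x y : C) : normc x <= normc (x - y) + normc y.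
Proof. by rewrite -{1}(subrK y x); exact: le_normcD. Qed.

Lemma normc_sum (I : Type) (r : seq I) (F : I -> C) :
  normc (\sum_(i <- r) F i) <= \sum_(i <- r) normc (F i).
Proof.
elim: r => [|i r IH]; first by rewrite !big_nil Normc.normc0.
by rewrite !big_cons; apply: le_trans (le_normcD _ _) _; rewrite lerD2l.
Qed.

Lemma poly_lipschitz_segment (p : {poly C}) : exists2 L : R, 0 <= L &
  forall a b : R, 0 <= a <= 1 -> 0 <= b <= 1 ->
    normc (p.[toC a] - p.[toC b]) <= L * `|a - b|.
Proof.
suff [B [L [B0 L0 _ h]]] : exists B L : R, [/\ 0 <= B, 0 <= L,
   forall a, 0 <= a <= 1 -> normc p.[toC a] <= B &
  forall a b : R, 0 <= a <= 1 -> 0 <= b <= 1 ->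
    normc (p.[toC a] - p.[toC b]) <= L * `|a - b|] by exists L.
elim/poly_ind: p => [|p c [B [L [B0 L0 hB hL]]]].
  by exists 0, 0; split => // *; rewrite !horner0 ?subrr Normc.normc0 ?mul0r.
exists (B + normc c), (L + B); split.
- by rewrite addr_ge0 ?normc_ge0.
- by rewrite addr_ge0.
- move=> a a01; rewrite hornerMXaddC; apply: le_trans (le_normcD _ _) _.
  rewrite lerD2r Normc.normcM normc_real; have := hB a a01.
  have := normc_ge0 p.[toC a]; rewrite ger0_norm; last by lra.
  by move: (normc _) => x; nra.
- move=> a b a01 b01; rewrite !hornerMXaddC.
  have -> : p.[toC a] * toC a + c - (p.[toC b] * toC b + c) =
    (p.[toC a] - p.[toC b]) * toC a + p.[toC b] * toC (a - b).
    by rewrite rmorphB /=; ring.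
  apply: le_trans (le_normcD _ _) _; rewrite [leRHS]mulrDl lerD //.
    rewrite Normc.normcM normc_real (ger0_norm (x := a)); last by lra.
    have := hL a b a01 b01; have := normc_ge0 (p.[toC a] - p.[toC b]).
    by move: (normc _) => x; nra.
  by rewrite Normc.normcM normc_real ler_wpM2r // hB.
Qed.

Lemma poly_family_lipschitz (P : {poly {poly C}}) k (p : R -> {poly C}) :
  (forall a, p a = map_poly (horner_eval (toC a)) P) ->
  (forall a, (size (p a) <= k.+1)%N) ->
  exists2 L : R, 0 <= L &
  forall (a b : R) z, 0 <= a <= 1 -> 0 <= b <= 1 ->
    normc ((p a).[z] - (p b).[z]) <= L * `|a - b| * (1 + normc z) ^+ k.
Proof.
move=> PE sp.
have /choice[l hl] : forall j : 'I_k.+1, exists L : R, 0 <= L /\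
  forall a b : R, 0 <= a <= 1 -> 0 <= b <= 1 ->
    normc ((P`_j).[toC a] - (P`_j).[toC b]) <= L * `|a - b|.
  by move=> j; have [L ? ?] := poly_lipschitz_segment (P`_j); exists L.
have l0 j : 0 <= l j by have [] := hl j.
exists (\sum_j l j) => [|a b z a01 b01].
  by apply: sumr_ge0 => j _; exact: l0.
rewrite !(@horner_coef_wide _ k.+1) //.
rewrite -sumrB; apply: le_trans (normc_sum _ _) _.
rewrite !mulr_suml; apply: ler_sum => j _.
rewrite -mulrBl Normc.normcM normcX !PE !coef_map /= /horner_eval.
apply: ler_pM; rewrite ?exprn_ge0 ?normc_ge0 //.
  by have [_] := hl j; apply.
have z0 := normc_ge0 z.
apply: (@le_trans _ _ ((1 + normc z) ^+ j)).
  by apply: lerXn2r; rewrite ?nnegrE ?addr_ge0 // lerDr.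
by rewrite ler_weXn2l ?lerDl // -ltnS.
Qed.

Lemma normc_sub_ge_Im (z r : C) : complex.Im r < 0 -> 0 <= complex.Im z ->
  - complex.Im r + complex.Im z <= normc (z - r).
Proof.
move=> r0 z0; apply: le_trans (normc_ge_Im _).
by case: z r r0 z0 => [a b] [c d] /= d0 b0; rewrite ger0_norm; lra.
Qed.

(** A polynomial with all its roots in the open lower half-plane is comparable to
    [(1 + |z|) ^ deg] on the closed upper one.  Being uniform up to infinity, this
    also prevents roots from coming in from there. *)
Lemma normc_prod_lower_bound (rs : seq C) :
  (forall r, r \in rs -> complex.Im r < 0) -> exists2 c : R, 0 < c &
  forall z, 0 <= complex.Im z ->
    c * (1 + normc z) ^+ size rs <= normc (\prod_(r <- rs) ('X - r%:P)).[z].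
Proof.
elim: rs => [|r rs IH] hrs.
  by exists 1 => // z _; rewrite big_nil hornerC Normc.normc1 expr0 mulr1.
have [|c c0 hc] := IH; first by move=> x xr; apply: hrs; rewrite inE xr orbT.
have d0 : 0 < - complex.Im r by rewrite oppr_gt0 hrs ?mem_head.
set d := - complex.Im r in d0; pose K := 1 + (1 + normc r) / d.
have K0 : 0 < K by rewrite /K ltr_pwDl // divr_ge0 ?(ltW d0) // addr_ge0 // normc_ge0.
exists (K^-1 * c) => [|z z0]; first by rewrite mulr_gt0 ?invr_gt0.
rewrite big_cons hornerM hornerXsubC Normc.normcM exprS mulrACA.
have z1 : 0 <= 1 + normc z by rewrite addr_ge0 // normc_ge0.
apply: ler_pM; [by rewrite mulr_ge0 ?invr_ge0 ?(ltW K0) | | | exact: hc].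
  by rewrite mulr_ge0 ?(ltW c0) ?exprn_ge0.
rewrite ler_pdivrMl //.
have zr : d <= normc (z - r).
  by apply: le_trans (normc_sub_ge_Im _ z0); rewrite ?hrs ?mem_head // /d lerDl.
have : 1 + normc r <= (1 + normc r) / d * normc (z - r).
  by rewrite mulrAC ler_pdivlMr // ler_wpM2l ?addr_ge0 ?normc_ge0.
have := normcB_triangle z r; rewrite /K; move: (_ / d) => x; nra.
Qed.

(** The real axis separates the roots: along a path of polynomials of constant
    degree without real roots, no root can move from the lower to the upper
    half-plane. *)
Lemma half_plane_continuation (p : R -> {poly C}) k (c : C) (L : R) :
  c != 0 ->
  (forall a, exists2 rs : seq C, size rs = k &
     p a = c *: \prod_(z <- rs) ('X - z%:P)) ->
  0 <= L ->
  (forall (a b : R) z, 0 <= a <= 1 -> 0 <= b <= 1 ->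
    normc ((p a).[z] - (p b).[z]) <= L * `|a - b| * (1 + normc z) ^+ k) ->
  (forall (a : R) t, 0 <= a <= 1 -> root (p a) t -> complex.Im t != 0) ->
  (forall t, root (p 0) t -> complex.Im t < 0) ->
  forall t, root (p 1) t -> complex.Im t < 0.
Proof.
move=> A0 fac L0 hL noreal h0.
pose S (a : R) := forall t, root (p a) t -> complex.Im t < 0.
apply: (@locally_constant_segment S) => // a a01.
have lc0 : 0 < normc c.
  rewrite lt_neqAle normc_ge0 andbT eq_sym; apply: contra A0 => /eqP h.
  by apply/eqP/Normc.eq0_normc.
have [Sa|Sa] := pselect (S a).
- have [rs srs E] := fac a.
  have [|e e0 he] := @normc_prod_lower_bound rs.
    by move=> r rr; apply: Sa; rewrite E rootZ // root_prod_XsubC.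
  exists (normc c * e / (L + 1)) => [|b b01 ab].
    by rewrite divr_gt0 ?mulr_gt0 // ltr_wpDl.
  split=> // _ t rt; rewrite ltNge; apply/negP => t0.
  have := hL a b t a01 b01; rewrite (eqP rt) subr0 E hornerZ Normc.normcM.
  apply/negP; rewrite -ltNge.
  apply: (@lt_le_trans _ _ (normc c * (e * (1 + normc t) ^+ k))); last first.
    by rewrite -srs ler_wpM2l ?normc_ge0 // he.
  rewrite mulrA ltr_pM2r; last by rewrite exprn_gt0 // ltr_pwDl // normc_ge0.
  move: ab; rewrite distrC ltr_pdivlMr ?ltr_wpDl // => ab.
  by apply: le_lt_trans ab; rewrite mulrC ler_wpM2l // lerDl.
(* A root in the open upper half-plane also persists: otherwise the factors of the
   nearby polynomial are all at least as large there as the height of the root. *)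
- have [t [rt /negP t0]] : exists t, root (p a) t /\ ~ (complex.Im t < 0).
    by apply: contrapT => h; apply: Sa => t rt; apply: contrapT => ?; apply: h; exists t.
  have {}t0 : 0 < complex.Im t.
    by rewrite lt_neqAle eq_sym (noreal a) //= leNgt.
  have K0 : 0 < (1 + normc t) ^+ k by rewrite exprn_gt0 // ltr_pwDl // normc_ge0.
  exists (normc c * complex.Im t ^+ k / ((L + 1) * (1 + normc t) ^+ k)).
    by rewrite divr_gt0 ?mulr_gt0 // ?exprn_gt0 // ltr_wpDl.
  move=> b b01 ab; split=> // Sb; exfalso.
  have [rs srs E] := fac b.
  have := hL b a t b01 a01; rewrite (eqP rt) subr0 E hornerZ Normc.normcM.
  apply/negP; rewrite -ltNge.
  apply: (@lt_le_trans _ _ (normc c * complex.Im t ^+ k)).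
    move: ab; rewrite ltr_pdivlMr ?mulr_gt0 ?ltr_wpDl // => ab.
    apply: le_lt_trans ab; rewrite mulrA ler_wpM2r ?(ltW K0) //.
    by rewrite mulrC ler_wpM2l // lerDl.
  rewrite ler_wpM2l ?normc_ge0 // -srs.
  have {E} : forall r, r \in rs -> complex.Im r < 0.
    by move=> r rr; apply: Sb; rewrite E rootZ // root_prod_XsubC.
  elim: rs {srs} => [|r rs IH] hrs.
    by rewrite expr0 big_nil hornerC Normc.normc1.
  rewrite big_cons hornerM hornerXsubC Normc.normcM exprS.
  have t0' := ltW t0; have r0 := hrs r (mem_head _ _).
  apply: ler_pM; rewrite ?exprn_ge0 //.
    by apply: le_trans (normc_sub_ge_Im r0 t0'); rewrite lerDr oppr_ge0 ltW.
  by apply: IH => x xr; apply: hrs; rewrite inE xr orbT.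
Qed.

Section Path.
Variables (n k : nat) (M0 M1 A : 'M[C]_n).
Hypothesis kn : (k <= n)%N.
Local Notation path a := (pencil k (M0 + toC a *: M1) A).

Lemma pencil_path_lipschitz : exists2 L : R, 0 <= L &
  forall (a b : R) z, 0 <= a <= 1 -> 0 <= b <= 1 ->
    normc ((path a).[z] - (path b).[z]) <= L * `|a - b| * (1 + normc z) ^+ k.
Proof.
pose P := pencil k (map_mx polyC M0 + 'X *: map_mx polyC M1) (map_mx polyC A).
apply: (@poly_family_lipschitz P k (fun a => path a)) => a; last exact: size_pencil.
rewrite /P /pencil -(esf_map (map_poly (horner_eval (toC a)))).
congr (esf k _); apply/matrixP => i j; rewrite !mxE.
rewrite [RHS]rmorphD [X in _ = _ + X]rmorphM /= map_polyX !map_polyC /= /horner_eval.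
by rewrite hornerD hornerM hornerX !hornerC.
Qed.

Lemma root_continuation : esf k A != 0 ->
  (forall (a : R) t, 0 <= a <= 1 -> root (path a) t -> complex.Im t != 0) ->
  (forall t, root (path 0) t -> complex.Im t < 0) ->
  forall t, root (path 1) t -> complex.Im t < 0.
Proof.
move=> A0; have [L L0 hL] := pencil_path_lipschitz.
apply: (@half_plane_continuation (fun a => path a) k (esf k A) L) => // a.
by apply: pencil_factor => //; exact: closed_field_poly_normal.
Qed.

End Path.
End RootContinuation.

#[global] Opaque pencil.

(** * Hyperbolicity of the elementary symmetric functions *)

Section HyperbolicCone.
Variable R : realType.
Local Notation C := R[i].
Local Notation toC := (real_complex R).
Local Notation "M ^C" := (map_mx toC M).

Lemma complex_real_toC (z : C) : complex.Im z = 0 -> z = toC (complex.Re z).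
Proof. by case: z => a b /= ->. Qed.

Lemma Im_scale (a : R) (z : C) : complex.Im (toC a * z) = a * complex.Im z.
Proof. by case: z => x y /=; rewrite mul0r addr0. Qed.

Lemma root_pencil (T : comNzRingType) n k (M A : 'M[T]_n) t :
  root (pencil k M A) t <-> esf k (M + t *: A) = 0.
Proof. by rewrite -horner_pencil; split=> /eqP. Qed.

Lemma symmetric_split n (M : 'M[R]_n) : M^T = M ->
  exists l : 'rV[R]_n, char_poly M = \prod_(i < n) ('X - (l 0 i)%:P).
Proof.
move=> sM; have [rs E] := closed_field_poly_normal (char_poly M^C).
rewrite (monicP (char_poly_monic _)) scale1r in E.
have szrs : size rs = n.
  by have := size_char_poly M^C; rewrite E size_prod_XsubC => -[].
exists (\row_i nth 0 [seq complex.Re z | z <- rs] i).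
apply: (map_poly_inj (real_complex R)) => /=.
rewrite [LHS]map_char_poly E rmorph_prod /= (big_nth 0) szrs big_mkord.
apply: eq_bigr => i _; rewrite rmorphB /= map_polyX map_polyC /= mxE.
rewrite (nth_map 0) ?szrs // -complex_real_toC //.
apply: (symmetric_real_rooted sM); rewrite E root_prod_XsubC mem_nth ?szrs //.
Qed.

Lemma sigma_pos n j (l : 'rV[R]_n) : (j <= n)%N -> (forall i, 0 < l 0 i) ->
  0 < sigma j l.
Proof.
move=> jn l0; have [S0 S0j] : exists S : {set 'I_n}, #|S| == j.
  exists [set i : 'I_n | (i < j)%N]%SET.
  have -> : [set i : 'I_n | (i < j)%N]%SET = [set widen_ord jn i | i : 'I_j]%SET.
    apply/setP => i; rewrite inE; apply/idP/imsetP => [ij|[i' _ ->]]; last exact: (ltn_ord i').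
    by exists (Ordinal ij) => //; apply: val_inj.
  by rewrite card_imset ?card_ord // => a b /(congr1 val) /= ?; apply: val_inj.
rewrite /sigma (bigD1 S0) //= ltr_pwDl ?prodr_gt0 // sumr_ge0 // => S _.
by apply: prodr_ge0 => i _; rewrite ltW.
Qed.

Lemma posdef_in_cone n k (M : 'M[R]_n) : (k <= n)%N -> M^T = M ->
  (forall v, v != 0 -> 0 < dotv (v *m M) v) -> in_cone k M.
Proof.
move=> kn sM pM; split=> // j /andP[j1 jk].
have [l E] := symmetric_split sM.
rewrite (esf_sigma _ E) ?(leq_trans jk) //; apply: sigma_pos; first by lia.
move=> i; have : eigenvalue M (l 0 i).
  rewrite eigenvalue_root_char E; apply/rootP; rewrite horner_prod.
  by rewrite (bigD1 i) //= hornerXsubC subrr mul0r.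
move=> /eigenvalueP[v vM v0]; have := pM _ v0.
by rewrite vM dotvZl pmulr_lgt0 // dotvv_gt0.
Qed.

Lemma psd_shift_in_cone n k (M : 'M[R]_n) e : (k <= n)%N -> M^T = M -> 0 < e ->
  (forall v, 0 <= dotv (v *m M) v) -> in_cone k (M + e%:M).
Proof.
move=> kn sM e0 pM; apply: posdef_in_cone => // [|v v0].
  by rewrite linearD /= sM tr_scalar_mx.
by rewrite mulmxDr mul_mx_scalar dotvDl dotvZl ltr_wpDl ?pM // mulr_gt0 // dotvv_gt0.
Qed.

Lemma scalar1_in_cone n k : (k <= n)%N -> in_cone k (1%:M : 'M[R]_n).
Proof.
move=> kn; rewrite -[1%:M]add0r; apply: psd_shift_in_cone; rewrite ?trmx0 //.
by move=> v; rewrite mulmx0 dotv0l.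
Qed.

Lemma in_cone_scale n k (M : 'M[R]_n) c : (k <= n)%N -> 0 < c -> in_cone k M ->
  in_cone k (c *: M).
Proof.
move=> kn c0 [sM hM]; split=> [|j /andP[j1 jk]]; first by rewrite linearZ /= sM.
rewrite esf_scale ?(leq_trans jk) ?gt_eqF //.
by rewrite mulr_gt0 ?exprn_gt0 // hM // j1.
Qed.

Lemma in_cone_open n k (M : 'M[R]_n) : in_cone k M ->
  exists2 e : R, 0 < e & in_cone k (M - e%:M).
Proof.
move=> [sM hM].
suff [e e0 he] : exists2 e : R, 0 < e & forall x, 0 < x < e ->
    forall j, (1 <= j <= k)%N -> 0 < esf j (M + (- x)%:M).
  exists (e / 2); first by rewrite divr_gt0.
  split=> [|j jk]; first by rewrite linearB /= sM tr_scalar_mx.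
  by rewrite -raddfN /=; apply: he => //; lra.
elim: k hM => [|k IH] hM.
  by exists 1 => // x _ j /andP[]; case: j.
have [|e e0 he] := IH; first by move=> j /andP[j1 jk]; apply: hM; rewrite j1 leqW.
pose p := (-1) ^+ k.+1 *: (char_poly M)^`N(n - k.+1).
have pE x : esf k.+1 (M + (- x)%:M) = p.[x].
  by rewrite esf_shift opprK hornerZ.
have p0 : 0 < p.[0] by rewrite -pE oppr0 raddf0 addr0 hM // leqnn andbT.
have := @continuous_horner R p 0; move=> /cvgr_gt -/(_ _ p0) /nbhs_ballP[d /= d0 hd].
exists (Num.min e d); first by rewrite lt_min e0.
move=> x /andP[x0]; rewrite lt_min => /andP[xe xd] j /andP[j1].
rewrite leq_eqVlt => /orP[/eqP ->|jk]; last by apply: he; rewrite ?x0 ?j1.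
rewrite pE; apply: hd; rewrite /ball /= sub0r normrN ger0_norm //; exact: ltW.
Qed.

Section Hyperbolicity.
Variables (n k : nat).
Hypothesis hk : (1 <= k <= n)%N.
Let kn : (k <= n)%N. Proof. by case/andP: hk. Qed.

Lemma in_cone_esf (A : 'M[R]_n) : in_cone k A -> 0 < esf k A.
Proof. by case=> _; apply; case/andP: hk => ->; rewrite leqnn. Qed.

Lemma esfC_neq0 (A : 'M[R]_n) : esf k A != 0 -> esf k A^C != 0.
Proof. by rewrite esf_map fmorph_eq0. Qed.

Lemma cone_shift_root (A : 'M[R]_n) (s : C) : in_cone k A ->
  esf k (A^C + s%:M) = 0 -> complex.Im s = 0 /\ complex.Re s < 0.
Proof.
move=> cA h; have [sA _] := cA.
have Is := esf_shift_real sA hk h; split=> //; rewrite ltNge; apply/negP => s0.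
move: h; rewrite (complex_real_toC Is) -map_scalar_mx -map_mxD esf_map => /complexI h.
by have := esf_shift_pos kn cA s0; rewrite h ltxx.
Qed.

Lemma esf_scalar_neq0 (s : C) : complex.Im s != 0 -> esf k (s%:M : 'M[C]_n) != 0.
Proof.
apply: contra => /eqP h; apply/eqP.
by have := @esf_shift_real R n k 0 s (trmx0 _ _ _) hk; rewrite map_mx0 add0r; apply.
Qed.

Lemma esf_pencil_inv (X A : 'M[C]_n) (t : C) : t != 0 ->
  esf k (X + t *: A) = 0 -> esf k (A + t^-1 *: X) = 0.
Proof.
move=> t0; have -> : X + t *: A = t *: (A + t^-1 *: X).
  by rewrite scalerDr scalerA divff // scale1r addrC.
by rewrite esf_scale // => /eqP; rewrite mulf_eq0 expf_eq0 (negPf t0) andbF => /eqP.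
Qed.

(** Continuation from [s] to [X + s] for the pencils in direction [A].  A real root on
    the way would exhibit the non-real [s] as a shift root of a real symmetric
    matrix. *)
Lemma esf_upper_half_planes (X A : 'M[R]_n) (s t : C) :
  X^T = X -> in_cone k A -> 0 < complex.Im s -> 0 <= complex.Im t ->
  esf k (X^C + s%:M + t *: A^C) != 0.
Proof.
move=> sX cA s0 t0; have [sA _] := cA; apply/negP => /eqP h.
suff : complex.Im t < 0 by rewrite ltNge t0.
have := @root_continuation R n k s%:M X^C A^C kn; apply.
- by rewrite esfC_neq0 // gt_eqF // in_cone_esf.
- move=> a t' a01 /root_pencil h'; apply/negP => /eqP It.
  have : complex.Im s = 0.
    have sXA : (a *: X + complex.Re t' *: A)^T = a *: X + complex.Re t' *: A.
      by rewrite linearD /= !linearZ /= sX sA.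
    apply: (esf_shift_real sXA hk).
    by rewrite map_mxD !map_mxZ /= -(complex_real_toC It) addrC addrA.
  by move=> Is; rewrite Is ltxx in s0.
- move=> t' /root_pencil; rewrite scale0r addr0 => h'.
  have [t'0|t'0] := eqVneq t' 0.
    move: h'; rewrite t'0 scale0r addr0 => /eqP.
    by rewrite (negPf (esf_scalar_neq0 _)) // gt_eqF.
  have := esf_pencil_inv t'0 h'; rewrite scale_scalar_mx => /(cone_shift_root cA)[Iu Ru].
  have -> : t' = toC (complex.Re (t'^-1 * s))^-1 * s.
    rewrite fmorphV /= -(complex_real_toC Iu) invfM invrK mulfVK //.
    by apply: contraL s0 => /eqP ->; rewrite ltxx.
  by rewrite Im_scale nmulr_rlt0 ?invr_lt0.
- by apply/root_pencil; rewrite scale1r [s%:M + _]addrC.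
Qed.

(** Every symmetric direction sees only real roots: moving the base point from
    the identity to any other point of the cone does not change this. *)
Lemma pencil_real_roots (X A : 'M[R]_n) (t : C) :
  X^T = X -> in_cone k A -> esf k (X^C + t *: A^C) = 0 -> complex.Im t = 0.
Proof.
move=> sX cA; have [e e0 cAe] := in_cone_open cA.
have pos u : 0 < complex.Im u -> esf k (X^C + u *: A^C) != 0.
  move=> u0; have := @esf_upper_half_planes X (A - e%:M) (toC e * u) u sX cAe.
  rewrite Im_scale mulr_gt0 // => /(_ isT (ltW u0)).
  suff -> : X^C + (toC e * u)%:M + u *: (A - e%:M)^C = X^C + u *: A^C by [].
  rewrite -addrA map_mxB map_scalar_mx /= scalerBr scale_scalar_mx mulrC.
  by rewrite [_%:M + _]addrC subrK.
move=> h; apply/eqP; rewrite eq_le !leNgt; apply/andP; split; apply/negP => It.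
  by move: h => /eqP; apply/negP/pos.
have := pos (conjc t); case: t h It => a b h /= b0; rewrite oppr_gt0 => /(_ b0) /negP; apply.
have conjM (M : 'M[R]_n) : map_mx conjc M^C = M^C.
  by apply/matrixP => i j; rewrite !mxE; exact: conjc_real.
have -> : X^C + (a -i* b)%C *: A^C = map_mx conjc (X^C + (a +i* b)%C *: A^C).
  by rewrite map_mxD map_mxZ !conjM.
by rewrite esf_map h rmorph0.
Qed.

Lemma esf_convex_pos (A : 'M[R]_n) a : in_cone k A -> 0 <= a <= 1 ->
  0 < esf k (1%:M + a *: (A - 1%:M)).
Proof.
move=> cA a01; have [->|a0] := eqVneq a 0.
  by rewrite scale0r addr0; exact: in_cone_esf (scalar1_in_cone kn).
have -> : 1%:M + a *: (A - 1%:M) = a *: (A + ((1 - a) / a)%:M).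
  apply/matrixP => i j; rewrite !mxE.
  by case: (i == j); rewrite ?mulr1n ?mulr0n; field.
have {}a0 : 0 < a by lra.
rewrite esf_scale ?gt_eqF // mulr_gt0 ?exprn_gt0 //.
by apply: esf_shift_pos => //; rewrite divr_ge0 //; lra.
Qed.

(** Continuation from the identity to [B], now with the imaginary axis as a barrier:
    a purely imaginary root would vanish by reality of the roots, and [0] is not
    a root inside the cone.  Dividing the direction by ['i] turns the left
    half-plane into the lower one. *)
Lemma pencil_negative_roots (A B : 'M[R]_n) (t : C) :
  in_cone k A -> in_cone k B -> esf k (B^C + t *: A^C) = 0 ->
  complex.Im t = 0 /\ complex.Re t < 0.
Proof.
move=> cA cB ht; have [sA _] := cA; have [sB _] := cB.
split; first exact: pencil_real_roots ht.
have i0 : 'i%C != 0 :> C by apply/eqP => /(congr1 (fun z : C => complex.Im z)) /= /eqP; rewrite oner_eq0.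
have ImiM (z : C) : complex.Im ('i%C * z) = complex.Re z.
  by case: z => x y /=; rewrite mul0r add0r mul1r.
rewrite -ImiM.
have rot (X : 'M[C]_n) u : X + ('i%C * u) *: (('i%C)^-1 *: A^C) = X + u *: A^C.
  by rewrite scalerA mulrAC (divff i0) mul1r.
have rot' (X : 'M[C]_n) u : X + u *: (('i%C)^-1 *: A^C) = X + (('i%C)^-1 * u) *: A^C.
  by rewrite scalerA mulrC.
have := @root_continuation R n k 1%:M (B - 1%:M)^C (('i%C)^-1 *: A^C) kn; apply.
- by rewrite esf_scale ?invr_eq0 // mulf_neq0 ?expf_neq0 ?invr_eq0 // esfC_neq0 // gt_eqF // in_cone_esf.
- move=> a t' a01 /root_pencil; rewrite rot' => h'; apply/negP => /eqP It.
  move: It h'; pose w := ('i%C)^-1 * t'; rewrite -/w => + h'; rewrite -[t']mul1r -(divff i0) -mulrA -/w ImiM => Rw.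
  have sM : (1%:M + a *: (B - 1%:M))^T = 1%:M + a *: (B - 1%:M).
    by rewrite linearD linearZ linearB /= sB trmx1.
  have h2 : esf k ((1%:M + a *: (B - 1%:M))^C + w *: A^C) = 0.
    by rewrite map_mxD map_mxZ map_scalar_mx.
  have Iw := pencil_real_roots sM cA h2.
  have w0 : w = 0 by rewrite (complex_real_toC Iw) Rw.
  move: h2; rewrite w0 scale0r addr0 => /eqP; apply/negP/esfC_neq0.
  by rewrite gt_eqF // esf_convex_pos.
- move=> t' /root_pencil; rewrite scale0r addr0 rot'; set w := _ * t' => h'.
  rewrite -[t']mul1r -(divff i0) -mulrA -/w ImiM.
  have w0 : w != 0.
    apply/eqP => w0; move: h'; rewrite w0 scale0r addr0 -(map_scalar_mx (real_complex R)) => /eqP.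
    apply/negP/esfC_neq0; exact: lt0r_neq0 (in_cone_esf (scalar1_in_cone kn)).
  have := esf_pencil_inv w0 h'; rewrite scale_scalar_mx mulr1.
  move=> /(cone_shift_root cA)[Iu Ru].
  have -> : w = toC (complex.Re w^-1)^-1 by rewrite fmorphV /= -(complex_real_toC Iu) invrK.
  by rewrite /= invr_lt0.
- by apply/root_pencil; rewrite rot scale1r map_mxB map_scalar_mx [1%:M + _]addrC subrK.
Qed.

End Hyperbolicity.
End HyperbolicCone.

(** * Garding's inequality and strict ellipticity *)

Section GardingInequality.
Variables (R : realType) (n k : nat).
Hypothesis hk : (1 <= k <= n)%N.
Local Notation C := R[i].
Local Notation toC := (real_complex R).
Local Notation "M ^C" := (map_mx toC M).
Let kn : (k <= n)%N. Proof. by case/andP: hk. Qed.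

Lemma esf_pencil_factor (A B : 'M[R]_n) : in_cone k A -> in_cone k B ->
  exists r : seq R, [/\ size r = k, all (fun x => 0 < x) r &
    forall t, esf k (B + t *: A) = esf k A * \prod_(x <- r) (t + x)].
Proof.
move=> cA cB; have A0 := in_cone_esf hk cA.
have A0' : esf k A^C != 0 by rewrite esfC_neq0 // lt0r_neq0.
have [rs srs E] := pencil_factor B^C (@closed_field_poly_normal _) kn A0'.
have rsP z : z \in rs -> complex.Im z = 0 /\ complex.Re z < 0.
  move=> zrs; apply: (pencil_negative_roots hk cA cB); apply/root_pencil.
  by rewrite E rootZ // root_prod_XsubC.
exists [seq - complex.Re z | z <- rs]; split.
- by rewrite size_map.
- by apply/allP => x /mapP[z /rsP[_ z0] ->]; rewrite oppr_gt0.
- move=> t; apply: (@complexI R); rewrite -!esf_map map_mxD map_mxZ -horner_pencil E.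
  rewrite hornerZ rmorphM /= esf_map; congr (_ * _).
  rewrite horner_prod rmorph_prod /= big_map big_seq [RHS]big_seq; apply: eq_bigr => z /rsP[Iz _].
  by rewrite hornerXsubC rmorphD rmorphN /= -(complex_real_toC Iz).
Qed.

Lemma expr_size_prod (I : Type) (r : seq I) (F : I -> R) t :
  t ^+ size r * \prod_(i <- r) F i = \prod_(i <- r) (t * F i).
Proof.
elim: r => [|i r IH]; first by rewrite !big_nil mulr1.
by rewrite !big_cons -IH /= exprS mulrACA.
Qed.

Lemma esf_convex_comb_factor (A B : 'M[R]_n) : in_cone k A -> in_cone k B ->
  exists r : seq R, [/\ size r = k, all (fun x => 0 < x) r,
    esf k B = esf k A * \prod_(x <- r) x &
    forall t, esf k (A + t *: (B - A)) = esf k A * \prod_(x <- r) (1 + t * (x - 1))].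
Proof.
move=> cA cB; have [r [sr r0 hr]] := esf_pencil_factor cA cB.
exists r; split => //.
  have := hr 0; rewrite scale0r addr0 => ->; congr (_ * _).
  by apply: eq_bigr => x _; rewrite add0r.
move=> t; have [->|t0] := eqVneq t 0.
  by rewrite scale0r addr0 big1 ?mulr1 // => x _; rewrite mul0r addr0.
have -> : A + t *: (B - A) = t *: (B + ((1 - t) / t) *: A).
  by apply/matrixP => i j; rewrite !mxE; field.
rewrite esf_scale // hr mulrCA -sr expr_size_prod; congr (_ * _).
by apply: eq_bigr => x _; field.
Qed.

(** The arithmetic-geometric mean inequality, from [1 + y <= exp y]. *)
Lemma sum_ge_size_of_prod_ge1 (r : seq R) : all (fun x => 0 < x) r ->
  1 <= \prod_(x <- r) x -> 0 <= \sum_(x <- r) (x - 1).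
Proof.
move=> r0; rewrite [0 <= _]leNgt -expR_lt1 -leNgt => /le_trans; apply.
elim: r r0 => [|x r IH] /=; first by rewrite !big_nil expR0.
move=> /andP[x0 r0]; rewrite !big_cons expRD ler_pM ?(ltW x0) ?IH //.
  rewrite big_seq prodr_ge0 // => y yr; exact/ltW/(allP r0).
by have := expR_ge1Dx (x - 1); lra.
Qed.

(** On the segment from [A] to [B] the function is a product of the [k] positive
    affine factors [1 + t (x - 1)], the [x] having product at least 1; its
    derivative at 0 is the sum of the [x - 1].  This is the concavity of the k-th
    root of [esf k] on the cone, as seen from the level set [esf k = 1]. *)
Lemma garding (A B : 'M[R]_n) : in_cone k A -> in_cone k B ->
  esf k A = 1 -> 1 <= esf k B -> 0 <= (pencil k A (B - A))^`().[0].
Proof.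
move=> cA cB A1 B1; have [r [sr r0 EB hr]] := esf_convex_comb_factor cA cB.
have -> : pencil k A (B - A) = \prod_(x <- r) (1 + 'X * (x - 1)%:P).
  apply: poly_eq_nat => m; rewrite horner_pencil hr A1 mul1r horner_prod.
  by apply: eq_bigr => x _; rewrite !hornerE.
have -> : (\prod_(x <- r) (1 + 'X * (x - 1)%:P))^`().[0] = \sum_(x <- r) (x - 1).
  elim: r {sr r0 EB hr} => [|x r IH]; first by rewrite !big_nil derivC horner0.
  rewrite !big_cons derivM hornerD !hornerM IH.
  rewrite derivD derivC derivM derivX derivC mulr0 addr0 add0r mul1r !hornerE.
  by rewrite horner_prod big1 ?mulr1 // => y _; rewrite !hornerE.
by apply: sum_ge_size_of_prod_ge1 => //; move: B1; rewrite EB A1 mul1r.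
Qed.

Lemma map_pencil (M B : 'M[R]_n) : map_poly toC (pencil k M B) = pencil k M^C B^C.
Proof.
apply: poly_eq_nat => m; rewrite horner_pencil -(rmorph_nat toC) horner_map /=.
by rewrite horner_pencil -map_mxZ -map_mxD esf_map.
Qed.

Lemma pencil_scalar_coef (M : 'M[R]_n) :
  (pencil k M 1%:M)`_k.-1 = \tr M *+ 'C(n.-1, n - k).
Proof.
have -> : pencil k M 1%:M = (-1) ^+ k *: ((char_poly M)^`N(n - k) \Po (-1 *: 'X)).
  apply: poly_eq_nat => m; rewrite horner_pencil scale_scalar_mx mulr1 esf_shift.
  by rewrite hornerZ horner_comp hornerZ hornerX mulN1r.
rewrite coefZ coef_comp_scaleX coef_nderivn.
have -> : (n - k + k.-1 = n.-1)%N by lia.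
have n0 : (0 < n)%N by lia.
rewrite char_poly_trace // -[X in (-1) ^+ X](@prednK k); last by case/andP: hk.
by rewrite exprS mulN1r mulNr mulrCA -expr2 sqrr_sign mulr1 mulNrn opprK.
Qed.

(** The sum of the shift roots is a negative multiple of the trace. *)
Lemma trace_pos_of_shift_roots (M : 'M[R]_n) :
  (forall u : C, esf k (M^C + u%:M) = 0 -> complex.Im u = 0 /\ complex.Re u < 0) ->
  0 < \tr M.
Proof.
move=> hM; have c0 := in_cone_esf hk (@scalar1_in_cone R n k kn).
have c0' := esfC_neq0 (lt0r_neq0 c0).
have [rs srs E] := pencil_factor M^C (@closed_field_poly_normal _) kn c0'.
have rsP z : z \in rs -> complex.Im z = 0 /\ complex.Re z < 0.
  move=> zrs; apply: hM; have /root_pencil : root (pencil k M^C (1%:M)^C) z.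
    by rewrite E rootZ // root_prod_XsubC.
  by rewrite map_scalar_mx scale_scalar_mx mulr1.
have := congr1 (fun p : {poly C} => p`_k.-1) E.
rewrite -map_pencil coef_map /= pencil_scalar_coef esf_map coefZ -srs.
have k0 : (0 < size rs)%N by rewrite srs; case/andP: hk.
rewrite coefPn_prod_XsubC -?lt0n // => /(congr1 (fun z : C => complex.Re z)).
have -> : - \sum_(p <- rs) p = toC (\sum_(p <- rs) (- complex.Re p)).
  rewrite rmorph_sum -sumrN /= big_seq [RHS]big_seq; apply: eq_bigr => z /rsP[Iz _].
  by rewrite rmorphN /= -(complex_real_toC Iz).
rewrite -rmorphM /= => h.
have : 0 < \sum_(p <- rs) - complex.Re p.
  case: rs k0 rsP {srs E h} => // z rs _ rsP; rewrite big_cons ltr_pwDl //.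
    by rewrite oppr_gt0; case: (rsP z (mem_head _ _)).
  rewrite big_seq sumr_ge0 // => y yr; rewrite oppr_ge0 ltW //.
  by case: (rsP y); rewrite // inE yr orbT.
move=> /(mulr_gt0 c0); rewrite -[k in esf k]srs -h pmulrn_lgt0 //.
by rewrite srs bin_gt0; lia.
Qed.

Section Positivity.
Variables (A V : 'M[R]_n).
Hypotheses (cA : in_cone k A) (sV : V^T = V).
Hypothesis psdV : forall v, 0 <= dotv (v *m V) v.

(** Semidefinite directions are limits of directions in the cone: write [A + s V] as
    [(A - e) + (s V + e)]. *)
Lemma esf_psd_root (t : C) : esf k (A^C + t *: V^C) = 0 ->
  complex.Im t = 0 /\ complex.Re t < 0.
Proof.
move=> h; have t0 : t != 0.
  apply/eqP => t0; move: h; rewrite t0 scale0r addr0 => /eqP.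
  by apply/negP/esfC_neq0; exact: lt0r_neq0 (in_cone_esf hk cA).
have hinv := esf_pencil_inv hk t0 h.
have It := pencil_real_roots hk sV cA hinv.
have tE : t = toC (complex.Re t^-1)^-1 by rewrite fmorphV /= -(complex_real_toC It) invrK.
rewrite tE /=; split=> //; rewrite invr_lt0 ltNge; apply/negP => s0.
move: h; rewrite tE; set s := (complex.Re t^-1)^-1.
have {}s0 : 0 < s.
  rewrite invr_gt0 lt_neqAle s0 andbT eq_sym; apply: contra t0 => /eqP e0.
  by rewrite tE e0 invr0 rmorph0.
rewrite -map_mxZ -map_mxD esf_map => /complexI h.
have [e e0 cAe] := in_cone_open cA.
have cV : in_cone k (s *: (V + (e / s)%:M)).
  exact: in_cone_scale kn s0 (psd_shift_in_cone kn sV (divr_gt0 e0 s0) psdV).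
have [r [sr r0 hr]] := esf_pencil_factor cAe cV.
have s0' := lt0r_neq0 s0.
have := hr 1; have -> : s *: (V + (e / s)%:M) + 1 *: (A - e%:M) = A + s *: V.
  by apply/matrixP => i j; rewrite !mxE; case: (i == j); rewrite ?mulr1n ?mulr0n; field.
rewrite h => /eqP; rewrite eq_sym mulf_eq0 gt_eqF ?(in_cone_esf hk) //=.
by rewrite gt_eqF // big_seq prodr_gt0 // => x xr; rewrite ltr_wpDl ?(allP r0).
Qed.


(** If [esf k] does not vanish on the line, then no shift root can cross the imaginary
    axis on the way from [A]. *)
Lemma esf_constant_shift_root : (forall s, esf k (A + s *: V) != 0) ->
  forall (s : R) (u : C), esf k ((A + s *: V)^C + u%:M) = 0 ->
  complex.Im u = 0 /\ complex.Re u < 0.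
Proof.
move=> hV s u hu; have [sA _] := cA.
have sM a : (A + a *: V)^T = A + a *: V by rewrite linearD linearZ /= sA sV.
split; first exact: (esf_shift_real (sM s) hk hu).
have i0 : 'i%C != 0 :> C by apply/eqP => /(congr1 (fun z : C => complex.Im z)) /= /eqP; rewrite oner_eq0.
have ImiM (z : C) : complex.Im ('i%C * z) = complex.Re z.
  by case: z => x y /=; rewrite mul0r add0r mul1r.
have dirE (X : 'M[C]_n) w : X + w *: (('i%C)^-1 *: (1%:M)^C) = X + (('i%C)^-1 * w)%:M.
  by rewrite map_scalar_mx scalerA scale_scalar_mx mulr1 mulrC.
rewrite -ImiM.
have := @root_continuation R n k A^C (s *: V)^C (('i%C)^-1 *: (1%:M)^C) kn; apply.
- rewrite esf_scale ?invr_eq0 // mulf_neq0 ?expf_neq0 ?invr_eq0 // esfC_neq0 //.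
  exact: lt0r_neq0 (in_cone_esf hk (@scalar1_in_cone R n k kn)).
- move=> a t a01 /root_pencil; rewrite dirE; set w := _ * t => h.
  rewrite -[t]mul1r -(divff i0) -mulrA -/w ImiM; apply/negP => /eqP Rw.
  have EaV : A^C + toC a *: (s *: V)^C = (A + (a * s) *: V)^C.
    by rewrite -map_mxZ -map_mxD scalerA.
  rewrite EaV in h.
  have Iw := esf_shift_real (sM _) hk h.
  have w0 : w = 0 by rewrite (complex_real_toC Iw) Rw.
  move: h; rewrite w0 raddf0 addr0 => /eqP.
  by apply/negP/esfC_neq0/hV.
- move=> t /root_pencil; rewrite scale0r addr0 dirE; set w := _ * t => h.
  rewrite -[t]mul1r -(divff i0) -mulrA -/w ImiM.
  by have [] := cone_shift_root hk cA h.
- apply/root_pencil; rewrite dirE scale1r mulrA (mulVf i0) mul1r.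
  by move: hu; rewrite map_mxD.
Qed.

(** Strict ellipticity.  If the derivative in a nonzero positive semidefinite
    direction vanished, the polynomial [s |-> esf k (A + s V)] would be a
    nonzero constant, so that the whole line [A + s V] would stay inside the
    cone, which is impossible because the trace takes both signs on it. *)
Lemma pencil_psd_deriv_gt0 : 0 < \tr V -> 0 < (pencil k A V)^`().[0].
Proof.
move=> trV; pose p := pencil k A V.
have p0 : 0 < p.[0] by rewrite horner_pencil scale0r addr0 in_cone_esf.
have [rs E] := closed_field_poly_normal (map_poly toC p).
have lc0 : lead_coef (map_poly toC p) != 0.
  rewrite lead_coef_eq0 map_poly_eq0; apply: contraTneq p0 => ->.
  by rewrite horner0 ltxx.
have rsP z : z \in rs -> complex.Im z = 0 /\ complex.Re z < 0.
  move=> zrs; apply: esf_psd_root; apply/root_pencil; rewrite -map_pencil.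
  by rewrite E rootZ // root_prod_XsubC.
have rs0 : 0 \notin rs by apply/negP => /rsP[_]; rewrite ltxx.
have : (0 < size rs)%N.
  rewrite lt0n; apply/negP => /nilP rsnil; move: E; rewrite rsnil big_nil.
  move=> E; have hc s : esf k (A + s *: V) = esf k A.
    have := congr1 (fun q : {poly C} => q.[toC s]) E.
    have := congr1 (fun q : {poly C} => q.[toC 0]) E => /=.
    rewrite !horner_map /= !horner_pencil scale0r addr0 !hornerZ !hornerC => <-.
    by case.
  have hne s : esf k (A + s *: V) != 0 by rewrite hc lt0r_neq0 // in_cone_esf.
  have := trace_pos_of_shift_roots (esf_constant_shift_root hne (s := - (\tr A / \tr V))).
  by rewrite linearD linearZ /= mulNr divfK ?gt_eqF // subrr ltxx.
move=> srs.
have : (map_poly toC p)^`().[0] = (map_poly toC p).[0] * \sum_(r <- rs) (0 - r)^-1.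
  by rewrite E derivZ !hornerZ log_deriv // mulrA.
rewrite deriv_map -(rmorph0 toC) !horner_map /=.
have -> : \sum_(r <- rs) (toC 0 - r)^-1 = toC (\sum_(r <- rs) (- complex.Re r)^-1).
  rewrite rmorph_sum /= big_seq [RHS]big_seq; apply: eq_bigr => z /rsP[Iz _].
  by rewrite fmorphV rmorphN /= -(complex_real_toC Iz) rmorph0 sub0r.
rewrite -rmorphM => /complexI ->; rewrite mulr_gt0 //.
case: rs srs rsP {E rs0} => // z rs _ rsP; rewrite big_cons ltr_pwDl //.
  by rewrite invr_gt0 oppr_gt0; case: (rsP z (mem_head _ _)).
rewrite big_seq sumr_ge0 // => y yr; rewrite invr_ge0 oppr_ge0 ltW //.
by case: (rsP y); rewrite // inE yr orbT.
Qed.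

End Positivity.
End GardingInequality.

(** * The linearized operator *)

Section LinearizedOperator.
Variable R : realType.

Definition mxdot n (G B : 'M[R]_n) : R := \sum_i \sum_j G i j * B i j.

Lemma mxdotD n (G B B' : 'M[R]_n) : mxdot G (B + B') = mxdot G B + mxdot G B'.
Proof.
rewrite -big_split; apply: eq_bigr => i _; rewrite -big_split; apply: eq_bigr => j _.
by rewrite mxE mulrDr.
Qed.

Lemma mxdotZ n (G B : 'M[R]_n) c : mxdot G (c *: B) = c * mxdot G B.
Proof.
rewrite mulr_sumr; apply: eq_bigr => i _; rewrite mulr_sumr; apply: eq_bigr => j _.
by rewrite mxE mulrCA.
Qed.

Lemma mxdotB n (G B B' : 'M[R]_n) : mxdot G (B - B') = mxdot G B - mxdot G B'.
Proof. by rewrite mxdotD -scaleN1r mxdotZ mulN1r. Qed.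

Section Differentiability.
Variables (n : nat) (A : 'M[R]_n).

(** Differentiability in the matrix makes directional derivatives additive in the
    direction, which the entrywise definition of the linearization presupposes. *)
Definition coef_differentiable (P : 'M[R]_n -> {poly R}) :=
  forall m, differentiable (fun M => (P M)`_m) A.

Lemma differentiable_bigsum (I : Type) (r : seq I) (F : I -> 'M[R]_n -> R) :
  (forall i, differentiable (F i) A) ->
  differentiable (fun M => \sum_(i <- r) F i M) A.
Proof.
move=> hF; elim: r => [|i r IH].
  rewrite (_ : (fun M => _) = cst 0); first exact: differentiable_cst.
  by apply/funext => M; rewrite big_nil.
rewrite (_ : (fun M => _) = F i + (fun M => \sum_(i <- r) F i M)).
  exact: differentiableD.
by apply/funext => M; rewrite big_cons.
Qed.

Lemma coef_differentiable_sum (I : Type) (r : seq I) (P : I -> 'M[R]_n -> {poly R}) :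
  (forall i, coef_differentiable (P i)) ->
  coef_differentiable (fun M => \sum_(i <- r) P i M).
Proof.
move=> hP m; rewrite (_ : (fun M => _) = (fun M => \sum_(i <- r) (P i M)`_m)).
  by apply: differentiable_bigsum => i; exact: hP.
by apply/funext => M; rewrite coef_sum.
Qed.

Lemma coef_differentiableM (P Q : 'M[R]_n -> {poly R}) :
  coef_differentiable P -> coef_differentiable Q ->
  coef_differentiable (fun M => P M * Q M).
Proof.
move=> hP hQ m.
rewrite (_ : (fun M => _) = (fun M => \sum_(i < m.+1) (P M)`_i * (Q M)`_(m - i))).
  apply: differentiable_bigsum => i.
  by apply: (@differentiableM _ _ (fun M => (P M)`_i) (fun M => (Q M)`_(m - i))); [exact: hP|exact: hQ].
by apply/funext => M; rewrite coefM.
Qed.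

Lemma coef_differentiable_cst p : coef_differentiable (fun=> p).
Proof. by move=> m; exact: differentiable_cst. Qed.

Lemma coef_differentiable_prod (I : Type) (r : seq I) (P : I -> 'M[R]_n -> {poly R}) :
  (forall i, coef_differentiable (P i)) ->
  coef_differentiable (fun M => \prod_(i <- r) P i M).
Proof.
move=> hP; elim: r => [|i r IH].
  rewrite (_ : (fun M => _) = fun=> 1); first exact: coef_differentiable_cst.
  by apply/funext => M; rewrite big_nil.
rewrite (_ : (fun M => _) = (fun M => P i M * \prod_(i <- r) P i M)).
  exact: coef_differentiableM.
by apply/funext => M; rewrite big_cons.
Qed.

Lemma char_poly_differentiable : coef_differentiable (@char_poly R n).
Proof.
rewrite /char_poly /determinant; apply: coef_differentiable_sum => s.
apply: coef_differentiableM; first exact: coef_differentiable_cst.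
apply: coef_differentiable_prod => i m.
rewrite (_ : (fun M => _) = (cst (('X *+ (i == s i))`_m)) -
  (fun M : 'M[R]_n => M i (s i) * (m == 0%N)%:R)).
  apply: differentiableB; first exact: differentiable_cst.
  apply: (@differentiableM _ _ (fun M : 'M[R]_n => M i (s i)) (cst _)); last exact: differentiable_cst.
  exact: differentiable_coord.
by apply/funext => M; rewrite !mxE coefB coefC !fctE; case: (m == 0%N); rewrite ?mulr1 ?mulr0.
Qed.

Lemma esf_differentiable k : differentiable (@esf R n k) A.
Proof.
rewrite (_ : @esf R n k = (cst ((-1) ^+ k)) * (fun M => (char_poly M)`_(n - k))) //.
apply: differentiableM; first exact: differentiable_cst.
exact: char_poly_differentiable.
Qed.

End Differentiability.

Lemma derive1_pencil n k (A B : 'M[R]_n) :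
  derive1 (fun t : R => esf k (A + t *: B)) 0 = (pencil k A B)^`().[0].
Proof.
rewrite derivE (_ : (fun t : R => _) = horner (pencil k A B)) //.
by apply/funext => t; rewrite horner_pencil.
Qed.

Lemma pencil_deriv_diff n k (A B : 'M[R]_n) :
  (pencil k A B)^`().[0] = 'd (@esf R n k) A B.
Proof.
rewrite -derive1_pencil -deriveE; last exact: esf_differentiable.
rewrite /derive1 /derive; apply: (congr1 (fun F => lim (F @ 0^'))).
by apply/funext => t; rewrite /shift /= !(addr0, scale0r) [A + _]addrC.
Qed.

Lemma eigenvalues_split n (M : 'M[R]_n) : M^T = M ->
  char_poly M = \prod_(i < n) ('X - (eigenvalues M 0 i)%:P).
Proof.
by move=> /symmetric_split[l hl]; rewrite /eigenvalues; case: xgetP => [y _ //|/(_ l)].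
Qed.

Lemma Fk_esf n k (M : 'M[R]_n) : (k <= n)%N -> M^T = M -> Fk k M = esf k M.
Proof. by move=> kn sM; rewrite /Fk -(esf_sigma kn (eigenvalues_split sM)). Qed.

Lemma Gamma_in_cone n k (M : 'M[R]_n) : (k <= n)%N -> M^T = M ->
  Gamma k (eigenvalues M) -> in_cone k M.
Proof.
move=> kn sM hM; split=> // j jk.
by rewrite -(Fk_esf _ sM); [exact: hM | case/andP: jk => _ /leq_trans; apply].
Qed.

(** The symmetrized unit matrices span the symmetric matrices, and the differential
    is linear. *)
Lemma linearized_mxdot n k (A B : 'M[R]_n) : (k <= n)%N -> A^T = A -> B^T = B ->
  mxdot (linearized k A) B = (pencil k A B)^`().[0].
Proof.
move=> kn sA sB.
have E i j : linearized k A i j =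
    'd (@esf R n k) A (2^-1 *: (delta_mx i j + delta_mx j i)).
  rewrite mxE -pencil_deriv_diff -derive1_pencil; congr (derive1 _ 0).
  apply/funext => t; rewrite Fk_esf //.
  have sS : (2^-1 *: (delta_mx i j + delta_mx j i))^T = 2^-1 *: (delta_mx i j + delta_mx j i) :> 'M[R]_n.
    by rewrite linearZ linearD /= !trmx_delta addrC.
  by rewrite linearD linearZ /= sA sS.
rewrite pencil_deriv_diff /mxdot.
have EB : B = \sum_i \sum_j B i j *: (2^-1 *: (delta_mx i j + delta_mx j i)).
  have -> : \sum_i \sum_j B i j *: (2^-1 *: (delta_mx i j + delta_mx j i)) =
     2^-1 *: (\sum_i \sum_j B i j *: delta_mx i j + \sum_i \sum_j B i j *: delta_mx j i).
    rewrite -big_split scaler_sumr; apply: eq_bigr => i _ /=.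
    rewrite -big_split scaler_sumr; apply: eq_bigr => j _ /=.
    by rewrite -scalerDr scalerA mulrC -scalerA.
  have -> : \sum_i \sum_j B i j *: delta_mx j i = \sum_i \sum_j B i j *: delta_mx i j :> 'M[R]_n.
    rewrite exchange_big; apply: eq_bigr => i _; apply: eq_bigr => j _.
    by rewrite -{1}sB mxE.
  by rewrite -matrix_sum_delta -[X in _ *: (X + X)]scale1r -scalerDl scalerA mulVf ?scale1r.
rewrite [in RHS]EB linear_sum; apply: eq_bigr => i _.
rewrite linear_sum; apply: eq_bigr => j _.
by rewrite linearZ /= E mulrC.
Qed.

Lemma linearized_sym n k (A : 'M[R]_n) i j : linearized k A i j = linearized k A j i.
Proof. by rewrite !mxE [delta_mx i j + _]addrC. Qed.

(** Tangency of the level set at [A] together with concavity: the linearization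
    at [A] is nonnegative on [H - A]. *)
Lemma linearized_garding n k (A H : 'M[R]_n) : (1 <= k <= n)%N -> calA k A ->
  H^T = H -> Gamma k (eigenvalues H) -> 1 <= sigma k (eigenvalues H) ->
  0 <= mxdot (linearized k A) (H - A).
Proof.
move=> hk [sA gA sigA] sH gH sigH; have /andP[_ kn] := hk.
rewrite linearized_mxdot //; last by rewrite linearB /= sH sA.
by apply: garding; rewrite -?Fk_esf //; exact: Gamma_in_cone.
Qed.

Lemma linearized_psd_gt0 n k (A V : 'M[R]_n) : (1 <= k <= n)%N -> calA k A ->
  V^T = V -> (forall v, 0 <= dotv (v *m V) v) -> 0 < \tr V ->
  0 < mxdot (linearized k A) V.
Proof.
move=> hk [sA gA _] sV pV trV; have /andP[_ kn] := hk.
by rewrite linearized_mxdot //; apply: pencil_psd_deriv_gt0 => //; exact: Gamma_in_cone.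
Qed.

(** Perturbation by a multiple of the identity reduces this to directions of positive
    trace, and symmetry of the linearization to symmetric ones. *)
Lemma mxdot_nonpos n k (A H : 'M[R]_n) : (1 <= k <= n)%N -> calA k A ->
  (forall v, dotv (v *m H) v <= 0) -> mxdot (linearized k A) H <= 0.
Proof.
move=> hk cA nH; have n0 : (0 < n)%N by case/andP: hk => k0 /(leq_trans k0).
pose S := (- 2^-1) *: (H + H^T).
have HS : mxdot (linearized k A) H = - mxdot (linearized k A) S.
  have HT : mxdot (linearized k A) H^T = mxdot (linearized k A) H.
    rewrite /mxdot exchange_big; apply: eq_bigr => i _; apply: eq_bigr => j _.
    by rewrite [H^T _ _]mxE linearized_sym.
  by rewrite /S mxdotZ mxdotD HT; lra.
have quadS v : dotv (v *m S) v = - dotv (v *m H) v.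
  by rewrite /S -scalemxAr mulmxDr dotvZl dotvDl dotv_mulmxT; lra.
have sS : S^T = S by rewrite linearZ linearD /= trmxK addrC.
rewrite HS oppr_le0; clearbody S.
have trS : 0 <= \tr S.
  rewrite /mxtrace sumr_ge0 // => i _.
  have <- : dotv (delta_mx 0 i *m S) (delta_mx 0 i) = S i i.
    rewrite -rowE dotvE (bigD1 i) //= big1 ?addr0; first by rewrite !mxE !eqxx mulr1.
    by move=> j ji; rewrite !mxE (negPf ji) andbF mulr0.
  by rewrite quadS oppr_ge0 nH.
have T0 : 0 < mxdot (linearized k A) 1%:M.
  apply: linearized_psd_gt0; rewrite ?trmx1 ?mxtrace1 ?ltr0n //.
  by move=> v; rewrite mulmx1 dotvv_ge0.
have pos e : 0 < e -> 0 < mxdot (linearized k A) (S + e *: 1%:M).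
  move=> e0; apply: linearized_psd_gt0 => //.
  - by rewrite linearD linearZ /= sS trmx1.
  - move=> v; rewrite mulmxDr -scalemxAr mulmx1 dotvDl dotvZl quadS.
    by rewrite addr_ge0 ?oppr_ge0 ?nH // mulr_ge0 ?dotvv_ge0 // ltW.
  - by rewrite linearD linearZ /= mxtrace1 ltr_wpDl // mulr_gt0 // ltr0n.
rewrite leNgt; apply/negP => s0.
have := pos (- mxdot (linearized k A) S / mxdot (linearized k A) 1%:M).
rewrite mxdotD mxdotZ divfK ?gt_eqF // subrr ltxx => h; apply: notF; apply: h.
by rewrite divr_gt0 // oppr_gt0.
Qed.

(** Compare coefficients in [det (X^2 - M^2) = det (X - M) * det (X + M)]. *)
Lemma trace_sqr m (M : 'M[R]_m.+2) : \tr (M *m M) = \tr M ^+ 2 - 2 * esf 2 M.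
Proof.
set p := char_poly M; pose Q := 'X%:M + map_mx polyC M.
pose q := \det Q.
have qE : q = (-1) ^+ m.+2 *: (p \Po (-1 *: 'X)).
  have -> : p \Po (-1 *: 'X) = \det (map_mx (comp_poly (-1 *: 'X)) (char_poly_mx M)).
    by rewrite det_map_mx.
  have -> : map_mx (comp_poly (-1 *: 'X)) (char_poly_mx M) = (-1) *: Q.
    apply/matrixP => i j; rewrite !mxE rmorphB /= rmorphMn /= comp_polyX comp_polyC.
    by case: (i == j); rewrite ?mulr1n ?mulr0n -?mul_polyC ?polyCN; ring.
  rewrite detZ -mul_polyC polyC_exp polyCN mulrA -exprMn mulrNN mulr1 expr1n mul1r.
  by [].
have pq : char_poly (M *m M) \Po 'X^2 = p * q.
  have -> : char_poly (M *m M) \Po 'X^2 = \det (map_mx (comp_poly 'X^2) (char_poly_mx (M *m M))).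
    by rewrite det_map_mx.
  rewrite -det_mulmx; congr (\det _).
  rewrite /char_poly_mx /Q mulmxDr !mulmxBl -!scalar_mxM mul_scalar_mx mul_mx_scalar.
  rewrite -map_mxM addrA subrK.
  apply/matrixP => i j; rewrite !mxE rmorphB /= rmorphMn /= comp_polyX comp_polyC.
  by rewrite expr2.
have tr2 : (p * q)`_(m.*2.+2) = - \tr (M *m M).
  rewrite -pq coef_comp_poly_Xn // -(char_poly_trace (M *m M)) //.
  have -> : (2 %| m.*2.+2)%N by rewrite dvdn2 /= negbK odd_double.
  by congr (_`__); rewrite -doubleS -muln2 mulnK.
have p_top : p`_m.+2 = 1 by have := monicP (char_poly_monic M); rewrite /lead_coef size_char_poly.
have p_big j : (m.+2 < j)%N -> p`_j = 0 by move=> h; rewrite nth_default // size_char_poly.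
have qj j : q`_j = (-1) ^+ m.+2 * (-1) ^+ j * p`_j.
  by rewrite qE coefZ coef_comp_scaleX -[RHS]mulrA [p`_j * _]mulrC.
have p1 : p`_m.+1 = - \tr M by rewrite -char_poly_trace.
have p2 : p`_m = esf 2 M by rewrite esf2.
have q_big j : (m.+2 < j)%N -> q`_j = 0 by move=> h; rewrite qj p_big ?mulr0.
move: tr2; rewrite coefM.
have i0 : (m < (m.*2.+2).+1)%N by rewrite -addnn; lia.
have i1 : (m.+1 < (m.*2.+2).+1)%N by rewrite -addnn; lia.
have i2 : (m.+2 < (m.*2.+2).+1)%N by rewrite -addnn; lia.
rewrite (bigD1 (Ordinal i0)) //= (bigD1 (Ordinal i1)) /=; last first.
  by rewrite -val_eqE /= eqn_leq ltnn.
rewrite (bigD1 (Ordinal i2)) /=; last first.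
  by rewrite -!val_eqE /= !eqn_leq !ltnn ltnNge leqnSn.
rewrite big1 ?addr0 => [|i /andP[/andP[]]]; last first.
  rewrite -!val_eqE /= => n0 n1 n2; have [h|h] := ltnP m.+2 i; first by rewrite p_big ?mul0r.
  by rewrite q_big ?mulr0 //; lia.
have -> : (m.*2.+2 - m = m.+2)%N by rewrite -addnn; lia.
have -> : (m.*2.+2 - m.+1 = m.+1)%N by rewrite -addnn; lia.
have -> : (m.*2.+2 - m.+2 = m)%N by rewrite -addnn; lia.
rewrite !qj p_top p1 p2 !exprS; have := sqrr_sign R m; rewrite expr2.
move: ((-1) ^+ m) (esf 2 M) (\tr M) (\tr (M *m M)) => e s t T ee h.
have : (e * e) * (2 * s - t ^+ 2) = - T by rewrite -h; ring.
by rewrite ee mul1r => h2; lra.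
Qed.

(** The quadratic value is at most the square root of the sum of the squared
    eigenvalues, and this sum is [(\tr M)^2 - 2 sigma_2]. *)
Lemma Gamma2_trace_bound n k (M : 'M[R]_n) v : (2 <= k <= n)%N -> M^T = M ->
  Gamma k (eigenvalues M) -> dotv v v = 1 -> dotv (v *m M) v <= \tr M.
Proof.
move=> /andP[k2 kn] sM gM v1; have [cs cM] := Gamma_in_cone kn sM gM.
case: n M v kn sM gM v1 cs cM => [|[|m]] M v kn sM gM v1 cs cM; try by lia.
have t0 : 0 < \tr M by rewrite -esf1 // cM //; lia.
have e2 : 0 < esf 2 M by rewrite cM.
have : dotv (v *m M) v ^+ 2 <= \tr M ^+ 2.
  apply: le_trans (dotv_cauchy_schwarz _ _) _; rewrite v1 mulr1.
  apply: (@le_trans _ _ (\tr (M *m M))); last by rewrite trace_sqr; lra.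
  rewrite dotvE /mxtrace; apply: ler_sum => j _.
  rewrite -expr2; have -> : (v *m M) 0 j = dotv v (row j M).
    by rewrite mxE dotvE; apply: eq_bigr => i _; rewrite !mxE -{1}sM mxE.
  apply: le_trans (dotv_cauchy_schwarz _ _) _; rewrite v1 mul1r dotvE mxE.
  by apply: ler_sum => i _; rewrite !mxE -{2}sM mxE.
by move: (dotv _ _) (\tr M) t0 => x y; nra.
Qed.

End LinearizedOperator.

(** * Taylor expansions *)

Section EpsilonForms.
Variables (R : realType) (n : nat).
Implicit Types (f g : 'rV[R]_n -> R) (U : set 'rV[R]_n) (x z v : 'rV[R]_n).

Lemma nbhs_eps x (P : set 'rV[R]_n) :
  nbhs x P <-> exists2 d : R, 0 < d & forall z, `|z| < d -> P (x + z).
Proof.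
split=> [|[d d0 h]].
  move=> /nbhs_normP[d /= d0 h]; exists d => // z zd; apply: h.
  by rewrite /= opprD addNKr normrN.
have [_] := nbhs_normP x P; apply; exists d => // y /= yd.
by rewrite -(subrK x y) addrC; apply: h; rewrite distrC.
Qed.

Lemma open_eps U x : open U -> U x ->
  exists2 d : R, 0 < d & forall z, `|z| < d -> U (x + z).
Proof. by move=> oU Ux; apply/nbhs_eps; exact: open_nbhs_nbhs. Qed.

Lemma continuous_eps f x : {for x, continuous f} -> forall e : R, 0 < e ->
  exists2 d : R, 0 < d & forall z, `|z| < d -> `|f (x + z) - f x| <= e.
Proof.
move=> cf e e0; apply/(nbhs_eps x (fun y => `|f y - f x| <= e)).
by move: cf => /cvgrPdist_le/(_ e e0); apply: filterS => y; rewrite distrC.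
Qed.

Lemma within_continuous_eps (S : set 'rV[R]_n) f x : {within S, continuous f} -> S x ->
  forall e : R, 0 < e ->
  exists2 d : R, 0 < d & forall y, `|y - x| < d -> S y -> `|f y - f x| <= e.
Proof.
move=> cf Sx e e0; have /subspace_continuousP/(_ x Sx)/cvgrPdist_le/(_ e e0) := cf.
move=> /nbhs_eps[d d0 h]; exists d => // y yd Sy.
by rewrite distrC; have := h _ yd; rewrite addrC subrK; apply.
Qed.

Lemma eps_within_continuous (S : set 'rV[R]_n) f :
  (forall x, S x -> forall e : R, 0 < e ->
  exists2 d : R, 0 < d & forall y, `|y - x| < d -> S y -> `|f y - f x| <= e) ->
  {within S, continuous f}.
Proof.
move=> h; apply/subspace_continuousP => x Sx; apply/cvgrPdist_le => e e0.
have [d d0 hd] := h x Sx e e0; apply/nbhs_eps; exists d => // z zd Sz.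
by rewrite distrC; apply: hd => //; rewrite addrC addKr.
Qed.

Lemma is_derive_eps (g : R -> R) (t l : R) :
  (forall e : R, 0 < e -> exists2 d : R, 0 < d &
     forall s, `|s| < d -> `|g (t + s) - g t - l * s| <= e * `|s|) ->
  is_derive t 1 g l.
Proof.
move=> h; have cv : h^-1 *: ((g \o shift t) (h *: 1) - g t) @[h --> 0^'] --> l.
  apply/cvgrPdist_le => e e0; have [d d0 hd] := h e e0.
  apply/nbhs_normP; exists d => // s /=; rewrite sub0r normrN => sd s0.
  move: (hd s sd) => hs; rewrite /shift /= [s%:A]mulr1 [s + t]addrC.
  have -> : l - s^-1 *: (g (t + s) - g t) = - s^-1 * (g (t + s) - g t - l * s).
    by rewrite /GRing.scale /=; field.
  by rewrite normrM normrN normfV mulrC ler_pdivrMr ?normr_gt0.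
by apply: DeriveDef; [apply/cvg_ex; exists l | exact/cvg_lim].
Qed.

Lemma derivable_line f x v t : derivable f (x + t *: v) v ->
  is_derive t 1 (fun s => f (x + s *: v)) ('D_v f (x + t *: v)).
Proof.
move=> df; set g := fun s => f (x + s *: v).
have E : (fun h : R => h^-1 *: ((g \o shift t) (h *: 1) - g t)) =
    (fun h : R => h^-1 *: ((f \o shift (x + t *: v)) (h *: v) - f (x + t *: v))).
  apply/funext => h /=; by rewrite /g [h%:A]mulr1 scalerDl addrCA addrC.
by apply: DeriveDef; rewrite /derivable /derive E.
Qed.

Lemma mvt_signed (g dg : R -> R) (s : R) :
  (forall t : R, `|t| <= `|s| -> is_derive t 1 g (dg t)) ->
  exists2 c, `|c| <= `|s| & g s - g 0 = dg c * s.
Proof.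
move=> h; have cont a b : (forall t, t \in `[a, b] -> `|t| <= `|s|) ->
    {within `[a, b], continuous g}.
  by move=> H; apply: derivable_within_continuous => t /H /h dt; exact: ex_derive.
have [s0|s0] := leP 0 s.
  have [||c] := @MVT_segment R g dg 0 s s0.
  - by move=> t; rewrite in_itv /= => /andP[t0 ts]; apply: h; rewrite !ger0_norm // ltW.
  - by apply: cont => t; rewrite in_itv /= => /andP[t0 ts]; rewrite !ger0_norm.
  - by rewrite in_itv /= subr0 => /andP[c0 cs]; exists c => //; rewrite !ger0_norm.
have [||c] := @MVT_segment R g dg s 0 (ltW s0).
- move=> t; rewrite in_itv /= => /andP[st t0]; apply: h.
  by rewrite (ltr0_norm t0) (ltr0_norm s0) lerN2 ltW.
- apply: cont => t; rewrite in_itv /= => /andP[st t0].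
  by rewrite (ler0_norm t0) (ltr0_norm s0) lerN2.
- rewrite in_itv /= sub0r => /andP[sc c0] E; exists c.
    by rewrite (ler0_norm c0) (ltr0_norm s0) lerN2.
  by rewrite -opprB E mulrN opprK.
Qed.

Lemma is_derive_quadratic (a b t : R) :
  is_derive t 1 (fun t => t * a + t ^+ 2 * b) (a + 2 * t * b).
Proof.
apply: is_derive_eps => e e0; have b1 : 0 < `|b| + 1 by rewrite ltr_wpDl.
exists (e / (`|b| + 1)) => [|s]; first by rewrite divr_gt0.
rewrite ltr_pdivlMr // => hs.
have -> : (t + s) * a + (t + s) ^+ 2 * b - (t * a + t ^+ 2 * b) - (a + 2 * t * b) * s =
  s * b * s by ring.
rewrite normrM ler_wpM2r // normrM; apply: ltW; apply: le_lt_trans hs.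
by rewrite ler_wpM2l // lerDl.
Qed.

Lemma forall_eps (P : 'I_n -> 'rV[R]_n -> Prop) :
  (forall i, exists2 d : R, 0 < d & forall z, `|z| < d -> P i z) ->
  exists2 d : R, 0 < d & forall z, `|z| < d -> forall i, P i z.
Proof.
move=> h; have /choice[d hd] : forall i, exists d : R, 0 < d /\ forall z, `|z| < d -> P i z.
  by move=> i; have [d d0 hd] := h i; exists d.
exists (\big[Num.min/1]_i d i) => [|z zd i].
  by apply: lt_bigmin => // i _; have [] := hd i.
by have [_] := hd i; apply; apply: lt_le_trans zd _; exact: bigmin_le.
Qed.

End EpsilonForms.

Section Taylor.
Variables (R : realType) (n : nat).
Implicit Types (f g : 'rV[R]_n -> R) (U : set 'rV[R]_n) (x y z v : 'rV[R]_n).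

Lemma partial_cat s1 s2 f : partial (s1 ++ s2) f = partial s1 (partial s2 f).
Proof. by rewrite /partial foldr_cat. Qed.

Lemma C_on_partial m U f s : C_on (m + size s) U f -> C_on m U (partial s f).
Proof.
move=> h s' s'm; rewrite -partial_cat; have [|h1 h2] := h (s' ++ s).
  by rewrite size_cat leq_add2r.
split=> // s'lt x i Ux; apply: h2 => //.
by rewrite size_cat ltn_add2r.
Qed.

Lemma C_on_le m m' U f : (m <= m')%N -> C_on m' U f -> C_on m U f.
Proof.
move=> mm h s sm; have [h1 h2] := h s (leq_trans sm mm); split=> // sm' x i Ux.
by apply: h2 => //; exact: leq_trans mm.
Qed.

Lemma C_on_continuous m U f x : C_on m U f -> U x -> {for x, continuous f}.
Proof. by move=> h Ux; have [h1 _] := h [::] isT; exact: h1. Qed.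

(** The corners of the polygonal path from 0 to [z] parallel to the axes. *)
Definition trunc_row (m : nat) z : 'rV[R]_n := \row_i (if (i < m)%N then z 0 i else 0).

Lemma trunc_row0 z : trunc_row 0 z = 0.
Proof. by apply/rowP => i; rewrite !mxE. Qed.

Lemma trunc_row_all z : trunc_row n z = z.
Proof. by apply/rowP => i; rewrite !mxE ltn_ord. Qed.

Lemma trunc_rowS (i : 'I_n) z : trunc_row i.+1 z = trunc_row i z + z 0 i *: basis_vec i.
Proof.
apply/rowP => j; rewrite !mxE eqxx /= ltnS leq_eqVlt.
have [->|ji] := eqVneq j i; first by rewrite eqxx ltnn add0r mulr1.
by rewrite (_ : (val j == val i) = false) ?mulr0 ?addr0 //; apply/negbTE.
Qed.

Lemma norm_trunc_row_step (i : 'I_n) z (c : R) : `|c| <= `|z 0 i| ->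
  `|trunc_row i z + c *: basis_vec i| <= `|z|.
Proof.
move=> ci; apply/norm_rV_le => // j; rewrite !mxE eqxx /=.
have [->|ji] := eqVneq j i.
  by rewrite ltnn add0r mulr1; exact: le_trans ci (coord_le_norm z i).
rewrite mulr0 addr0; case: ifP => _; first exact: coord_le_norm.
by rewrite normr0.
Qed.

Lemma gradientE f x i : gradient f x 0 i = partial [:: i] f x.
Proof. by rewrite mxE. Qed.

(** A function with continuous partial derivatives is differentiable: move from
    [x] to [x + z] one coordinate at a time and apply the mean value theorem on
    each segment. *)
Lemma C1_expansion U f x : open U -> C_on 1 U f -> U x -> forall e : R, 0 < e ->
  exists2 d : R, 0 < d & forall z, `|z| < d ->
    `|f (x + z) - f x - dotv (gradient f x) z| <= e * `|z|.
Proof.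
move=> oU hf Ux e e0; pose e' := e / n.+1%:R.
have e'0 : 0 < e' by rewrite divr_gt0.
have [dU dU0 hU] := open_eps oU Ux.
have [d1 d10 h1] : exists2 d : R, 0 < d & forall z, `|z| < d ->
    forall i, `|partial [:: i] f (x + z) - partial [:: i] f x| <= e'.
  apply: (@forall_eps _ _ (fun i z => `|partial [:: i] f (x + z) - partial [:: i] f x| <= e')) => i.
  by have [c _] := hf [:: i] isT; apply: continuous_eps e'0; exact: c.
exists (Num.min dU d1); first by rewrite lt_min dU0.
move=> z; rewrite lt_min => /andP[zU zd].
have step m : (m <= n)%N ->
    `|f (x + trunc_row m z) - f x - \sum_(i < n | (i < m)%N) partial [:: i] f x * z 0 i|
     <= m%:R * (e' * `|z|).
  elim: m => [|m IH] mn.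
    by rewrite trunc_row0 addr0 big1 ?subrr ?normr0 ?mul0r // => i.
  pose i := Ordinal mn.
  have hline (t : R) : `|t| <= `|z 0 i| ->
      is_derive t 1 (fun s => f (x + trunc_row m z + s *: basis_vec i))
        (partial [:: i] f (x + trunc_row m z + t *: basis_vec i)).
    move=> tz; apply: derivable_line.
    have [_ h2] := hf [::] isT; apply: h2 => //; rewrite -addrA.
    by apply: hU; apply: le_lt_trans zU; exact: (norm_trunc_row_step tz).
  have [c cz E] := mvt_signed hline.
  have EE : trunc_row m.+1 z = trunc_row m z + z 0 i *: basis_vec i.
    exact: (trunc_rowS i).
  rewrite (bigD1 i) //= EE addrA.
  have -> : \sum_(j < n | (j < m.+1)%N && (j != i)) partial [:: j] f x * z 0 j =
            \sum_(j < n | (j < m)%N) partial [:: j] f x * z 0 j.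
    apply: eq_bigl => j; rewrite -val_eqE /= ltnS [(j <= m)%N]leq_eqVlt.
    by case: eqVneq => [->|]; rewrite ?ltnn ?andbT.
  have E2 : f (x + trunc_row m z + z 0 i *: basis_vec i) = f (x + trunc_row m z) +
      partial [:: i] f (x + trunc_row m z + c *: basis_vec i) * z 0 i.
    by move: E; rewrite scale0r addr0 => /eqP; rewrite subr_eq => /eqP ->; rewrite addrC.
  rewrite E2; set S := \sum_(j | _) _; set q := partial _ _ (_ + _).
  have -> : f (x + trunc_row m z) + q * z 0 i - f x - (partial [:: i] f x * z 0 i + S) =
    (f (x + trunc_row m z) - f x - S) + (q - partial [:: i] f x) * z 0 i by ring.
  have -> : m.+1%:R * (e' * `|z|) = m%:R * (e' * `|z|) + e' * `|z|.
    by rewrite -natr1 mulrDl mul1r.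
  apply: le_trans (ler_normD _ _) _; rewrite lerD ?IH //; first exact: ltnW.
  rewrite normrM ler_pM //; last exact: coord_le_norm.
  rewrite /q -addrA; apply: h1; apply: le_lt_trans zd.
  exact: (norm_trunc_row_step cz).
have := step n (leqnn n); rewrite trunc_row_all => h.
rewrite dotvE; under eq_bigr => i _ do rewrite gradientE.
have -> : \sum_i partial [:: i] f x * z 0 i = \sum_(i < n | (i < n)%N) partial [:: i] f x * z 0 i.
  by apply: eq_bigl => i; rewrite ltn_ord.
apply: le_trans h _; rewrite mulrA ler_wpM2r // /e' mulrA ler_pdivrMr // mulrC.
by rewrite ler_pM2l // ler_nat.
Qed.

Lemma C1_line_derive U f x v t : open U -> C_on 1 U f -> U (x + t *: v) ->
  is_derive t 1 (fun s => f (x + s *: v)) (dotv (gradient f (x + t *: v)) v).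
Proof.
move=> oU hf Ux; apply: is_derive_eps => e e0.
have e'0 : 0 < e / (`|v| + 1) by rewrite divr_gt0 // ltr_wpDl.
have [d d0 hd] := C1_expansion oU hf Ux e'0.
exists (d / (`|v| + 1)) => [|s sd]; first by rewrite divr_gt0 // ltr_wpDl.
have v1 : 0 < `|v| + 1 by rewrite ltr_wpDl.
have svd : `|s *: v| < d.
  rewrite normrZ; move: sd; rewrite ltr_pdivlMr // => /(le_lt_trans _); apply.
  by rewrite ler_wpM2l // lerDl.
have := hd _ svd; rewrite scalerDl addrA dotvZr [s * _]mulrC => /le_trans; apply.
rewrite normrZ; have -> : e / (`|v| + 1) * (`|s| * `|v|) = e * `|s| * (`|v| / (`|v| + 1)) by ring.
by rewrite ler_piMr ?mulr_ge0 ?(ltW e0) // ler_pdivrMr // mul1r lerDl.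
Qed.

Lemma C2_partial U f j : C_on 2 U f -> C_on 1 U (partial [:: j] f).
Proof. by move=> h; apply: C_on_partial; rewrite addn1. Qed.

Lemma dotv_gradient_partial f x z j :
  dotv (gradient (partial [:: j] f) x) z = (z *m hessian f x) 0 j.
Proof.
rewrite dotvE mxE; apply: eq_bigr => i _; rewrite mulrC; congr (_ * _).
by rewrite gradientE mxE.
Qed.

(** Young's theorem, by comparing the two ways of evaluating a mixed second
    difference. *)
Lemma hessian_sym U f x : open U -> C_on 2 U f -> U x -> (hessian f x)^T = hessian f x.
Proof.
move=> oU hf Ux; apply/matrixP => i j; rewrite mxE.
suff key i' j' (e : R) : 0 < e -> exists2 d : R, 0 < d & forall t : R, 0 < t < d ->
    `|f (x + t *: basis_vec i' + t *: basis_vec j') - f (x + t *: basis_vec i')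
      - f (x + t *: basis_vec j') + f x - t ^+ 2 * hessian f x j' i'| <= e * t ^+ 2.
  apply/eqP; rewrite -subr_eq0 -normr_le0; apply/ler_addgt0Pr => e e0; rewrite add0r.
  have e20 : 0 < e / 2 by rewrite divr_gt0.
  have [d1 d10 h1] := key i j _ e20; have [d2 d20 h2] := key j i _ e20.
  pose t := Num.min d1 d2 / 2.
  have m0 : 0 < Num.min d1 d2 by rewrite lt_min d10.
  have td : 0 < t < d1 /\ 0 < t < d2.
    have : t < Num.min d1 d2 by rewrite /t ltr_pdivrMr // mulr_natr mulr2n ltrDl.
    by rewrite lt_min => /andP[-> ->]; rewrite /t divr_gt0.
  have := h1 t td.1; have := h2 t td.2; have t0 : 0 < t ^+ 2 by rewrite exprn_gt0 // /t divr_gt0.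
  have -> : x + t *: basis_vec j + t *: basis_vec i = x + t *: basis_vec i + t *: basis_vec j.
    by rewrite addrAC.
  move: (hessian f x i j) (hessian f x j i) (f (_ + _)) (f (_ + _)) (f (_ + _)) => a b F1 F2 F3.
  move: (t ^+ 2) t0 => T T0; rewrite !ler_norml => /andP[k1 k2] /andP[k3 k4].
  by rewrite -(ler_pM2l T0) -(ler_pM2l T0) mulrN; apply/andP; split; nra.
move=> e0; have e3 : 0 < e / 4 by rewrite divr_gt0.
have [dU dU0 hU] := open_eps oU Ux.
have [d1 d10 h1] := C1_expansion oU (C2_partial i' hf) Ux e3.
exists (Num.min dU d1 / 2) => [|t /andP[t0 td]]; first by rewrite divr_gt0 // lt_min dU0.
have tm : 2 * t < Num.min dU d1 by rewrite -ltr_pdivlMl // mulrC.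
move: tm; rewrite lt_min => /andP[tU t1].
have nb (a b : R) i1 i2 : `|a| <= t -> `|b| <= t -> `|a *: basis_vec i1 + b *: basis_vec i2 : 'rV[R]_n| <= 2 * t.
  move=> ha hb; apply: le_trans (ler_normD _ _) _; rewrite !normrZ.
  have bv i0 : `|basis_vec i0 : 'rV[R]_n| <= 1.
    by apply/norm_rV_le => // l; rewrite !mxE; case: (_ && _); rewrite ?normr1 ?normr0.
  have := ler_pM (normr_ge0 a) (normr_ge0 _) ha (bv i1).
  have := ler_pM (normr_ge0 b) (normr_ge0 _) hb (bv i2); rewrite !mulr1; lra.
have nb1 (a : R) i1 : `|a| <= t -> `|a *: basis_vec i1 : 'rV[R]_n| <= 2 * t.
  by move=> ha; have := nb a 0 i1 i1 ha; rewrite normr0 scale0r addr0; apply; exact: ltW.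
have tt : `|t| <= t by rewrite ger0_norm // ltW.
have hline y (s : R) : U (y + s *: basis_vec i') -> is_derive s 1 (fun s => f (y + s *: basis_vec i'))
    (partial [:: i'] f (y + s *: basis_vec i')).
  by move=> Uy; apply: derivable_line; have [_ h] := hf [::] isT; exact: h.
pose phi (s : R) := f (x + t *: basis_vec j' + s *: basis_vec i') - f (x + s *: basis_vec i').
have hphi (s : R) : `|s| <= `|t| -> is_derive s 1 phi
   (partial [:: i'] f (x + t *: basis_vec j' + s *: basis_vec i') - partial [:: i'] f (x + s *: basis_vec i')).
  rewrite (ger0_norm (ltW t0)) => st; apply: is_deriveB; apply: hline.
    by rewrite -addrA; apply: hU; apply: le_lt_trans tU; exact: nb.
  by apply: hU; apply: le_lt_trans tU; exact: nb1.
have [c ct E] := mvt_signed hphi; rewrite (ger0_norm (ltW t0)) in ct.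
have -> : f (x + t *: basis_vec i' + t *: basis_vec j') - f (x + t *: basis_vec i')
      - f (x + t *: basis_vec j') + f x = phi t - phi 0.
  by rewrite /phi scale0r !addr0 [x + t *: basis_vec i' + _]addrAC; ring.
rewrite E.
have k1 := h1 _ (le_lt_trans (nb t c j' i' tt ct) t1).
have k2 := h1 _ (le_lt_trans (nb1 c i' ct) t1).
rewrite addrA in k1; move: k1 k2; rewrite dotvDr !dotvZr.
have -> : dotv (gradient (partial [:: i'] f) x) (basis_vec j') = hessian f x j' i'.
  rewrite dotvE (bigD1 j') //= big1 => [|l lj]; first by rewrite !mxE !eqxx mulr1 addr0.
  by rewrite !mxE (negPf lj) andbF mulr0.
have := nb t c j' i' tt ct; have := nb1 c i' ct.
move: (`|_ : 'rV[R]_n|) (`|_ : 'rV[R]_n|) => N1 N2 hN1 hN2.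
move: (dotv _ _) (hessian _ _ _ _) (partial _ _ _) (partial _ _ _) (partial _ _ _) => a b p1 p2 p3.
move=> k1 k2; have -> : (p3 - p1) * t - t ^+ 2 * b = (p3 - p1 - t * b) * t by ring.
rewrite normrM (ger0_norm (ltW t0)).
have : `|p3 - p1 - t * b| <= e * t.
  move: k1 k2; rewrite !ler_norml => /andP[? ?] /andP[? ?]; apply/andP; split; nra.
by move: (`|_ - _ - _|) => q; nra.
Qed.

(** The Peano form of a second-order expansion.  It is all that the maximum principle
    uses, and it is easily computed for explicit barriers. *)
Definition jet2 f x (p : 'rV[R]_n) (H : 'M[R]_n) := forall e : R, 0 < e ->
  exists2 d : R, 0 < d & forall z, `|z| < d ->
    `|f (x + z) - f x - dotv p z - 2^-1 * dotv (z *m H) z| <= e * `|z| ^+ 2.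

Lemma C2_jet U f x : open U -> C_on 2 U f -> U x ->
  jet2 f x (gradient f x) (hessian f x).
Proof.
move=> oU hf Ux e e0; set p := gradient f x; set H := hessian f x.
pose e' := e / n.+1%:R.
have e'0 : 0 < e' by rewrite divr_gt0.
have [dU dU0 hU] := open_eps oU Ux.
have [d1 d10 h1] : exists2 d : R, 0 < d & forall z, `|z| < d -> forall j,
   `|partial [:: j] f (x + z) - partial [:: j] f x - (z *m H) 0 j| <= e' * `|z|.
  apply: (@forall_eps _ _ (fun j z =>
    `|partial [:: j] f (x + z) - partial [:: j] f x - (z *m H) 0 j| <= e' * `|z|)) => j.
  have [d d0 hd] := C1_expansion oU (C2_partial j hf) Ux e'0.
  by exists d => // z zd; rewrite -dotv_gradient_partial; exact: hd.
exists (Num.min dU d1); first by rewrite lt_min dU0.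
move=> z; rewrite lt_min => /andP[zU zd].
pose g (t : R) := f (x + t *: z) - t * dotv p z - t ^+ 2 * (2^-1 * dotv (z *m H) z).
pose dg (t : R) := dotv (gradient f (x + t *: z)) z - dotv p z - t * dotv (z *m H) z.
have hg (t : R) : `|t| <= `|1 : R| -> is_derive t 1 g (dg t).
  rewrite normr1 => t1; have Ut : U (x + t *: z).
    by apply: hU; rewrite normrZ; apply: le_lt_trans zU; rewrite ler_piMl.
  have h := C1_line_derive oU (C_on_le (leqnSn 1) hf) Ut.
  rewrite /g /dg; set a := dotv p z; set b := dotv (z *m H) z.
  have -> : (fun t => f (x + t *: z) - t * a - t ^+ 2 * (2^-1 * b)) =
      (fun t => f (x + t *: z)) - (fun t => t * a + t ^+ 2 * (2^-1 * b)).
    by apply/funext => s; rewrite !fctE; ring.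
  have -> : dotv (gradient f (x + t *: z)) z - a - t * b =
     dotv (gradient f (x + t *: z)) z - (a + 2 * t * (2^-1 * b)) by field.
  by apply: is_deriveB; exact: is_derive_quadratic.
have [c c1 E] := mvt_signed hg; rewrite normr1 in c1.
have -> : f (x + z) - f x - dotv p z - 2^-1 * dotv (z *m H) z = g 1 - g 0.
  by rewrite /g scale1r scale0r addr0; ring.
have cz : `|c *: z| <= `|z| by rewrite normrZ ler_piMl.
rewrite E mulr1 /dg.
have -> : dotv (gradient f (x + c *: z)) z - dotv p z - c * dotv (z *m H) z =
   \sum_j (partial [:: j] f (x + c *: z) - partial [:: j] f x - ((c *: z) *m H) 0 j) * z 0 j.
  rewrite -dotvBl -dotvZl -dotvBl scalemxAl dotvE; apply: eq_bigr => j _.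
  have subE (a b : 'rV[R]_n) : (a - b) 0 j = a 0 j - b 0 j by rewrite !mxE.
  by rewrite !subE /p !gradientE.
apply: le_trans (ler_norm_sum _ _ _) _.
apply: (@le_trans _ _ (\sum_(j < n) e' * `|z| ^+ 2)).
  apply: ler_sum => j _; rewrite normrM expr2 mulrA ler_pM //; last exact: coord_le_norm.
  by apply: le_trans (h1 _ (le_lt_trans cz zd) j) _; rewrite ler_wpM2l // ltW.
rewrite sumr_const card_ord -mulrnAl ler_wpM2r ?sqr_ge0 // /e' -mulr_natr -mulrA.
by rewrite ler_piMr ?(ltW e0) // mulrC ler_pdivrMr // mul1r ler_nat.
Qed.

End Taylor.

(** * Second-order comparison at a boundary point *)

Section OneVariable.
Variable R : realType.
Implicit Types (g dg : R -> R).

Lemma mvt_closed g dg (a b : R) : a <= b ->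
  (forall t : R, a <= t <= b -> is_derive t 1 g (dg t)) ->
  exists2 c, a <= c <= b & g b - g a = dg c * (b - a).
Proof.
move=> ab h; have [||c] := @MVT_segment R g dg a b ab.
- by move=> t; rewrite in_itv /= => /andP[t0 ts]; apply: h; rewrite !ltW.
- apply: derivable_within_continuous => t; rewrite in_itv /= => /h dt; exact: ex_derive.
- by rewrite in_itv /= => cab E; exists c.
Qed.

Lemma mvt_half_open g dg (t : R) : 0 < t ->
  (forall s : R, 0 < s <= t -> is_derive s 1 g (dg s)) ->
  (forall e : R, 0 < e -> exists2 d : R, 0 < d & forall s, 0 < s < d -> `|g s - g 0| <= e) ->
  exists2 c, 0 < c < t & g t - g 0 = dg c * t.
Proof.
move=> t0 h c0; have [||c] := @MVT R g dg 0 t t0.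
- by move=> s; rewrite in_itv /= => /andP[s0 st]; apply: h; rewrite s0 ltW.
- apply/continuous_within_itvP => //; split.
  + move=> s; rewrite in_itv /= => /andP[s0 st]; apply: differentiable_continuous.
    apply/derivable1_diffP; have ? : is_derive s 1 g (dg s) by apply: h; rewrite s0 ltW.
    exact: ex_derive.
  + apply/cvgrPdist_le => e e0; have [d d0 hd] := c0 e e0.
    exists d => //= s /=; rewrite sub0r normrN => sd s0; rewrite distrC; apply: hd.
    by rewrite s0 /=; apply: le_lt_trans sd; exact: ler_norm.
  + apply: cvg_at_left_filter; apply: differentiable_continuous.
    apply/derivable1_diffP; have ? : is_derive t 1 g (dg t) by apply: h; rewrite t0 lexx.
    exact: ex_derive.
- by rewrite in_itv /= subr0 => cab E; exists c.
Qed.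

End OneVariable.

Section BoundarySecondOrder.
Variables (R : realType) (n : nat).
Implicit Types (f g : 'rV[R]_n -> R) (x y z v : 'rV[R]_n).

(** Boundary values of the gradient and of the Hessian at [xi], tested on vectors
    because only quadratic expressions in them occur. *)
Definition gradient_limit (U : set 'rV[R]_n) f xi p :=
  forall v (e : R), 0 < e -> exists2 d : R, 0 < d & forall z, `|z| < d -> U (xi + z) ->
    `|dotv (gradient f (xi + z)) v - dotv p v| <= e.

Definition hessian_limit (U : set 'rV[R]_n) f xi (H : 'M[R]_n) :=
  forall v (e : R), 0 < e -> exists2 d : R, 0 < d & forall z, `|z| < d -> U (xi + z) ->
    `|dotv (v *m hessian f (xi + z)) v - dotv (v *m H) v| <= e.

Definition limit_along (U : set 'rV[R]_n) f xi :=
  forall e : R, 0 < e -> exists2 d : R, 0 < d & forall z, `|z| < d -> U (xi + z) ->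
    `|f (xi + z) - f xi| <= e.

Variables (U : set 'rV[R]_n) (xi nu tau : 'rV[R]_n).
Hypotheses (oU : open U).
Hypotheses (nunu : dotv nu nu = 1) (nutau : dotv nu tau = 0).

Section Region.
Variables (rho : 'rV[R]_n -> R) (a : R) (Hr : 'M[R]_n).
Hypotheses (a0 : 0 < a) (jrho : jet2 rho xi (a *: nu) Hr) (rho0 : rho xi = 0).
Hypothesis regU : exists2 d : R, 0 < d & forall z, `|z| < d -> 0 < rho (xi + z) -> U (xi + z).
Let kappa := dotv (tau *m Hr) tau / a.

(** In the plane of [tau] and [nu] the boundary is the graph of [- kappa t^2 / 2] up
    to [o(t^2)], so that a margin [e t^2] suffices to be on the outer side. *)
Lemma above_parabola (e K : R) : 0 < e -> 0 < K ->
  exists2 d : R, 0 < d & forall t t' s : R, 0 < t < d -> `|t'| <= t -> `|s| <= K * t ^+ 2 ->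
    e * t ^+ 2 <= s + 2^-1 * kappa * t' ^+ 2 -> U (xi + (t' *: tau + s *: nu)).
Proof.
move=> e0 K0; pose N := `|tau| + K * `|nu| + 1.
have N0 : 0 < N by rewrite /N ltr_wpDl // addr_ge0 // mulr_ge0 // ltW.
pose B := `|dotv (tau *m Hr) nu| + `|dotv (nu *m Hr) tau| + `|dotv (nu *m Hr) nu|.
have B0 : 0 <= B by rewrite /B !addr_ge0.
have ea0 : 0 < e * a by rewrite mulr_gt0.
have e'0 : 0 < e * a / 4 / N ^+ 2 by rewrite !divr_gt0 // exprn_gt0.
have [d1 d10 h1] := jrho e'0; have [d2 d20 h2] := regU.
pose C := (1 + B) * (K + K ^+ 2).
have C0 : 0 < C by rewrite /C mulr_gt0 //; [lra | rewrite addr_gt0 // exprn_gt0].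
pose d := Num.min (Num.min 1 (Num.min d1 d2 / N)) (e * a / 2 / C).
exists d => [|t t' s /andP[t0]]; first by rewrite /d !lt_min ltr01 !divr_gt0 // lt_min d10.
rewrite /d !lt_min => /andP[/andP[t1 tN] tC] t't sK hs.
have {tN} : t * N < Num.min d1 d2 by rewrite -ltr_pdivlMr.
rewrite lt_min => /andP[tN1 tN2].
set z := t' *: tau + s *: nu.
have st : `|s| <= K * t.
  apply: le_trans sK _; rewrite expr2 ler_wpM2l ?(ltW K0) // ler_piMr ?(ltW t0) //; exact: ltW.
have zN : `|z| <= t * N.
  apply: le_trans (ler_normD _ _) _; rewrite !normrZ /N.
  have := ler_wpM2r (normr_ge0 tau) t't; have := ler_wpM2r (normr_ge0 nu) st; lra.
have zn2 : `|z| ^+ 2 <= (t * N) ^+ 2 by rewrite lerXn2r ?nnegrE // mulr_ge0 // ltW.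
apply: h2; first exact: le_lt_trans zN tN2.
have := h1 z (le_lt_trans zN tN1); rewrite rho0 subr0 => hz.
have gz : dotv (a *: nu) z = a * s.
  by rewrite /z dotvZl dotvDr !dotvZr nunu nutau mulr0 add0r mulr1.
have Hz : dotv (z *m Hr) z = a * kappa * t' ^+ 2 +
    (t' * s * (dotv (tau *m Hr) nu + dotv (nu *m Hr) tau) + s ^+ 2 * dotv (nu *m Hr) nu).
  rewrite /z mulmxDl -!scalemxAl !(dotvDl, dotvDr, dotvZl, dotvZr) /kappa.
  by field; rewrite gt_eqF.
have small : `|t' * s * (dotv (tau *m Hr) nu + dotv (nu *m Hr) tau) + s ^+ 2 * dotv (nu *m Hr) nu|
    <= C * t ^+ 3.
  apply: le_trans (ler_normD _ _) _.
  have b1 : `|t' * s| <= K * t ^+ 3.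
    rewrite normrM exprS mulrCA ler_pM //.
  have t31 : 0 < t ^+ 3 by rewrite exprn_gt0.
  have b2 : s ^+ 2 <= K ^+ 2 * t ^+ 3.
    rewrite -real_normK ?num_real //; apply: (@le_trans _ _ ((K * t ^+ 2) ^+ 2)).
      by rewrite lerXn2r ?nnegrE // mulr_ge0 ?exprn_ge0 // ltW.
    rewrite exprMn ler_wpM2l ?sqr_ge0 // -exprM exprS ler_piMl ?(ltW t31) //; exact: ltW.
  have X1 : `|dotv (tau *m Hr) nu + dotv (nu *m Hr) tau| <= B.
    by apply: le_trans (ler_normD _ _) _; rewrite /B lerDl.
  have Y1 : `|dotv (nu *m Hr) nu| <= B by rewrite /B lerDr addr_ge0.
  rewrite [`|_ * _ * _|]normrM [`|s ^+ 2 * _|]normrM (ger0_norm (sqr_ge0 s)).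
  have := ler_pM (normr_ge0 (t' * s)) (normr_ge0 _) b1 X1.
  have := ler_pM (sqr_ge0 s) (normr_ge0 _) b2 Y1.
  have : 0 <= K ^+ 2 * t ^+ 3 by rewrite mulr_ge0 ?sqr_ge0 // ltW.
  have : 0 <= K * t ^+ 3 by rewrite mulr_ge0 // ltW.
  have -> : C * t ^+ 3 = (1 + B) * (K * t ^+ 3) + (1 + B) * (K ^+ 2 * t ^+ 3) by rewrite /C; ring.
  by move: (K * t ^+ 3) (K ^+ 2 * t ^+ 3) => P Q; lra.
move: hz; rewrite gz Hz.
set E := _ + s ^+ 2 * _ in small *.
have e4 : e * a / 4 / N ^+ 2 * `|z| ^+ 2 <= e * a / 4 * t ^+ 2.
  have -> : e * a / 4 * t ^+ 2 = e * a / 4 / N ^+ 2 * (t * N) ^+ 2 by field; rewrite gt_eqF.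
  by rewrite ler_wpM2l // ltW.
have tC' : C * t ^+ 3 <= e * a / 2 * t ^+ 2.
  rewrite exprS mulrA ler_wpM2r ?sqr_ge0 // mulrC -ler_pdivlMr //; exact: ltW.
have ht2 : 0 < t ^+ 2 by rewrite exprn_gt0.
move: small; rewrite !ler_norml => /andP[E1 E2] /andP[k1 k2].
have := ler_wpM2l (ltW a0) hs; have : 0 < e * a * t ^+ 2 by rewrite mulr_gt0.
nra.
Qed.

Lemma above_normal : exists2 d : R, 0 < d &
  forall s : R, 0 < s < d -> U (xi + s *: nu).
Proof.
have [d d0 h] := above_parabola ltr01 ltr01; exists (d ^+ 2) => [|s /andP[s0 sd]].
  by rewrite exprn_gt0.
have := h (Num.sqrt s) 0 s; rewrite scale0r add0r !sqr_sqrtr ?(ltW s0) //.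
apply; rewrite ?normr0 ?sqrtr_ge0 ?mul1r ?expr0n ?mulr0 ?addr0 //.
  rewrite sqrtr_gt0 s0 /= -(@ltr_pXn2r _ 2) // ?nnegrE ?sqrtr_ge0 ?(ltW d0) //.
  by rewrite sqr_sqrtr // ltW.
by rewrite ger0_norm // ltW.
Qed.

Section Comparison.
Variables (f : 'rV[R]_n -> R) (p q : 'rV[R]_n) (H A : 'M[R]_n).
Hypotheses (hf : C_on 2 U f) (lf : limit_along U f xi).
Hypotheses (lp : gradient_limit U f xi p) (lH : hessian_limit U f xi H).
Hypothesis below : forall z, U (xi + z) ->
  f (xi + z) <= f xi + dotv q z + 2^-1 * dotv (z *m A) z.

Let hf1 : C_on 1 U f := C_on_le (leqnSn 1) hf.

Lemma vertical_increment y (s0 s1 m eta : R) : s0 <= s1 ->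
  (forall s, s0 <= s <= s1 -> U (y + s *: nu) /\
     `|dotv (gradient f (y + s *: nu)) nu - m| <= eta) ->
  `|f (y + s1 *: nu) - f (y + s0 *: nu) - (s1 - s0) * m| <= (s1 - s0) * eta.
Proof.
move=> s01 h.
have [|c /h[_ hc] ->] := @mvt_closed R (fun s => f (y + s *: nu))
    (fun s => dotv (gradient f (y + s *: nu)) nu) s0 s1 s01.
  by move=> s /h[Us _]; exact: C1_line_derive oU hf1 Us.
rewrite -[_ * m]mulrC -mulrBl normrM mulrC [`|s1 - s0|]ger0_norm ?subr_ge0 //.
by rewrite ler_wpM2l // subr_ge0.
Qed.

Lemma normal_increment (s m eta : R) : 0 < s ->
  (forall r, 0 < r <= s -> U (xi + r *: nu) /\
     `|dotv (gradient f (xi + r *: nu)) nu - m| <= eta) ->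
  `|f (xi + s *: nu) - f xi - s * m| <= s * eta.
Proof.
move=> s0 h.
have [||c /andP[c0 cs]] := @mvt_half_open R (fun s => f (xi + s *: nu))
    (fun s => dotv (gradient f (xi + s *: nu)) nu) s s0.
- by move=> r /h[Ur _]; exact: C1_line_derive oU hf1 Ur.
- move=> e e0; have [d d0 hd] := lf e0; have v1 : 0 < `|nu| + 1 by rewrite ltr_wpDl.
  exists (Num.min s (d / (`|nu| + 1))) => [|r /andP[r0]].
    by rewrite lt_min s0 divr_gt0.
  rewrite lt_min => /andP[rs rd]; rewrite scale0r addr0; apply: hd.
    rewrite normrZ ger0_norm ?(ltW r0) //; move: rd; rewrite ltr_pdivlMr //.
    by apply: le_lt_trans; rewrite ler_wpM2l ?(ltW r0) // lerDl.
  by have [] := h r; rewrite ?r0 ?(ltW rs).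
- rewrite scale0r addr0 => ->; rewrite [s * m]mulrC -mulrBl normrM mulrC ger0_norm ?(ltW s0) //.
  by rewrite ler_wpM2l ?(ltW s0) //; have [] := h c; rewrite ?c0 ?(ltW cs).
Qed.

Lemma second_difference y (t m : R) : 0 < t ->
  (forall s, `|s| <= t -> U (y + s *: tau) /\
     m <= dotv (tau *m hessian f (y + s *: tau)) tau) ->
  t ^+ 2 * m <= f (y + t *: tau) + f (y + (- t) *: tau) - 2 * f y.
Proof.
move=> t0 h.
pose chi (s : R) := dotv (gradient f (y + s *: tau)) tau.
have hchi (s : R) : `|s| <= t ->
    is_derive s 1 chi (dotv (tau *m hessian f (y + s *: tau)) tau).
  move=> st; have [Us _] := h s st.
  have -> : chi = \sum_(j < n) (tau 0 j \*: (fun s => partial [:: j] f (y + s *: tau))).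
    apply/funext => r; rewrite /chi dotvE fct_sumE; apply: eq_bigr => j _.
    by rewrite gradientE mulrC.
  have -> : dotv (tau *m hessian f (y + s *: tau)) tau =
      \sum_(j < n) tau 0 j *: dotv (gradient (partial [:: j] f) (y + s *: tau)) tau.
    by rewrite dotvE; apply: eq_bigr => j _; rewrite dotv_gradient_partial mulrC.
  apply: is_derive_sum => j; apply: is_deriveZ.
  exact: C1_line_derive oU (C2_partial j hf) Us.
have chi_ge s : 0 <= s <= t -> 2 * s * m <= chi s - chi (- s).
  move=> /andP[s0 st].
  have Ns : - s <= s by lra.
  have [|c /andP[c1 c2] ->] := @mvt_closed R chi
    (fun r => dotv (tau *m hessian f (y + r *: tau)) tau) (- s) s Ns.
    by move=> r /andP[r1 r2]; apply: hchi; rewrite ler_norml; lra.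
  have [|_ hc] := h c; first by rewrite ler_norml; lra.
  have -> : s - - s = 2 * s by lra.
  by rewrite mulrC ler_wpM2r //; lra.
pose g (s : R) := f (y + s *: tau) + f (y + s *: (- tau)) - s ^+ 2 * m.
pose dg (s : R) := chi s - chi (- s) - 2 * s * m.
have [|c /andP[c1 c2]] := @mvt_closed R g dg 0 t (ltW t0).
  move=> s /andP[s0 st]; have hs : `|s| <= t by rewrite ger0_norm.
  have [Us _] := h s hs; have [|Us' _] := h (- s); first by rewrite normrN.
  have -> : g = (fun s => f (y + s *: tau)) + (fun s => f (y + s *: (- tau)))
      - (fun s => s * 0 + s ^+ 2 * m).
    by apply/funext => r; rewrite !fctE mulr0 add0r.
  have -> : dg s = chi s + dotv (gradient f (y + s *: (- tau))) (- tau) - (0 + 2 * s * m).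
    by rewrite /dg /chi dotvNr add0r scalerN scaleNr.
  apply: is_deriveB; last exact: is_derive_quadratic.
  apply: is_deriveD; first exact: C1_line_derive oU hf1 Us.
  by apply: C1_line_derive oU hf1 _; rewrite scalerN -scaleNr.
rewrite /g !scale0r !addr0 expr0n mul0r subr0 scalerN -scaleNr => E.
have : 0 <= dg c by rewrite /dg subr_ge0 chi_ge // c1.
by move: E; have := ltW t0; move: (dg c) => D; nra.
Qed.

(** The bound [below] is used at the two points [xi +- t tau + b t^2 nu] just above
    the osculating parabola.  They are joined to [xi] inside the region by a
    vertical step to height [K t^2], a symmetric horizontal second difference at
    that height, and vertical descents; this needs the derivatives of [f] in the
    open region only.  The vertical parts contribute [b (p - q) . nu], which is
    where the curvature enters. *)
Lemma boundary_second_order :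
  dotv (tau *m H) tau - dotv (tau *m A) tau <= kappa * (dotv p nu - dotv q nu).
Proof.
set X := dotv (tau *m H) tau - _; set Y := dotv p nu - _.
apply/ler_addgt0Pr => e e0.
pose e1 := e / 2 / (1 + `|Y|).
have Y1 : 0 < 1 + `|Y| by rewrite ltr_pwDl.
have e10 : 0 < e1 by rewrite !divr_gt0.
(* The parabola of coefficient [- kappa / 2], raised by the margin [e1 / 2]. *)
pose b := - 2^-1 * (kappa - e1).
(* At this height the whole horizontal segment is above the parabola. *)
pose K := `|kappa| + `|b| + e1 + 1.
have K0 : 0 < K by rewrite /K ltr_wpDl // !addr_ge0 // ltW.
have [d1 d10 h1] := above_parabola (divr_gt0 e10 (ltr0n R 2 : 0 < 2)) K0.
pose eta := e / 4 / (4 * K - 2 * b + 1).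
have Kb : `|b| <= K by rewrite /K; have := normr_ge0 kappa; lra.
have Kb' : b <= K by apply: le_trans (ler_norm _) Kb.
have W0 : 0 < 4 * K - 2 * b + 1 by lra.
have eta0 : 0 < eta by rewrite !divr_gt0.
have [d2 d20 h2] := lp nu eta0.
have [d3 d30 h3] := lH tau eta0.
have [d4 d40 h4] := above_normal.
pose N := `|tau| + K * `|nu| + 1.
have N0 : 0 < N by rewrite /N ltr_wpDl // addr_ge0 // mulr_ge0 // ltW.
pose w := dotv (nu *m A) nu.
have w0 : 0 < b ^+ 2 * `|w| + 1 by rewrite ltr_wpDl // mulr_ge0 // sqr_ge0.
pose m := Num.min (Num.min (Num.min 1 d1) (Num.min (Num.min d2 d3 / N) (d4 / K)))
            (e / 4 / (b ^+ 2 * `|w| + 1)).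
have m0 : 0 < m by rewrite /m !lt_min ltr01 d10 !divr_gt0 // lt_min d20.
pose t := m / 2; have t0 : 0 < t by rewrite divr_gt0.
have : t < m by rewrite /t; lra.
rewrite /m !lt_min !ltr_pdivlMr // !lt_min => /andP[/andP[/andP[t1 td1] /andP[/andP[td2 td3] td4]] tw].
pose T := t ^+ 2; have T0 : 0 < T by rewrite exprn_gt0.
have Tt : T <= t by rewrite /T expr2 ler_piMl // ltW.
have KT0 : 0 < K * T by rewrite mulr_gt0.
have normz t' s : `|t'| <= t -> `|s| <= K * T -> `|t' *: tau + s *: nu| <= t * N.
  move=> ht hs; apply: le_trans (ler_normD _ _) _; rewrite !normrZ /N.
  have st : `|s| <= K * t by apply: le_trans hs _; rewrite ler_pM2l.
  have := ler_wpM2r (normr_ge0 tau) ht; have := ler_wpM2r (normr_ge0 nu) st; lra.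
have region t' s : `|t'| <= t -> `|s| <= K * T ->
    e1 / 2 * T <= s + 2^-1 * kappa * t' ^+ 2 -> U (xi + (t' *: tau + s *: nu)).
  by move=> ht hs hz; apply: (h1 t); rewrite ?t0.
have vert t' : `|t'| <= t -> t' ^+ 2 = T ->
    `|f (xi + (t' *: tau + (K * T) *: nu)) - f (xi + (t' *: tau + (b * T) *: nu))
       - (K * T - b * T) * dotv p nu| <= (K * T - b * T) * eta.
  move=> ht t'T; rewrite !addrA; apply: vertical_increment.
    by rewrite ler_pM2r.
  move=> s /andP[s1 s2].
  have hs : `|s| <= K * T.
    rewrite ler_norml s2 andbT; apply: le_trans s1; rewrite -mulNr ler_pM2r //.
    by move: Kb; rewrite ler_norml => /andP[].
  have Us : U (xi + (t' *: tau + s *: nu)).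
    by apply: region => //; rewrite t'T; move: s1; rewrite /b; lra.
  rewrite -addrA; split=> //; apply: h2 => //.
  exact: le_lt_trans (normz _ _ ht hs) td2.
have horiz : T * (dotv (tau *m H) tau - eta) <=
    f (xi + (t *: tau + (K * T) *: nu)) + f (xi + ((- t) *: tau + (K * T) *: nu))
    - 2 * f (xi + (K * T) *: nu).
  have E (r : R) : xi + (r *: tau + (K * T) *: nu) = xi + (K * T) *: nu + r *: tau.
    by rewrite [r *: tau + _]addrC addrA.
  rewrite !E; apply: second_difference => // s hs.
  have hK : `|K * T| <= K * T by rewrite ger0_norm // ltW.
  have Us : U (xi + (s *: tau + (K * T) *: nu)).
    apply: region => //.
    have sT : s ^+ 2 <= T by rewrite -real_normK ?num_real // lerXn2r ?nnegrE // ltW.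
    have := sqr_ge0 s; have := ler_norm (- kappa); rewrite normrN => k1 s2.
    have : - (`|kappa| * T) <= kappa * s ^+ 2.
      by have := normr_ge0 kappa; nra.
    have : 0 <= `|b| * T by rewrite mulr_ge0 // ltW.
    have : 0 < e1 * T by rewrite mulr_gt0.
    have : 0 <= `|kappa| * T by rewrite mulr_ge0 // ltW.
    by rewrite /K; lra.
  rewrite -E; split=> //; have := h3 _ (le_lt_trans (normz _ _ hs hK) td3) Us.
  by rewrite ler_norml; lra.
have center : `|f (xi + (K * T) *: nu) - f xi - K * T * dotv p nu| <= K * T * eta.
  apply: normal_increment => // r /andP[r0 rK].
  have Ur : U (xi + r *: nu).
    apply: h4; rewrite r0 /=; apply: le_lt_trans rK _; apply: le_lt_trans td4.
    by rewrite mulrC ler_pM2r.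
  split=> //; apply: h2 => //; have := normz 0 r; rewrite scale0r add0r normr0.
  move=> h; apply: le_lt_trans (h (ltW t0) _) td2; rewrite ger0_norm //; exact: ltW.
have top (t' : R) : t' ^+ 2 = T -> `|t'| <= t -> f (xi + (t' *: tau + (b * T) *: nu)) <=
    f xi + (t' * dotv q tau + b * T * dotv q nu) +
    2^-1 * (T * dotv (tau *m A) tau + t' * (b * T) * (dotv (tau *m A) nu + dotv (nu *m A) tau)
      + (b * T) ^+ 2 * w).
  move=> t'T ht; have Uz : U (xi + (t' *: tau + (b * T) *: nu)).
    apply: region => //; last by rewrite t'T /b; lra.
    by rewrite normrM (ger0_norm (ltW T0)) ler_pM2r.
  apply: le_trans (below Uz) _.
  rewrite mulmxDl -!scalemxAl !(dotvDl, dotvDr, dotvZl, dotvZr) -/w -t'T.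
  by rewrite le_eqVlt; apply/orP; left; apply/eqP; ring.
have tT : t ^+ 2 = T by [].
have tT' : (- t) ^+ 2 = T by rewrite sqrrN.
have ht : `|t| <= t by rewrite ger0_norm // ltW.
have ht' : `|- t| <= t by rewrite normrN.
have v1 := vert t ht tT; have v2 := vert (- t) ht' tT'.
have p1 := top t tT ht; have p2 := top (- t) tT' ht'.
have E1 : T * (eta * (4 * K - 2 * b + 1)) = T * (e / 4) by rewrite /eta divfK // gt_eqF.
have E2 : T * (b ^+ 2 * T * w) <= T * (e / 4).
  rewrite ler_pM2l //; apply: (@le_trans _ _ (t * (b ^+ 2 * `|w|))); last by move: tw; lra.
  have -> : b ^+ 2 * T * w = T * (b ^+ 2 * w) by ring.
  have h1' : b ^+ 2 * w <= b ^+ 2 * `|w| by rewrite ler_wpM2l ?sqr_ge0 // ler_norm.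
  apply: (@le_trans _ _ (T * (b ^+ 2 * `|w|))); first by rewrite ler_pM2l.
  by rewrite ler_wpM2r // mulr_ge0 ?sqr_ge0.
have E3 : T * (- e1 * Y) <= T * (e / 2).
  rewrite ler_pM2l //; have : e1 * (1 + `|Y|) = e / 2 by rewrite /e1 divfK // gt_eqF.
  have : e1 * (- Y) <= e1 * `|Y| by rewrite ler_pM2l // -normrN ler_norm.
  lra.
have E4 : - 2 * b * T * Y = T * (kappa * Y) + T * (- e1 * Y) by rewrite /b; field.
rewrite -(ler_pM2l T0) mulrDr.
move: v1 v2 center; rewrite !ler_norml => /andP[_ v1] /andP[_ v2] /andP[c1 _].
move: E1 E2 E3 E4 p1 p2 v1 v2 c1 horiz.
rewrite /X /Y; clear.
move: (f _) (f _) (f _) (f _) (f _) (f xi) => F1 F2 F3 F4 F5 F0.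
move: (dotv _ _) (dotv _ _) (dotv _ _) (dotv _ _) (dotv _ _) => D1 D2 D3 D4 D5.
lra.
Qed.

End Comparison.
End Region.

End BoundarySecondOrder.

(** * Defining functions and the exterior normal *)

Section DomainGeometry.
Variables (R : realType) (n : nat).
Implicit Types (x y z v tau : 'rV[R]_n) (D U : set 'rV[R]_n) (rho : 'rV[R]_n -> R).

Lemma exterior_open D : open (exterior D).
Proof. by apply: closed_openC; exact: closed_closure. Qed.

Lemma closure_eps D x : closure D x <->
  forall d : R, 0 < d -> exists z, `|z| < d /\ D (x + z).
Proof.
split=> [cx d d0|h B /nbhs_eps[d d0 hd]].
  have [|y [Dy yd]] := cx [set y | `|y - x| < d].
    by apply/nbhs_eps; exists d => // z; rewrite /= [x + z]addrC addrK.
  by exists (y - x); split=> //; rewrite addrC subrK.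
by have [z [zd Dz]] := h d d0; exists (x + z); split=> //; exact: hd.
Qed.

Lemma exterior_eps D x : exterior D x <->
  exists2 d : R, 0 < d & forall z, `|z| < d -> ~ D (x + z).
Proof.
split=> [h|[d d0 h] /closure_eps/(_ d d0)[z [zd]]]; last exact: h.
apply: contrapT => h'; apply: h; apply/closure_eps => d d0.
apply: contrapT => h2; apply: h'; exists d => // z zd Dz; apply: h2.
by exists z.
Qed.

Section DefiningFunction.
Variables (D U : set 'rV[R]_n) (rho : 'rV[R]_n -> R).
Hypotheses (oD : open D) (hrho : defining_function D U rho).

Let oU : open U. Proof. by case: hrho. Qed.
Lemma defining_C_on m : C_on m U rho. Proof. by case: hrho. Qed.
Let C1rho : C_on 1 U rho := @defining_C_on 1%N.

Lemma defining_neg y : U y -> rho y < 0 -> D y.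
Proof. by case: hrho => _ _ _ h Uy; exact: (h y Uy).2. Qed.

Lemma defining_pos y : U y -> 0 < rho y -> exterior D y.
Proof.
move=> Uy ry; apply/exterior_eps; have [dU dU0 hU] := open_eps oU Uy.
have r2 : 0 < rho y / 2 by rewrite divr_gt0.
have [d d0 hd] := continuous_eps (C_on_continuous C1rho Uy) r2.
exists (Num.min dU d) => [|z]; first by rewrite lt_min dU0.
rewrite lt_min => /andP[zU zd]; case: hrho => _ _ _ h /(h _ (hU _ zU)).1.
by have := hd _ zd; rewrite ler_norml; lra.
Qed.

Lemma defining_boundary y : boundary D y -> U y -> rho y = 0.
Proof.
move=> [cy iy] Uy; have [r0|r0|//] := ltrgtP (rho y) 0.
  by exfalso; apply: iy; apply: open_nbhs_nbhs; split=> //; exact: defining_neg.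
by exfalso; exact: (defining_pos Uy r0).
Qed.

Lemma defining_direction_signed (s : R) xi v : U xi -> rho xi = 0 ->
  0 < s * dotv (gradient rho xi) v -> exists2 d : R, 0 < d &
    forall t : R, 0 < t < d -> U (xi + t *: v) /\ 0 < s * rho (xi + t *: v).
Proof.
move=> Ux r0 gv; set c := dotv _ _ in gv.
have v1 : 0 < (`|s| + 1) * (`|v| + 1) by rewrite mulr_gt0 // ltr_wpDl.
have e0 : 0 < s * c / 2 / ((`|s| + 1) * (`|v| + 1)) by rewrite !divr_gt0.
have [d1 d10 h1] := C1_expansion oU C1rho Ux e0; have [d2 d20 h2] := open_eps oU Ux.
have v2 : 0 < `|v| + 1 by rewrite ltr_wpDl.
exists (Num.min d1 d2 / (`|v| + 1)) => [|t /andP[t0]]; first by rewrite divr_gt0 // lt_min d10.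
rewrite ltr_pdivlMr // lt_min => /andP[t1 t2].
have tv : `|t *: v| <= t * (`|v| + 1) by rewrite normrZ gtr0_norm // ler_pM2l // lerDl.
split; first by apply: h2; exact: le_lt_trans tv t2.
have := h1 _ (le_lt_trans tv t1); rewrite r0 subr0 dotvZr -/c; set X := rho _ - _ => h.
have : `|s * X| <= s * c / 2 * t.
  rewrite normrM; apply: (@le_trans _ _ ((`|s| + 1) * (s * c / 2 / ((`|s| + 1) * (`|v| + 1)) *
    (t * (`|v| + 1))))); last by rewrite le_eqVlt; apply/orP; left; apply/eqP; field; rewrite !gt_eqF // ltr_wpDl.
  apply: ler_pM => //; first by rewrite lerDl.
  by apply: le_trans h _; rewrite ler_pM2l.
rewrite ler_norml => /andP[h3 _].
have -> : s * rho (xi + t *: v) = s * X + t * (s * c) by rewrite /X; ring.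
have : 0 < t * (s * c) by rewrite mulr_gt0.
lra.
Qed.

Lemma defining_direction xi v : U xi -> rho xi = 0 -> 0 < dotv (gradient rho xi) v ->
  exists2 d : R, 0 < d & forall t : R, 0 < t < d -> U (xi + t *: v) /\
    0 < rho (xi + t *: v).
Proof.
move=> Ux r0 gv; have [|d d0 hd] := @defining_direction_signed 1 xi v Ux r0; first by rewrite mul1r.
by exists d => // t /hd; rewrite mul1r.
Qed.

Lemma defining_direction_neg xi v : U xi -> rho xi = 0 -> dotv (gradient rho xi) v < 0 ->
  exists2 d : R, 0 < d & forall t : R, 0 < t < d -> U (xi + t *: v) /\
    rho (xi + t *: v) < 0.
Proof.
move=> Ux r0 gv; have [|d d0 hd] := @defining_direction_signed (-1) xi v Ux r0.
  by rewrite mulN1r oppr_gt0.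
by exists d => // t /hd; rewrite mulN1r oppr_gt0.
Qed.

Lemma defining_gradient_gt0 xi : U xi -> 0 < dotv (gradient rho xi) (gradient rho xi).
Proof. by move=> Ux; rewrite dotvv_gt0; case: hrho => _ _ h _; exact: h. Qed.

Lemma defining_zero_boundary xi : U xi -> rho xi = 0 -> boundary D xi.
Proof.
move=> Ux r0; split.
  apply/closure_eps => d d0; have g0 := defining_gradient_gt0 Ux.
  have [|d1 d10 h1] := @defining_direction_neg xi (- gradient rho xi) Ux r0.
    by rewrite dotvNr oppr_lt0.
  have v1 : 0 < `|gradient rho xi| + 1 by rewrite ltr_wpDl.
  pose t := Num.min d1 (d / (`|gradient rho xi| + 1)) / 2.
  have m0 : 0 < Num.min d1 (d / (`|gradient rho xi| + 1)) by rewrite lt_min d10 divr_gt0.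
  have t0 : 0 < t by rewrite divr_gt0.
  have : t < Num.min d1 (d / (`|gradient rho xi| + 1)) by rewrite /t; lra.
  rewrite lt_min ltr_pdivlMr // => /andP[td1 td].
  have [|Ut rt] := h1 t; first by rewrite t0.
  exists (t *: - gradient rho xi); split; last exact: defining_neg.
  rewrite normrZ normrN gtr0_norm //; apply: le_lt_trans td.
  by rewrite ler_pM2l // lerDl.
move=> /interior_subset; case: hrho => _ _ _ h /(h _ Ux).1; by rewrite r0 ltxx.
Qed.

End DefiningFunction.

(** The negative half-space of a unit vector determines it: test with [b - a]. *)
Lemma unit_vectors_eq (a b : 'rV[R]_n) : dotv a a = 1 -> dotv b b = 1 ->
  (forall v, dotv a v < 0 -> dotv b v <= 0) -> a = b.
Proof.
move=> a1 b1 h; apply/eqP; rewrite -subr_eq0 -dotvv_eq0; apply: contraT => nz.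
have d0 : 0 < dotv (a - b) (a - b) by rewrite lt_neqAle dotvv_ge0 eq_sym nz.
move: d0; rewrite !(dotvBl, dotvBr) a1 b1 (dotvC b a) => d0.
have := h (b - a); rewrite !dotvBr a1 b1 (dotvC b a); lra.
Qed.

Lemma unit_normalization (g : 'rV[R]_n) : g != 0 ->
  dotv ((enorm g)^-1 *: g) ((enorm g)^-1 *: g) = 1.
Proof.
move=> g0; have e0 : enorm g != 0 by rewrite enorm_eq0.
by rewrite dotvZl dotvZr -sqr_enorm; field.
Qed.

(** Two defining functions are negative on the same side of the boundary, so their
    gradients there have the same negative half-space, hence the same direction. *)
Lemma unit_normalE D U rho xi : open D -> boundary D xi -> U xi ->
  defining_function D U rho ->
  unit_normal D xi = (enorm (gradient rho xi))^-1 *: gradient rho xi.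
Proof.
move=> oD bxi Ux hrho; rewrite /unit_normal; case: xgetP => [w _ [U' [rho' [Ux' hrho' ->]]]|]; last first.
  move=> /(_ ((enorm (gradient rho xi))^-1 *: gradient rho xi))[].
  by exists U, rho.
have r0 := defining_boundary oD hrho bxi Ux; have r0' := defining_boundary oD hrho' bxi Ux'.
have g0 : gradient rho xi != 0 by rewrite -dotvv_gt0; exact: defining_gradient_gt0 hrho _ Ux.
have g0' : gradient rho' xi != 0 by rewrite -dotvv_gt0; exact: defining_gradient_gt0 hrho' _ Ux'.
apply: unit_vectors_eq; [exact: unit_normalization|exact: unit_normalization|].
move=> v; rewrite !dotvZl pmulr_rlt0 ?invr_gt0 ?enorm_gt0 // => h'.
rewrite pmulr_rle0 ?invr_gt0 ?enorm_gt0 // leNgt; apply/negP => h.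
have [d d0 hd] := defining_direction hrho Ux r0 h.
have [d' d0' hd'] := defining_direction_neg hrho' Ux' r0' h'.
pose t := Num.min d d' / 2; have m0 : 0 < Num.min d d' by rewrite lt_min d0.
have t0 : 0 < t by rewrite divr_gt0.
have : t < Num.min d d' by rewrite /t; lra.
rewrite lt_min => /andP[td td'].
have [|Ut rt] := hd t; first by rewrite t0.
have [|Ut' rt'] := hd' t; first by rewrite t0.
have Dt := defining_neg hrho' Ut' rt'.
have := defining_pos hrho Ut rt; apply; exact: subset_closure.
Qed.

End DomainGeometry.

(** * Second fundamental form and tangent frame *)

Section ContinuityRules.
Variables (T : topologicalType) (R : realType).

Lemma continuous_sum (I : finType) (f : I -> T -> R) x :
  (forall i, {for x, continuous (f i)}) -> {for x, continuous (fun y => \sum_i f i y)}.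
Proof.
move=> h; rewrite /continuous_at.
apply: (@cvg_big _ _ +%R _ _ _ _ _ _ (fun i y => f i y) (fun i => f i x)) => [|i _]; last exact: h.
exact: add_continuous.
Qed.

Lemma continuous_dotv n (f g : T -> 'rV[R]_n) x :
  (forall i, {for x, continuous (fun y => f y 0 i)}) ->
  (forall i, {for x, continuous (fun y => g y 0 i)}) ->
  {for x, continuous (fun y => dotv (f y) (g y))}.
Proof.
move=> hf hg; have -> : (fun y => dotv (f y) (g y)) = fun y => \sum_i f y 0 i * g y 0 i.
  by apply/funext => y; rewrite dotvE.
by apply: continuous_sum => i; apply: continuousM.
Qed.

Lemma continuous_mulmx n (f : T -> 'rV[R]_n) (M : T -> 'M[R]_n) x j :
  (forall i, {for x, continuous (fun y => f y 0 i)}) ->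
  (forall i k, {for x, continuous (fun y => M y i k)}) ->
  {for x, continuous (fun y => (f y *m M y) 0 j)}.
Proof.
move=> hf hM; have -> : (fun y => (f y *m M y) 0 j) = fun y => \sum_i f y 0 i * M y i j.
  by apply/funext => y; rewrite mxE.
by apply: continuous_sum => i; apply: continuousM.
Qed.

End ContinuityRules.

Section Frame.
Variables (R : realType).

Lemma sym_idempotent_trace0 n (Q : 'M[R]_n) : Q^T = Q -> Q *m Q = Q -> \tr Q = 0 -> Q = 0.
Proof.
move=> sQ QQ t0.
have : \sum_i \sum_j Q i j ^+ 2 = 0.
  rewrite -[RHS]t0 -[in RHS]QQ /mxtrace; apply: eq_bigr => i _; rewrite mxE.
  by apply: eq_bigr => j _; rewrite expr2 -[in X in _ * X = _]sQ mxE.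
move=> /psumr_eq0P h; apply/matrixP => i j; rewrite mxE.
have /psumr_eq0P : \sum_j Q i j ^+ 2 = 0.
  by apply: h => // k _; rewrite sumr_ge0 // => l _; exact: sqr_ge0.
move=> /(_ (fun l _ => sqr_ge0 _) j isT) /eqP; rewrite sqrf_eq0; exact: eqP.
Qed.

(** Completing the tangent frame by the normal gives an orthonormal basis: the
    defect of the completeness relation is an orthogonal projection of trace 0. *)
Lemma frame_complete m (E : 'M[R]_(m, m.+1)) (nu : 'rV[R]_m.+1) :
  E *m E^T = 1%:M -> E *m nu^T = 0 -> dotv nu nu = 1 -> E^T *m E + nu^T *m nu = 1%:M.
Proof.
move=> EE En nn; set P := _ + _; apply/eqP; rewrite eq_sym -subr_eq0; apply/eqP.
have nE : nu *m E^T = 0 by rewrite -[LHS]trmxK trmx_mul trmxK En trmx0.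
have n1 : nu *m nu^T = 1%:M by apply/matrixP => i j; rewrite !ord1 !mxE /=; rewrite -nn /dotv !mxE.
have PP : P *m P = P.
  rewrite /P mulmxDr !mulmxDl !mulmxA -(mulmxA E^T E E^T) EE mulmx1.
  rewrite -(mulmxA nu^T nu E^T) nE mulmx0 mul0mx addr0.
  rewrite -(mulmxA E^T E nu^T) En mulmx0 mul0mx add0r.
  by rewrite -(mulmxA nu^T nu nu^T) n1 mulmx1.
apply: sym_idempotent_trace0.
- by rewrite linearB /= trmx1 /P linearD /= !trmx_mul !trmxK.
- by rewrite mulmxBl mul1mx mulmxBr mulmx1 PP subrr subr0.
rewrite linearB /= /P linearD /= mxtrace_mulC EE mxtrace_mulC n1 !mxtrace1.
by rewrite -[m.+1]addn1 natrD; ring.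
Qed.

Lemma frame_trace m (E : 'M[R]_(m, m.+1)) (nu : 'rV[R]_m.+1) (M : 'M[R]_m.+1) :
  E *m E^T = 1%:M -> E *m nu^T = 0 -> dotv nu nu = 1 ->
  \sum_i dotv (row i E *m M) (row i E) = \tr M - dotv (nu *m M) nu.
Proof.
move=> EE En nn.
have -> : \sum_i dotv (row i E *m M) (row i E) = \tr (E *m M *m E^T).
  rewrite /mxtrace; apply: eq_bigr => i _; rewrite /dotv -row_mul !mxE.
  by apply: eq_bigr => j _; rewrite !mxE.
rewrite mxtrace_mulC mulmxA.
have -> : E^T *m E = 1%:M - nu^T *m nu by rewrite -(frame_complete EE En nn) addrK.
rewrite mulmxBl mul1mx linearB /=; congr (_ - _).
by rewrite -mulmxA mxtrace_mulC /mxtrace big_ord_recl big_ord0 addr0.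
Qed.

(** If the characteristic polynomial does not split, then [eigenvalues] takes its
    default value 0, whose first symmetric function vanishes. *)
Lemma sigma1_trace n (M : 'M[R]_n) : 0 < sigma 1 (eigenvalues M) ->
  sigma 1 (eigenvalues M) = \tr M.
Proof.
case: n M => [|n] M.
  rewrite /sigma big_pred0 ?ltxx // => S; rewrite eqn_leq; apply/negbTE; rewrite negb_and.
  apply/orP; right; rewrite -ltnNge ltnS leqn0 cards_eq0; apply/eqP/setP => - [i hi]; lia.
rewrite /eigenvalues; case: xgetP => [l _ /= E _|_].
  by rewrite -(esf_sigma _ E) // esf1.
rewrite /sigma big1 ?ltxx // => S /eqP; move=> /eqP/cards1P[i ->].
by rewrite big_set1 mxE.
Qed.

End Frame.

Section BoundaryPoint.
Variables (R : realType) (n : nat) (D : set 'rV[R]_n) (xi : 'rV[R]_n).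
Hypotheses (oD : open D) (bxi : boundary D xi).
Variables (U : set 'rV[R]_n) (rho : 'rV[R]_n -> R).
Hypotheses (Ux : U xi) (hrho : defining_function D U rho).

Let oU : open U. Proof. by case: hrho. Qed.
Let nu := unit_normal D xi.
Let a := enorm (gradient rho xi).

Lemma gradient_neq0 y : U y -> gradient rho y != 0.
Proof. by case: hrho => _ _ h _; exact: h. Qed.

Lemma gradient_enorm_gt0 y : U y -> 0 < enorm (gradient rho y).
Proof. by move=> /gradient_neq0; rewrite enorm_gt0. Qed.

Lemma gradient_normal : gradient rho xi = a *: nu.
Proof.
rewrite /nu (unit_normalE oD bxi Ux hrho) scalerA divff ?scale1r //.
by rewrite gt_eqF // gradient_enorm_gt0.
Qed.

Lemma unit_normal_unit : dotv nu nu = 1.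
Proof. by rewrite /nu (unit_normalE oD bxi Ux hrho) unit_normalization // gradient_neq0. Qed.

Lemma defining_regular : exists2 d : R, 0 < d &
  forall z, `|z| < d -> 0 < rho (xi + z) -> exterior D (xi + z).
Proof.
have [d d0 hd] := open_eps oU Ux; exists d => // z /hd; exact: defining_pos.
Qed.

Lemma defining_jet : jet2 rho xi (a *: nu) (hessian rho xi).
Proof. by rewrite -gradient_normal; exact: (C2_jet oU (@defining_C_on _ _ _ _ _ hrho 2%N) Ux). Qed.

(** In every tangent direction the boundary is reached to first order: cross it
    along the normal between the two sides of the tangent plane. *)
Lemma boundary_along tau (e : R) : dotv nu tau = 0 -> 0 < e ->
  exists2 d : R, 0 < d & forall t, 0 < t < d ->
    exists2 eta : R, `|eta| <= e & boundary D (xi + t *: (tau + eta *: nu)).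
Proof.
move=> nt e0; have a0 : 0 < a := gradient_enorm_gt0 Ux.
have r0 := defining_boundary oD hrho bxi Ux.
have slope s : dotv (gradient rho xi) (tau + s *: nu) = a * s.
  by rewrite gradient_normal dotvZl dotvDr nt add0r dotvZr unit_normal_unit mulr1.
have [|d1 d10 h1] := @defining_direction _ _ _ _ _ hrho xi (tau + e *: nu) Ux r0.
  by rewrite slope mulr_gt0.
have [|d2 d20 h2] := @defining_direction_neg _ _ _ _ _ hrho xi (tau + (- e) *: nu) Ux r0.
  by rewrite slope mulrN oppr_lt0 mulr_gt0.
have [d3 d30 h3] := open_eps oU Ux.
pose N := `|tau| + e * `|nu| + 1.
have N0 : 0 < N by rewrite /N ltr_wpDl // addr_ge0 // mulr_ge0 // ltW.
exists (Num.min d1 (Num.min d2 (d3 / N))) => [|t /andP[t0]].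
  by rewrite !lt_min d10 d20 divr_gt0.
rewrite !lt_min ltr_pdivlMr // => /and3P[t1 t2 t3].
have Us (s : R) : `|s| <= e -> U (xi + t *: (tau + s *: nu)).
  move=> se; apply: h3; apply: le_lt_trans t3; rewrite normrZ gtr0_norm // ler_pM2l //.
  apply: le_trans (ler_normD _ _) _; rewrite /N -addrA lerD2l normrZ.
  by apply: (@le_trans _ _ (e * `|nu|)); rewrite ?ler_wpM2r // lerDl.
have [|_ p1] := h1 t; first by rewrite t0.
have [|_ p2] := h2 t; first by rewrite t0.
pose g (s : R) := rho (xi + t *: (tau + s *: nu)).
have gE : g = fun s : R => rho ((xi + t *: tau) + s *: (t *: nu)).
  by apply/funext => s; rewrite /g scalerDr addrA scalerA mulrC -scalerA.
have [|||eta] := @IVT R g (- e) e 0.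
- lra.
- apply: derivable_within_continuous => s; rewrite in_itv /= => se.
  have Uss : U ((xi + t *: tau) + s *: (t *: nu)).
    by move: (Us s); rewrite scalerDr addrA scalerA mulrC -scalerA; apply; rewrite ler_norml.
  rewrite gE; have := C1_line_derive oU (@defining_C_on _ _ _ _ _ hrho 1%N) Uss.
  by move=> hd; exact: ex_derive.
- by rewrite /g ge_min le_max (ltW p1) (ltW p2) orbT.
rewrite in_itv /= -ler_norml => he g0; exists eta => //.
by apply: (defining_zero_boundary hrho) => //; exact: Us.
Qed.

(** Evaluate the covector on the chords provided by [boundary_along]. *)
Lemma tangential_covector p tau : dotv nu tau = 0 ->
  (forall e : R, 0 < e -> exists2 d : R, 0 < d & forall z, `|z| < d ->
     boundary D (xi + z) -> `|dotv p z| <= e * `|z|) -> dotv p tau = 0.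
Proof.
move=> nt h; apply/eqP; rewrite -normr_le0; apply/ler_addgt0Pr => e e0; rewrite add0r.
pose N := `|tau| + `|nu|; pose N1 := N + `|dotv p nu| + 1.
have N0 : 0 <= N by rewrite addr_ge0.
have N10 : 0 < N1 by rewrite /N1 ltr_wpDl // addr_ge0.
pose e1 := Num.min 1 (e / N1); have e10 : 0 < e1 by rewrite lt_min ltr01 divr_gt0.
have e11 : e1 <= 1 by rewrite ge_min lexx.
have e1e : e1 * N1 <= e by rewrite -ler_pdivlMr // ge_min lexx orbT.
have [d d0 hd] := h e1 e10; have [d' d'0 hd'] := boundary_along nt e10.
pose t := Num.min d' (d / (N + 1)) / 2.
have m0 : 0 < Num.min d' (d / (N + 1)) by rewrite lt_min d'0 divr_gt0 // ltr_wpDl.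
have t0 : 0 < t by rewrite divr_gt0.
have : t < Num.min d' (d / (N + 1)) by rewrite /t; lra.
rewrite lt_min ltr_pdivlMr ?ltr_wpDl // => /andP[td' td].
have [|eta he hb] := hd' t; first by rewrite t0.
have nv : `|tau + eta *: nu| <= N.
  apply: le_trans (ler_normD _ _) _; rewrite lerD2l normrZ ler_piMl //.
  exact: le_trans he e11.
have nz : `|t *: (tau + eta *: nu)| <= t * N.
  by rewrite normrZ gtr0_norm // ler_pM2l.
have /hd : `|t *: (tau + eta *: nu)| < d.
  by apply: le_lt_trans nz _; apply: le_lt_trans td; rewrite ler_pM2l // lerDl.
move=> /(_ hb); rewrite dotvZr normrM (gtr0_norm t0) => h1.
have h2 : t * `|dotv p (tau + eta *: nu)| <= t * (e1 * N).
  by apply: le_trans h1 _; rewrite mulrCA ler_wpM2l // ltW.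
move: h2; rewrite ler_pM2l // dotvDr dotvZr => h2.
have h3 : `|eta * dotv p nu| <= e1 * `|dotv p nu| by rewrite normrM ler_wpM2r.
have h4 : e1 * N1 = e1 * N + e1 * `|dotv p nu| + e1 by rewrite /N1; ring.
have := ler_normB (dotv p tau + eta * dotv p nu) (eta * dotv p nu).
rewrite addrK; lra.
Qed.

Lemma continuous_gradient i : {for xi, continuous (fun y => gradient rho y 0 i)}.
Proof.
have -> : (fun y => gradient rho y 0 i) = partial [:: i] rho.
  by apply/funext => y; rewrite gradientE.
by have [h _] := @defining_C_on _ _ _ _ _ hrho 1%N [:: i] isT; exact: h.
Qed.

Lemma continuous_hessian i j : {for xi, continuous (fun y => hessian rho y i j)}.
Proof.
have -> : (fun y => hessian rho y i j) = partial [:: i; j] rho.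
  by apply/funext => y; rewrite mxE.
by have [h _] := @defining_C_on _ _ _ _ _ hrho 2%N [:: i; j] isT; exact: h.
Qed.

Lemma continuous_gradient_enorm : {for xi, continuous (fun y => enorm (gradient rho y))}.
Proof.
apply: (@continuous_comp _ _ _ (fun y => dotv (gradient rho y) (gradient rho y)) Num.sqrt).
  by apply: continuous_dotv; exact: continuous_gradient.
exact: sqrt_continuous.
Qed.

Lemma gradient_expansion tau (e : R) : 0 < e -> exists2 d : R, 0 < d & forall z, `|z| < d ->
  `|dotv (gradient rho (xi + z)) tau - dotv (gradient rho xi) tau
     - dotv (z *m hessian rho xi) tau| <= e * `|z|.
Proof.
move=> e0; pose e' := e / (n%:R * `|tau| + 1).
have N0 : 0 < n%:R * `|tau| + 1 by rewrite ltr_wpDl // mulr_ge0.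
have e'0 : 0 < e' by rewrite divr_gt0.
have C2 : C_on 2 U rho := @defining_C_on _ _ _ _ _ hrho 2%N.
have [d d0 hd] := forall_eps (fun i => C1_expansion oU (C2_partial i C2) Ux e'0).
exists d => // z /hd{}hd; rewrite -!dotvBl.
apply: le_trans (dotv_le_norm _ _) _.
have : `|gradient rho (xi + z) - gradient rho xi - z *m hessian rho xi| <= e' * `|z|.
  apply/norm_rV_le => [|i]; first by rewrite mulr_ge0 // ltW.
  have -> : (gradient rho (xi + z) - gradient rho xi - z *m hessian rho xi) 0 i =
    gradient rho (xi + z) 0 i - gradient rho xi 0 i - (z *m hessian rho xi) 0 i by rewrite !mxE.
  by rewrite !gradientE -dotv_gradient_partial; exact: hd.
move=> hz; apply: (@le_trans _ _ (n%:R * `|tau| * (e' * `|z|))).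
  by rewrite mulrAC ler_wpM2l // mulr_ge0.
rewrite mulrA ler_wpM2r // /e' mulrCA ger_pMr // mulrC ltW //.
by rewrite -mulrC ltr_pdivrMr // mul1r ltrDl.
Qed.

(** On the boundary the gradient of [rho] is its length times the extended normal.
    Both sides of its product with [tau] have first-order expansions at [xi], with
    covectors [Hess rho tau] and [a] times the derivative of the normal; by
    [tangential_covector] these agree on [tau]. *)
Lemma second_fundamental_form_diag tau : dotv nu tau = 0 ->
  (exists N : 'rV[R]_n -> 'rV[R]_n, differentiable N xi /\
     \forall x \near xi, boundary D x -> N x = unit_normal D x) ->
  second_fundamental_form D xi tau tau = dotv (tau *m hessian rho xi) tau / a.
Proof.
move=> nt [N0 hN0]; rewrite /second_fundamental_form /normal_extension.
case: xgetP => [N _ /= [dN /nbhs_eps[dn dn0 hn]]|/(_ N0)//].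
have a0 : 0 < a := gradient_enorm_gt0 Ux.
rewrite deriveEjacobian //; set J := jacobian N xi.
have expN (e : R) : 0 < e -> exists2 d : R, 0 < d & forall z, `|z| < d ->
    `|N (xi + z) - N xi - z *m J| <= e * `|z|.
  move=> e0; have [_ /eqaddoP/(_ _ e0)/nbhs_eps[d d0 hd]] := (diff_locallyP xi N).1 dN.
  exists d => // z zd; have := hd z zd; rewrite add0r.
  by rewrite /J /jacobian mul_rV_lin1 !fctE /= opprD addrA [z + xi]addrC.
suff : dotv (a *: (tau *m J^T) - tau *m (hessian rho xi)^T) tau = 0.
  rewrite dotvBl dotvZl !dotv_mulmxT => /eqP; rewrite subr_eq0 => /eqP <-.
  by rewrite mulrAC divff ?mul1r ?gt_eqF.
apply: (tangential_covector nt) => e e0.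
have [K K0 hK] := mulmx_norm_bound J.
pose B := K * `|tau| + (a + 1) * (n%:R * `|tau|) + 1.
have B1 : 0 <= K * `|tau| by rewrite mulr_ge0 // ltW.
have B2 : 0 <= (a + 1) * (n%:R * `|tau|) by rewrite !mulr_ge0 // ltW // ltr_wpDl // ltW.
have B0 : 0 < B by rewrite /B ltr_wpDl // addr_ge0.
pose e1 := Num.min 1 (e / B); have e10 : 0 < e1 by rewrite lt_min ltr01 divr_gt0.
have e11 : e1 <= 1 by rewrite ge_min lexx.
have e1e : e1 * B <= e by rewrite -ler_pdivlMr // ge_min lexx orbT.
have [d1 d10 h1] := expN e1 e10; have [d2 d20 h2] := gradient_expansion tau e10.
have [d3 d30 h3] := continuous_eps continuous_gradient_enorm e10.
have [d4 d40 h4] := open_eps oU Ux.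
exists (Num.min (Num.min dn d1) (Num.min d2 (Num.min d3 d4))) => [|z].
  by rewrite !lt_min dn0 d10 d20 d30.
rewrite !lt_min => /andP[/andP[zn z1] /and3P[z2 z3 z4]] bz.
have Uz := h4 z z4; set m := enorm (gradient rho (xi + z)).
have m0 : 0 < m := gradient_enorm_gt0 Uz.
have Nz : m * dotv (N (xi + z)) tau = dotv (gradient rho (xi + z)) tau.
  rewrite hn // (unit_normalE oD bz Uz hrho) dotvZl mulrA divff ?mul1r // gt_eqF //.
have Nx : dotv (N xi) tau = 0.
  by have := hn 0; rewrite normr0 addr0 => -> //; exact: nt.
have gx : dotv (gradient rho xi) tau = 0 by rewrite gradient_normal dotvZl nt mulr0.
have := h1 z z1; set w := _ - z *m J => hw.
have hw1 : `|dotv w tau| <= e1 * (n%:R * `|tau|) * `|z|.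
  apply: le_trans (dotv_le_norm _ _) _.
  have -> : e1 * (n%:R * `|tau|) * `|z| = n%:R * (e1 * `|z|) * `|tau| by ring.
  by rewrite ler_wpM2r // ler_wpM2l.
have wE : dotv w tau = dotv (N (xi + z)) tau - dotv (z *m J) tau by rewrite /w !dotvBl Nx subr0.
have := h2 z z2; rewrite gx subr0; set o2 := _ - _ => ho2.
have := h3 z z3; rewrite -/m -/a => hm.
rewrite dotvBl dotvZl !dotv_mulmxT.
have -> : a * dotv (z *m J) tau - dotv (z *m hessian rho xi) tau =
   (a - m) * dotv (z *m J) tau - m * dotv w tau + o2 by rewrite /o2 -Nz wE; ring.
have hJ := hK z tau.
have T1 : `|(a - m) * dotv (z *m J) tau| <= e1 * (K * `|tau| * `|z|).
  have -> : K * `|tau| * `|z| = K * `|z| * `|tau| by ring.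
  rewrite normrM; apply: ler_pM; [exact: normr_ge0|exact: normr_ge0| |exact: hJ].
  by rewrite distrC; exact: hm.
have T2 : `|m * dotv w tau| <= (a + 1) * (e1 * (n%:R * `|tau|) * `|z|).
  rewrite normrM; apply: ler_pM; [exact: normr_ge0|exact: normr_ge0| |exact: hw1].
  rewrite (gtr0_norm m0); move: hm; rewrite ler_norml => /andP[_ hm].
  by rewrite -lerBlDl; exact: le_trans hm e11.
have T3 : e1 * B * `|z| <= e * `|z| by rewrite ler_wpM2r.
have T4 : e1 * B * `|z| = e1 * (K * `|tau| * `|z|) + (a + 1) * (e1 * (n%:R * `|tau|) * `|z|)
   + e1 * `|z| by rewrite /B; ring.
apply: le_trans (ler_normD _ _) _; have := ler_normB ((a - m) * dotv (z *m J) tau) (m * dotv w tau).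
move: ho2 T1 T2 T3; rewrite T4; set x1 := `|o2|; set x2 := `|_ * _|; lra.
Qed.

End BoundaryPoint.

(** * Mean curvature of the boundary *)

Section MeanCurvature.
Variables (R : realType) (m : nat) (D : set 'rV[R]_m.+1).
Hypothesis oD : open D.
Implicit Types (U : set 'rV[R]_m.+1) (rho : 'rV[R]_m.+1 -> R).

(** Positivity of the mean curvature forces the normal extension and the tangent
    frame to exist, since the trace would otherwise vanish. *)
Lemma mean_curvature_frame U rho xi : boundary D xi -> U xi -> defining_function D U rho ->
  0 < sigma 1 (principal_curvatures D xi) ->
  let E := tangent_frame D xi in
  [/\ E *m E^T = 1%:M, E *m (unit_normal D xi)^T = 0 &
    sigma 1 (principal_curvatures D xi) =
      \sum_i dotv (row i E *m hessian rho xi) (row i E) / enorm (gradient rho xi)].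
Proof.
move=> bxi Ux hrho s0 E; move: (s0); rewrite /principal_curvatures => s1.
rewrite (sigma1_trace s1); move: s0; rewrite /principal_curvatures sigma1_trace //.
rewrite /mxtrace => t0.
have z0 v : v = 0 -> second_fundamental_form D xi v v = 0.
  by move=> ->; rewrite /second_fundamental_form dotv0r.
have [EE En] : E *m E^T = 1%:M /\ E *m (unit_normal D xi)^T = 0.
  move: t0; rewrite /E /tangent_frame; case: xgetP => [E' _ //|_].
  rewrite big1 ?ltxx // => i _; rewrite mxE z0 //; apply/rowP => j; by rewrite !mxE.
split=> //; apply: eq_bigr => i _; rewrite mxE -/E.
have nE : dotv (unit_normal D xi) (row i E) = 0.
  by rewrite dotvC /dotv -row_mul En !mxE.
apply: (second_fundamental_form_diag oD bxi Ux hrho nE).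
apply: contrapT => hN; move: t0; rewrite big1 ?ltxx // => j _; rewrite mxE.
rewrite /second_fundamental_form /normal_extension; case: xgetP => [N _ hN'|_].
  by exfalso; apply: hN; exists N.
by rewrite derive_cst dotv0l.
Qed.

(** The mean curvature of the level sets of [rho]: an expression that is continuous
    in the point, whereas frames and normal extensions are chosen pointwise. *)
Definition defining_mean_curvature rho y : R :=
  (\tr (hessian rho y) - dotv (gradient rho y *m hessian rho y) (gradient rho y) /
     enorm (gradient rho y) ^+ 2) / enorm (gradient rho y).

Lemma mean_curvatureE U rho xi : boundary D xi -> U xi -> defining_function D U rho ->
  0 < sigma 1 (principal_curvatures D xi) ->
  sigma 1 (principal_curvatures D xi) = defining_mean_curvature rho xi.
Proof.
move=> bxi Ux hrho s0; have [EE En ->] := mean_curvature_frame bxi Ux hrho s0.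
rewrite -mulr_suml (frame_trace _ EE En (unit_normal_unit oD bxi Ux hrho)); congr ((_ - _) / _).
have a0 : enorm (gradient rho xi) != 0 by rewrite gt_eqF // (gradient_enorm_gt0 hrho).
rewrite (gradient_normal oD bxi Ux hrho) -scalemxAl dotvZl dotvZr.
rewrite -(gradient_normal oD bxi Ux hrho) -mulrA.
by field.
Qed.

Lemma continuous_mean_curvature U rho xi : U xi -> defining_function D U rho ->
  {for xi, continuous (defining_mean_curvature rho)}.
Proof.
move=> Ux hrho; have a0 : enorm (gradient rho xi) != 0 by rewrite gt_eqF // (gradient_enorm_gt0 hrho).
have ce := continuous_gradient_enorm Ux hrho.
apply: continuousM; last exact: continuousV.
apply: continuousB; first by apply: continuous_sum => i; exact: continuous_hessian hrho _ _.
apply: continuousM; last by apply: continuousV; [rewrite expf_neq0|exact: continuousM].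
apply: continuous_dotv => i; last exact: continuous_gradient hrho _.
apply: continuous_mulmx => *; [exact: continuous_gradient hrho _|exact: continuous_hessian hrho _ _].
Qed.

End MeanCurvature.

Section BoundaryCompact.
Variables (R : realType) (n : nat) (D : set 'rV[R]_n.+1).
Hypotheses (hD : smooth_bounded_domain D).

Let oD : open D. Proof. by case: hD. Qed.

Lemma closure_compact : compact (closure D).
Proof.
apply: bounded_closed_compact; last exact: closed_closure.
case: hD => _ _ _ [M [Mr hM]] _; exists (M + 1); split; first by rewrite realD // realn.
move=> x Mx y /= cy; apply/ler_addgt0Pr => e e0.
have [z [ze Dz]] := (closure_eps D y).1 cy e e0.
have hz : `|y + z| <= x by apply: (hM x _ (y + z) Dz); lra.
have := ler_normB (y + z) z; rewrite addrK => h; lra.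
Qed.

Lemma boundary_compact : compact (boundary D).
Proof.
apply: (subclosed_compact _ closure_compact) => [|x []//].
rewrite /boundary setDE; apply: closedI; first exact: closed_closure.
by apply: open_closedC; exact: open_interior.
Qed.

Lemma max_within (K : set 'rV[R]_n.+1) (f : 'rV[R]_n.+1 -> R) : K !=set0 -> compact K ->
  {within K, continuous f} -> exists2 x, K x & forall y, K y -> f y <= f x.
Proof.
move=> K0 cK cf; have [x /set_mem Kx hx] := EVT_max_rV K0 cK cf.
by exists x => // y Ky; apply: hx; exact: mem_set.
Qed.

Lemma min_within (K : set 'rV[R]_n.+1) (f : 'rV[R]_n.+1 -> R) : K !=set0 -> compact K ->
  {within K, continuous f} -> exists2 x, K x & forall y, K y -> f x <= f y.
Proof.
move=> K0 cK cf; have [x /set_mem Kx hx] := EVT_min_rV K0 cK cf.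
by exists x => // y Ky; apply: hx; exact: mem_set.
Qed.

Lemma continuous_sqr_norm (x : 'rV[R]_n.+1) : {for x, continuous (fun y => dotv y y)}.
Proof. by apply: continuous_dotv => i; exact: coord_continuous. Qed.

(** A point of the closure farthest from the origin is not interior. *)
Lemma boundary_nonempty : boundary D !=set0.
Proof.
have [x0 Dx0] : D !=set0 by case: hD.
have [||x cx hx] := @max_within (closure D) (fun y => dotv y y) _ closure_compact.
- by exists x0; exact: subset_closure.
- by apply: continuous_subspaceT => y; exact: continuous_sqr_norm.
exists x; split=> // /nbhs_eps[d d0 hd].
pose v : 'rV[R]_n.+1 := if x == 0 then delta_mx 0 0 else x.
have v0 : v != 0.
  rewrite /v; case: ifPn => // _; apply/eqP => /rowP/(_ 0); rewrite !mxE eqxx /=; lra.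
have vN : 0 < `|v| by rewrite normr_gt0.
pose t := d / `|v| / 2; have t0 : 0 < t by rewrite !divr_gt0.
have : closure D (x + t *: v).
  apply: subset_closure; apply: hd; rewrite normrZ gtr0_norm // /t.
  have -> : d / `|v| / 2 * `|v| = d / 2 by field; rewrite gt_eqF.
  lra.
move=> /hx; rewrite !(dotvDl, dotvDr, dotvZl, dotvZr).
have h1 : 0 <= dotv x v by rewrite /v; case: ifPn => [/eqP ->|_]; rewrite ?dotv0l ?dotvv_ge0.
have h2 : 0 < dotv v v by rewrite dotvv_gt0.
have h3 : 0 < t * (t * dotv v v) by exact: mulr_gt0 t0 (mulr_gt0 t0 h2).
have h4 : 0 <= t * dotv x v by rewrite mulr_ge0 // ltW.
rewrite (dotvC v x); lra.
Qed.

Hypothesis hconv : forall xi, boundary D xi -> 0 < sigma 1 (principal_curvatures D xi).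

Lemma H0_attained : 0 < H0 D /\
  forall xi, boundary D xi -> H0 D <= sigma 1 (principal_curvatures D xi).
Proof.
have sb : smooth_boundary D by case: hD.
pose f y := sigma 1 (principal_curvatures D y).
have cf : {within boundary D, continuous f}.
  apply: eps_within_continuous => x bx e e0; have [U [rho [Ux hrho]]] := sb x bx.
  have [d d0 hd] := continuous_eps (continuous_mean_curvature Ux hrho) e0.
  have oU : open U by case: hrho.
  have [d' d'0 hd'] := open_eps oU Ux.
  exists (Num.min d d') => [|y]; first by rewrite lt_min d0.
  rewrite lt_min => /andP[yd yd'] by_.
  have Uy : U y by have := hd' _ yd'; rewrite addrC subrK.
  have -> : f x = defining_mean_curvature rho x := mean_curvatureE oD bx Ux hrho (hconv bx).
  have -> : f y = defining_mean_curvature rho y := mean_curvatureE oD by_ Uy hrho (hconv by_).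
  by have := hd _ yd; rewrite [x + _]addrC subrK.
have [x bx hx] := min_within boundary_nonempty boundary_compact cf.
have lb : lbound [set sigma 1 (principal_curvatures D xi) | xi in boundary D] (f x).
  by move=> _ [y by_ <-]; exact: hx.
split=> [|y by_].
  apply: lt_le_trans (hconv bx) _; apply: lb_le_inf => //; by exists (f x), x.
by apply: ge_inf; [exists (f x)|exists y].
Qed.

End BoundaryCompact.

(** * Jets, the maximum principle and Hopf's lemma *)

Section Jets.
Variables (R : realType) (n : nat).
Implicit Types (f g : 'rV[R]_n -> R) (x z p : 'rV[R]_n) (H : 'M[R]_n).

Lemma jet2_exact f x p H :
  (forall z, f (x + z) = f x + dotv p z + 2^-1 * dotv (z *m H) z) -> jet2 f x p H.
Proof.
move=> h e e0; exists 1 => // z _; rewrite h.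
have -> : f x + dotv p z + 2^-1 * dotv (z *m H) z - f x - dotv p z
  - 2^-1 * dotv (z *m H) z = 0 by ring.
by rewrite normr0 mulr_ge0 // ltW.
Qed.

Lemma jet2D f g x p q H K : jet2 f x p H -> jet2 g x q K ->
  jet2 (fun y => f y + g y) x (p + q) (H + K).
Proof.
move=> hf hg e e0; have e2 : 0 < e / 2 by rewrite divr_gt0.
have [d d0 hd] := hf _ e2; have [d' d'0 hd'] := hg _ e2.
exists (Num.min d d') => [|z]; first by rewrite lt_min d0.
rewrite lt_min => /andP[/hd h1 /hd' h2].
rewrite mulmxDr !dotvDl.
set s := `|z| ^+ 2 in h1 h2 *; set F := f _ - _ - _ - _ in h1; set G := g _ - _ - _ - _ in h2.
have -> : f (x + z) + g (x + z) - (f x + g x) - (dotv p z + dotv q z) -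
   2^-1 * (dotv (z *m H) z + dotv (z *m K) z) = F + G by rewrite /F /G; ring.
apply: le_trans (ler_normD _ _) _; apply: le_trans (lerD h1 h2) _.
by rewrite -mulrDl -splitr.
Qed.

Lemma jet2Z f x p H c : jet2 f x p H -> jet2 (fun y => c * f y) x (c *: p) (c *: H).
Proof.
move=> hf e e0; have c0 : 0 < `|c| + 1 by rewrite ltr_wpDl.
have e2 : 0 < e / (`|c| + 1) by rewrite divr_gt0.
have [d d0 hd] := hf _ e2; exists d => // z /hd h1.
rewrite -scalemxAr !dotvZl.
set F := f _ - _ - _ - _ in h1.
have -> : c * f (x + z) - c * f x - c * dotv p z - 2^-1 * (c * dotv (z *m H) z) = c * F.
  by rewrite /F; ring.
rewrite normrM; apply: (@le_trans _ _ ((`|c| + 1) * `|F|)); first by rewrite ler_wpM2r // lerDl.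
apply: (@le_trans _ _ ((`|c| + 1) * (e / (`|c| + 1) * `|z| ^+ 2))).
  by rewrite ler_pM2l.
have -> : (`|c| + 1) * (e / (`|c| + 1) * `|z| ^+ 2) = e * `|z| ^+ 2 by field; rewrite gt_eqF.
by [].
Qed.

Lemma jet2_shift f x p H c : jet2 f x p H -> jet2 (fun y => f y - c) x p H.
Proof.
move=> hf e e0; have [d d0 hd] := hf e e0; exists d => // z /hd.
by have -> : f (x + z) - c - (f x - c) = f (x + z) - f x by ring.
Qed.

Lemma jet2_eq f g x p H : (forall y, f y = g y) -> jet2 f x p H -> jet2 g x p H.
Proof. by move=> /funext ->. Qed.

Lemma jet2_local_max f x p H : jet2 f x p H ->
  (exists2 d : R, 0 < d & forall z, `|z| < d -> f (x + z) <= f x) ->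
  forall v, dotv (v *m H) v <= 0.
Proof.
move=> hj [d d0 hd] v; apply/ler_addgt0Pr => e e0; rewrite add0r.
have v0 : 0 < `|v| + 1 by rewrite ltr_wpDl.
pose e1 := e / 2 / (`|v| + 1) ^+ 2; have e10 : 0 < e1 by rewrite !divr_gt0 // exprn_gt0.
have [d' d'0 hd'] := hj e1 e10.
pose t : R := Num.min d d' / (`|v| + 1) / 2; have m0 : 0 < Num.min d d' by rewrite lt_min d0.
have t0 : 0 < t by rewrite !divr_gt0.
have : t * (`|v| + 1) < Num.min d d'.
  rewrite /t; have -> : Num.min d d' / (`|v| + 1) / 2 * (`|v| + 1) = Num.min d d' / 2.
    by field; rewrite gt_eqF.
  lra.
rewrite lt_min => /andP[td td'].
have tv : `|t *: v| <= t * (`|v| + 1) by rewrite normrZ gtr0_norm // ler_pM2l // lerDl.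
have key (s : R) : `|s| = t -> s * dotv p v + 2^-1 * (s ^+ 2 * dotv (v *m H) v) <=
   e / 2 * t ^+ 2.
  move=> st; have st' : `|s| = `|t| by rewrite st gtr0_norm.
  have sv : `|s *: v| = `|t *: v| by rewrite (normrZ s) (normrZ t) st'.
  have := hd (s *: v); rewrite sv => /(_ (le_lt_trans tv td)) hm.
  have := hd' (s *: v); rewrite sv => /(_ (le_lt_trans tv td')).
  rewrite -scalemxAl !(dotvZl, dotvZr) mulrA -expr2 ler_norml => /andP[hj' _].
  have h1 : e1 * `|t *: v| ^+ 2 <= e / 2 * t ^+ 2.
    apply: (@le_trans _ _ (e1 * (t * (`|v| + 1)) ^+ 2)).
      by rewrite ler_pM2l // lerXn2r // nnegrE ?mulr_ge0 // ltW.
    by rewrite exprMn mulrCA mulrC /e1 divfK // expf_neq0 // gt_eqF.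
  lra.
have h1 := key t (gtr0_norm t0); have := key (- t); rewrite normrN => /(_ (gtr0_norm t0)) h2.
have tt : 0 < t ^+ 2 by rewrite exprn_gt0.
rewrite -(ler_pM2l tt); move: h1 h2; rewrite sqrrN; lra.
Qed.

Lemma sqr_dist_expand (x z0 z : 'rV[R]_n) : dotv (x + z - z0) (x + z - z0) =
  dotv (x - z0) (x - z0) + 2 * dotv (x - z0) z + dotv z z.
Proof.
by rewrite !(dotvDl, dotvDr, dotvNl, dotvNr) (dotvC z x) (dotvC z0 x) (dotvC z z0); ring.
Qed.

Lemma jet2_sqr_dist (z0 x : 'rV[R]_n) (c : R) :
  jet2 (fun y => c - dotv (y - z0) (y - z0)) x (-2 *: (x - z0)) (- 2%:M).
Proof.
apply: jet2_exact => z; rewrite sqr_dist_expand mulmxN mul_mx_scalar !(dotvZl, dotvNl); by field.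
Qed.

Lemma jet2_sqr_dist_sqr (z0 x : 'rV[R]_n) (c : R) : let s y := c - dotv (y - z0) (y - z0) in
  jet2 (fun y => s y ^+ 2) x (- (4 * s x) *: (x - z0))
    (8 *: ((x - z0)^T *m (x - z0)) - (4 * s x)%:M).
Proof.
move=> s e e0; set y := x - z0.
pose B := n%:R * (4 * (n%:R * `|y|) + n%:R) : R.
have B0 : 0 <= B by rewrite mulr_ge0 // addr_ge0 // !mulr_ge0.
have B1 : 0 < B + 1 by rewrite ltr_wpDl.
exists (Num.min 1 (e / (B + 1))) => [|z]; first by rewrite lt_min ltr01 divr_gt0.
rewrite lt_min ltr_pdivlMr // => /andP[z1 ze].
have yz : dotv (z *m (y^T *m y)) z = dotv y z ^+ 2.
  by rewrite mulmxA (mx11_scalar (z *m y^T)) mul_scalar_mx dotvZl -/(dotv z y) dotvC expr2.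
rewrite mulmxBr mul_mx_scalar -scalemxAr dotvBl !dotvZl yz /s sqr_dist_expand -/y.
set Y := dotv y y; set P := dotv y z; set Z := dotv z z.
have -> : (c - (Y + 2 * P + Z)) ^+ 2 - (c - Y) ^+ 2 - - (4 * (c - Y)) * P -
  2^-1 * (8 * P ^+ 2 - 4 * (c - Y) * Z) = Z * (4 * P + Z) by field.
have hZ : Z <= n%:R * `|z| ^+ 2 := dotvv_le_norm z.
have hP : `|P| <= n%:R * `|y| * `|z| := dotv_le_norm y z.
have Z0 : 0 <= Z := dotvv_ge0 z.
have zz : `|z| ^+ 2 <= `|z| by rewrite expr2 ler_piMl // ltW.
have hS : `|4 * P + Z| <= (4 * (n%:R * `|y|) + n%:R) * `|z|.
  apply: le_trans (ler_normD _ _) _; rewrite normrM (ger0_norm Z0) (ger0_norm (_ : 0 <= 4)) //.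
  have : n%:R * `|z| ^+ 2 <= n%:R * `|z| by rewrite ler_wpM2l.
  rewrite mulrDl; lra.
rewrite normrM (ger0_norm Z0).
apply: (@le_trans _ _ (n%:R * `|z| ^+ 2 * ((4 * (n%:R * `|y|) + n%:R) * `|z|))).
  by apply: ler_pM.
have -> : n%:R * `|z| ^+ 2 * ((4 * (n%:R * `|y|) + n%:R) * `|z|) = `|z| * B * `|z| ^+ 2.
  by rewrite /B; ring.
rewrite ler_wpM2r ?sqr_ge0 //; apply: le_trans (ltW ze).
by rewrite ler_wpM2l // lerDl.
Qed.

End Jets.

Section MaximumPrinciple.
Variables (R : realType) (n : nat).
Implicit Types (v : 'rV[R]_n.+1 -> R) (x y z p : 'rV[R]_n.+1) (H G : 'M[R]_n.+1).

Lemma continuous_sqr_dist z0 x : {for x, continuous (fun y => dotv (y - z0) (y - z0))}.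
Proof.
apply: continuous_dotv => i;
  (have -> : (fun y => (y - z0) 0 i) = (fun y : 'rV[R]_n.+1 => y 0 i - z0 0 i) by
    apply/funext => y; rewrite !mxE);
  apply: continuousB; [exact: coord_continuous|exact: cst_continuous|
    exact: coord_continuous|exact: cst_continuous].
Qed.

Lemma closed_ball_compact z0 (r : R) : compact [set x | dotv (x - z0) (x - z0) <= r].
Proof.
apply: bounded_closed_compact.
  exists (enorm z0 + Num.sqrt r); split; first exact: num_real.
  move=> M hM x /= hx; apply: le_trans (ltW hM); rewrite -{1}(subrK z0 x) addrC.
  apply: le_trans (ler_normD _ _) _; apply: lerD; first exact: norm_le_enorm.
  apply: le_trans (norm_le_enorm _) _; rewrite /enorm ler_wsqrtr //.
have -> : [set x | dotv (x - z0) (x - z0) <= r] =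
    (fun x : 'rV[R]_n.+1 => dotv (x - z0) (x - z0)) @^-1` [set t | t <= r] by [].
by apply: preimage_closed => [x _|]; [exact: continuous_sqr_dist|exact: closed_le].
Qed.

(** Monotonicity under the semidefinite order, and uniform positivity on rank-one
    matrices for the gradient terms of barriers. *)
Definition elliptic G := (forall H, (forall y, dotv (y *m H) y <= 0) -> mxdot G H <= 0) /\
  exists2 theta : R, 0 < theta & forall x, theta * dotv x x <= mxdot G (x^T *m x).

Variable G : 'M[R]_n.+1.
Hypothesis ellG : elliptic G.

Lemma mxdot_scalar c : mxdot G c%:M = c * \tr G.
Proof.
rewrite /mxdot mulr_sumr; apply: eq_bigr => i _; rewrite (bigD1 i) //= big1 => [|j ji].
  by rewrite mxE eqxx addr0 mulrC.
by rewrite mxE eq_sym (negbTE ji) mulr0.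
Qed.

Lemma elliptic_trace_gt0 : 0 < \tr G.
Proof.
have [h [th th0 hth]] := ellG; pose e : 'rV[R]_n.+1 := delta_mx 0 0.
have : mxdot G (e^T *m e - 1%:M) <= 0.
  apply: h => v; rewrite mulmxBr mulmx1 dotvBl subr_le0.
  rewrite mulmxA dotvE; under eq_bigr do rewrite mxE big_ord1 -mulrA.
  rewrite -mulr_sumr -dotvE -/(dotv v e) (dotvC e v) -expr2.
  apply: le_trans (dotv_cauchy_schwarz v e) _.
  by rewrite (_ : dotv e e = 1) ?mulr1 // /dotv /e trmx_delta mul_delta_mx mxE !eqxx.
rewrite mxdotB mxdot_scalar mul1r subr_le0; apply: lt_le_trans.
apply: lt_le_trans (hth e); rewrite (_ : dotv e e = 1) ?mulr1 //.
by rewrite /dotv /e trmx_delta mul_delta_mx mxE !eqxx.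
Qed.

(** At a positive maximum the Hessian would be nonpositive. *)
Lemma maximum_principle (K : set 'rV[R]_n.+1) v : compact K -> {within K, continuous v} ->
  (forall x, K x -> 0 < v x -> nbhs x K /\ exists p H, jet2 v x p H /\ 0 < mxdot G H) ->
  forall x, K x -> v x <= 0.
Proof.
move=> cK cv h x Kx; rewrite leNgt; apply/negP => vx.
have [|y Ky hy] := max_within _ cK cv; first by exists x.
have vy : 0 < v y by apply: lt_le_trans vx (hy x Kx).
have [/nbhs_eps[d d0 hd] [p [H [hj]]]] := h y Ky vy.
apply/negP; rewrite -leNgt; apply: ellG.1; apply: (jet2_local_max hj).
by exists d => // z /hd; exact: hy.
Qed.

(** Hopf's lemma.  Let [s] be the squared radius minus the squared distance to the
    center.  In a thin shell [0 <= s <= s0] the barrier [s + C s^2] is a strict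
    subsolution for large [C], because the gradient term of [C s^2] wins.  A small
    multiple of it lies below [- v] on both parts of the boundary of the shell,
    hence in the shell. *)
Lemma hopf v z0 (r : R) : 0 < r ->
  {within [set x | dotv (x - z0) (x - z0) <= r ^+ 2], continuous v} ->
  (forall x, dotv (x - z0) (x - z0) < r ^+ 2 ->
     v x < 0 /\ exists p H, jet2 v x p H /\ 0 <= mxdot G H) ->
  (forall x, dotv (x - z0) (x - z0) = r ^+ 2 -> v x <= 0) ->
  exists2 c : R, 0 < c & exists2 t0 : R, 0 < t0 & forall xi t, 0 < t < t0 ->
    dotv (xi - z0) (xi - z0) = r ^+ 2 -> v (xi + t *: (z0 - xi)) <= - (c * t).
Proof.
move=> r0 cv hin hsph; have trG := elliptic_trace_gt0.
have [_ [th th0 hth]] := ellG.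
pose s x := r ^+ 2 - dotv (x - z0) (x - z0).
have r20 : 0 < r ^+ 2 by rewrite exprn_gt0.
(* The first bound keeps the shell away from the center, and the second one the
   contribution [- 4 s \tr G] to [s^2] at most half of the gradient term. *)
pose s0 := Num.min (r ^+ 2 / 2) (th * r ^+ 2 / 2 / \tr G).
have s00 : 0 < s0 by rewrite lt_min !divr_gt0 // mulr_gt0.
have s0r : s0 <= r ^+ 2 / 2 by rewrite ge_min lexx.
have s0G : s0 * \tr G <= th * r ^+ 2 / 2 by rewrite -ler_pdivlMr // ge_min lexx orbT.
pose C := (\tr G + 1) / (th * r ^+ 2).
have C0 : 0 < C by rewrite divr_gt0 ?mulr_gt0 // addr_gt0.
have Ceq : C * (th * r ^+ 2) = \tr G + 1 by rewrite /C divfK // gt_eqF // mulr_gt0.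
pose b x := s x + C * s x ^+ 2.
have cs x : {for x, continuous s}.
  by apply: continuousB; [exact: cst_continuous|exact: continuous_sqr_dist].
have cb x : {for x, continuous b}.
  apply: continuousD; first exact: cs.
  by apply: continuousM; [exact: cst_continuous|apply: continuousM; exact: cs].
have jb x : exists p H, jet2 b x p H /\
    mxdot G H = - (2 * \tr G) + C * (8 * mxdot G ((x - z0)^T *m (x - z0)) - 4 * s x * \tr G).
  have j1 := jet2_sqr_dist z0 x (r ^+ 2).
  have j2 := jet2Z C (jet2_sqr_dist_sqr z0 x (r ^+ 2)).
  do 2?eexists; split; first exact: jet2D j1 j2.
  rewrite mxdotD mxdotZ mxdotB mxdotZ !mxdot_scalar -scaleN1r mxdotZ mxdot_scalar.
  by rewrite mulN1r.
pose K1 := [set x | dotv (x - z0) (x - z0) <= r ^+ 2 - s0].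
have cK1 : compact K1 by exact: closed_ball_compact.
have [||y Ky hy] := max_within _ cK1 (_ : {within K1, continuous v}).
- by exists z0; rewrite /K1 /= subrr dotv0l; lra.
- by apply: continuous_subspaceW cv => x; rewrite /K1 /=; lra.
have vy : v y < 0 by apply: (hin _ _).1; move: Ky; rewrite /K1 /=; lra.
have bs0 : 0 < s0 + C * s0 ^+ 2 by rewrite addr_gt0 // mulr_gt0 // exprn_gt0.
(* On the inner sphere [v <= v y], and the barrier equals [s0 + C s0^2]. *)
pose eps := - v y / (s0 + C * s0 ^+ 2).
have eps0 : 0 < eps by rewrite divr_gt0 // oppr_gt0.
have epsE : eps * (s0 + C * s0 ^+ 2) = - v y by rewrite /eps divfK // gt_eqF.
pose K := [set x | dotv (x - z0) (x - z0) <= r ^+ 2] `&` [set x | r ^+ 2 - s0 <= dotv (x - z0) (x - z0)].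
have cK : compact K.
  apply: compact_closedI; first exact: closed_ball_compact.
  have -> : [set x | r ^+ 2 - s0 <= dotv (x - z0) (x - z0)] =
    (fun x : 'rV[R]_n.+1 => dotv (x - z0) (x - z0)) @^-1` [set t | r ^+ 2 - s0 <= t] by [].
  by apply: preimage_closed => [x _|]; [exact: continuous_sqr_dist|exact: closed_ge].
have below x : K x -> v x + eps * b x <= 0.
  apply: (@maximum_principle K (fun x => v x + eps * b x) cK) => [|{}x [/= Kx1 Kx2] vx].
    move=> {}x; apply: cvgD.
      by have cvK : {within K, continuous v} by [apply: continuous_subspaceW cv => z []]; exact: cvK.
    apply: cvgM; first exact: cvg_cst.
    by have cbK : {within K, continuous b} by [apply: continuous_subspaceT]; exact: cbK.
  have sx0 : 0 <= s x by rewrite /s; lra.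
  have sxs0 : s x <= s0 by rewrite /s; lra.
  have lt1 : dotv (x - z0) (x - z0) < r ^+ 2.
    rewrite lt_neqAle Kx1 andbT; apply/eqP => E; move: vx.
    by rewrite /b /s E subrr expr0n /= mulr0 addr0 mulr0 addr0 ltNge hsph.
  have lt2 : r ^+ 2 - s0 < dotv (x - z0) (x - z0).
    rewrite lt_neqAle Kx2 andbT; apply/eqP => E; move: vx.
    have -> : b x = s0 + C * s0 ^+ 2.
      by rewrite /b; have -> : s x = s0 by rewrite /s -E; ring.
    by rewrite epsE subr_gt0 ltNge hy // /K1 /= -E.
  split.
    apply/nbhs_eps; have e1 : 0 < Num.min (r ^+ 2 - dotv (x - z0) (x - z0))
      (dotv (x - z0) (x - z0) - (r ^+ 2 - s0)) by rewrite lt_min !subr_gt0 lt1.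
    have [d d0 hd] := continuous_eps (continuous_sqr_dist (z0 := z0) (x := x)) e1.
    exists d => // z /hd; rewrite ler_norml le_min => /andP[].
    rewrite lerNl le_min => /andP[_ h1] /andP[h2 _].
    by split=> /=; lra.
  have [_ [p [H [hj hG]]]] := hin x lt1; have [p' [H' [hj' hG']]] := jb x.
  exists (p + eps *: p'), (H + eps *: H'); split; first exact: jet2D hj (jet2Z _ hj').
  rewrite mxdotD mxdotZ hG' ltr_wpDl // mulr_gt0 //.
  have h1 := hth (x - z0); have h2 : th * (r ^+ 2 / 2) <= th * dotv (x - z0) (x - z0).
    by rewrite ler_pM2l //; lra.
  have h3 : s x * \tr G <= th * r ^+ 2 / 2 by apply: le_trans s0G; rewrite ler_pM2r.
  have h4 : C * (2 * (th * r ^+ 2)) <= C * (8 * mxdot G ((x - z0)^T *m (x - z0)) - 4 * s x * \tr G).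
    by rewrite ler_pM2l // -mulrA; lra.
  lra.
exists (eps * r ^+ 2); first by rewrite mulr_gt0.
exists (Num.min 1 (s0 / (2 * r ^+ 2))) => [|xi t /andP[t0]].
  by rewrite lt_min ltr01 divr_gt0 // mulr_gt0.
rewrite lt_min ltr_pdivlMr ?mulr_gt0 // => /andP[t1 ts] hxi.
set x := xi + _; have dx : dotv (x - z0) (x - z0) = (1 - t) ^+ 2 * r ^+ 2.
  have -> : x - z0 = (1 - t) *: (xi - z0).
    by rewrite /x; apply/rowP => i; rewrite !mxE; ring.
  by rewrite dotvZl dotvZr hxi; ring.
have sx : s x = t * (2 - t) * r ^+ 2 by rewrite /s dx; ring.
have tr0 : 0 < t * r ^+ 2 by rewrite mulr_gt0.
have h1 : t * r ^+ 2 * t <= t * r ^+ 2 * 1 by rewrite ler_pM2l // ltW.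
have h2 : 0 < t * r ^+ 2 * t by rewrite mulr_gt0.
have sx1 : t * r ^+ 2 <= s x by rewrite sx; lra.
have sx2 : s x <= s0 by rewrite sx; lra.
have : K x by split=> /=; move: sx1 sx2; rewrite /s; lra.
move=> /below h; have h3 : t * r ^+ 2 <= b x.
  by rewrite /b; apply: le_trans sx1 _; rewrite lerDl mulr_ge0 ?sqr_ge0 // ltW.
have : eps * (t * r ^+ 2) <= eps * b x by rewrite ler_pM2l.
lra.
Qed.

End MaximumPrinciple.

(** * Comparison in the exterior domain *)

Section CompactTools.
Variables (R : realType) (n : nat).
Implicit Types (K : set 'rV[R]_n.+1) (f : 'rV[R]_n.+1 -> R).

Lemma zero_set_compact K f : compact K -> {within K, continuous f} ->
  compact (K `&` [set x | f x = 0]).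
Proof.
move=> cK /continuous_closedP cf.
have /closed_subspaceP[V cV VE] := cf [set 0] (@closed_eq _ 0).
have -> : K `&` [set x | f x = 0] = K `&` V by rewrite setIC [K `&` V]setIC VE.
exact: compact_closedI.
Qed.

Lemma line_continuous (x v : 'rV[R]_n.+1) : continuous (fun t : R => x + t *: v).
Proof.
move=> t; apply: cvgD; first exact: cvg_cst.
exact: scalel_continuous.
Qed.

End CompactTools.

Section LinearizedElliptic.
Variable R : realType.

Lemma mxdot_rank1 n (G : 'M[R]_n) x : mxdot G (x^T *m x) = dotv (x *m G) x.
Proof.
rewrite dotv_mulmx; apply: eq_bigr => i _; apply: eq_bigr => j _.
by rewrite mxE big_ord1 mxE; ring.
Qed.

(** Uniform positivity follows from strict ellipticity by compactness of the unit
    sphere and homogeneity. *)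
Lemma linearized_elliptic n k (A : 'M[R]_n.+1) : (1 <= k <= n.+1)%N -> calA k A ->
  elliptic (linearized k A).
Proof.
move=> hk cA; split=> [H|]; first exact: mxdot_nonpos.
pose S := [set x : 'rV[R]_n.+1 | dotv x x <= 1] `&` [set x | dotv x x - 1 = 0].
have cS : compact S.
  apply: zero_set_compact.
    have := @closed_ball_compact R n 0 1; congr compact.
    by apply/funext => x /=; rewrite subr0.
  apply: continuous_subspaceT => x.
  by apply: (@continuousB _ _ _ (fun y => dotv y y) (fun=> 1)); [exact: continuous_sqr_norm|exact: cst_continuous].
pose q (x : 'rV[R]_n.+1) := dotv (x *m linearized k A) x.
have cq : {within S, continuous q}.
  apply: continuous_subspaceT => x.
  apply: (@continuous_dotv 'rV[R]_n.+1 R _ (fun y => y *m linearized k A) (fun y => y)) => i; last exact: coord_continuous.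
  by apply: continuous_mulmx => [j|j l]; [exact: coord_continuous|exact: cst_continuous].
have e1 : dotv (delta_mx 0 0 : 'rV[R]_n.+1) (delta_mx 0 0) = 1.
  by rewrite /dotv trmx_delta mul_delta_mx mxE !eqxx.
have [|y [_ /eqP]] := min_within _ cS cq.
  by exists (delta_mx 0 0); split; rewrite /= e1 ?subrr.
rewrite subr_eq0 => /eqP y1 hy; exists (q y) => [|x].
  rewrite /q -mxdot_rank1; apply: linearized_psd_gt0 => //.
  - by rewrite trmx_mul trmxK.
  - move=> v; rewrite mulmxA (mx11_scalar (v *m y^T)) mul_scalar_mx dotvZl.
    by rewrite -/(dotv v y) dotvC -expr2 sqr_ge0.
  - by rewrite mxtrace_mulC /mxtrace big_ord1 -/(dotv y y) y1.
have [->|x0] := eqVneq x 0.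
  by rewrite dotv0l mulr0 mxdot_rank1 mul0mx dotv0l.
have ex : enorm x != 0 by rewrite enorm_eq0.
rewrite mxdot_rank1 -sqr_enorm -ler_pdivlMr ?exprn_gt0 ?enorm_gt0 //.
have := hy ((enorm x)^-1 *: x); rewrite /q -scalemxAl dotvZl dotvZr.
have -> : dotv (x *m linearized k A) x / enorm x ^+ 2 =
  (enorm x)^-1 * ((enorm x)^-1 * dotv (x *m linearized k A) x) by field.
apply; have := unit_normalization x0 => u1.
by split; rewrite /= u1 ?subrr.
Qed.

End LinearizedElliptic.

Section ExteriorDomain.
Variables (R : realType) (n : nat) (D : set 'rV[R]_n.+1).
Hypothesis hD : smooth_bounded_domain D.
Implicit Types (x y z xi : 'rV[R]_n.+1) (f v h : 'rV[R]_n.+1 -> R).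

Let oD : open D. Proof. by case: hD. Qed.
Let sbD : smooth_boundary D. Proof. by case: hD. Qed.
Let oE : open (exterior D) := exterior_open (D := D).

Lemma closure_exteriorP x : closure (exterior D) x -> exterior D x \/ boundary D x.
Proof.
move=> cx; have [cDx|] := pselect (closure D x); last by left.
right; split=> // /cx[y [ey Dy]]; apply: ey; exact: subset_closure.
Qed.

Lemma unit_normal_norm xi : boundary D xi -> dotv (unit_normal D xi) (unit_normal D xi) = 1.
Proof.
by move=> bx; have [U [rho [Ux hrho]]] := sbD bx; exact: (unit_normal_unit oD bx Ux hrho).
Qed.

Lemma normal_exterior xi : boundary D xi -> exists2 d : R, 0 < d &
  forall t, 0 < t < d -> exterior D (xi + t *: unit_normal D xi).
Proof.
move=> bx; have [U [rho [Ux hrho]]] := sbD bx.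
have r0 := defining_boundary oD hrho bx Ux.
have [|d d0 hd] := @defining_direction _ _ _ _ _ hrho xi (unit_normal D xi) Ux r0.
  rewrite (gradient_normal oD bx Ux hrho) dotvZl unit_normal_norm // mulr1.
  exact: gradient_enorm_gt0 hrho _ Ux.
by exists d => // t /hd[Ut rt]; exact: defining_pos hrho _ Ut rt.
Qed.

Lemma boundary_closure_exterior xi : boundary D xi -> closure (exterior D) xi.
Proof.
move=> bx; apply/closure_eps => d d0; have [d' d'0 hd'] := normal_exterior bx.
set v := unit_normal D xi in hd'; have v1 : 0 < `|v| + 1 by rewrite ltr_wpDl.
pose t : R := Num.min d' (d / (`|v| + 1)) / 2.
have m0 : 0 < Num.min d' (d / (`|v| + 1)) by rewrite lt_min d'0 divr_gt0.
have t0 : 0 < t by rewrite divr_gt0.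
have : t < Num.min d' (d / (`|v| + 1)) by rewrite /t; lra.
rewrite lt_min ltr_pdivlMr // => /andP[td' td]; exists (t *: v); split.
  by rewrite normrZ gtr0_norm //; apply: le_lt_trans td; rewrite ler_pM2l // lerDl.
by apply: hd'; rewrite t0.
Qed.

Section Comparison.
Variable G : 'M[R]_n.+1.
Hypothesis ellG : elliptic G.

(** Adding a small multiple of [|x|^2] makes a subsolution strict; on a large
    ball the maximum principle then applies. *)
Lemma exterior_comparison v : {within closure (exterior D), continuous v} ->
  (forall x, exterior D x -> exists p H, jet2 v x p H /\ 0 <= mxdot G H) ->
  (forall x, boundary D x -> v x <= 0) ->
  (forall e : R, 0 < e -> exists r : R, forall x, r < enorm x -> exterior D x -> v x <= e) ->
  forall x, exterior D x -> v x <= 0.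
Proof.
move=> cv hj hb hinf x1 ex1; rewrite leNgt; apply/negP => vx1.
pose e := v x1 / 2; have e0 : 0 < e by rewrite divr_gt0.
have [r hr] := hinf e e0.
pose r1 := Num.max (Num.max r (enorm x1)) 0 + 1.
have r1r : r < r1 by rewrite /r1 ltr_pwDr // !le_max lexx.
have r1x : enorm x1 < r1 by rewrite /r1 ltr_pwDr // !le_max lexx orbT.
have r10 : 0 < r1 by rewrite /r1 ltr_pwDr // le_max lexx orbT.
have r12 : 0 < r1 ^+ 2 by rewrite exprn_gt0.
pose del := e / (2 * r1 ^+ 2); have del0 : 0 < del by rewrite divr_gt0 // mulr_gt0.
have delE : del * r1 ^+ 2 = e / 2 by rewrite /del; field; rewrite gt_eqF.
pose vd x := v x + ((-1) * e + (- del) * (r1 ^+ 2 - dotv (x - 0) (x - 0))).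
pose K := [set x : 'rV[R]_n.+1 | dotv (x - 0) (x - 0) <= r1 ^+ 2] `&` closure (exterior D).
have cK : compact K.
  by apply: compact_closedI; [exact: closed_ball_compact|exact: closed_closure].
have x1r : dotv x1 x1 < r1 ^+ 2 by rewrite -sqr_enorm ltr_pXn2r // nnegrE ?enorm_ge0 // ltW.
have cvd : {within K, continuous vd}.
  move=> x; apply: cvgD.
    have cvK : {within K, continuous v} by [apply: continuous_subspaceW cv => z []]; exact: cvK.
  apply: cvgD; first exact: cvg_cst.
  apply: cvgM; first exact: cvg_cst.
  apply: cvgB; first exact: cvg_cst.
  have cs : {within K, continuous (fun y : 'rV[R]_n.+1 => dotv (y - 0) (y - 0))}.
    by apply: continuous_subspaceT => z; exact: continuous_sqr_dist.
  exact: cs.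
have : vd x1 <= 0.
  apply: (maximum_principle ellG cK cvd) => [x [/= Kx cx] vx|]; last first.
    split; first by rewrite /= subr0 ltW.
    exact: subset_closure.
  have s0 : 0 <= del * (r1 ^+ 2 - dotv (x - 0) (x - 0)).
    by rewrite mulr_ge0 ?subr_ge0 // ltW.
  have ve : e < v x by move: vx; rewrite /vd; lra.
  have exx : exterior D x.
    have [//|bx] := closure_exteriorP cx; have := hb x bx; lra.
  have lt1 : dotv (x - 0) (x - 0) < r1 ^+ 2.
    rewrite subr0 in Kx *; rewrite ltNge; apply/negP => h.
    have : v x <= e.
      apply: hr => //; apply: lt_le_trans r1r _.
      by rewrite -(@ler_pXn2r _ 2) ?nnegrE ?enorm_ge0 ?(ltW r10) // sqr_enorm.
    lra.
  split.
    apply/nbhs_eps; have [d d0 hd] := open_eps oE exx.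
    have e1 : 0 < r1 ^+ 2 - dotv (x - 0) (x - 0) by rewrite subr_gt0.
    have [d' d'0 hd'] := continuous_eps (continuous_sqr_dist (z0 := 0) (x := x)) e1.
    exists (Num.min d d') => [|z]; first by rewrite lt_min d0.
    rewrite lt_min => /andP[/hd z1 /hd']; rewrite ler_norml => /andP[_ z2].
    split; last exact: subset_closure.
    by rewrite /=; lra.
  have [p [H [j1 hG]]] := hj x exx.
  have j2 : jet2 (fun y => (-1) * e + (- del) * (r1 ^+ 2 - dotv (y - 0) (y - 0))) x
      (0 + (- del) *: (-2 *: (x - 0))) (0 + (- del) *: (- 2%:M)).
    apply: jet2D; last by apply: jet2Z; exact: jet2_sqr_dist.
    by apply: jet2_exact => z; rewrite mulmx0 !dotv0l mulr0 !addr0.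
  exists (p + (0 + (- del) *: (-2 *: (x - 0)))), (H + (0 + (- del) *: (- 2%:M))).
  split; first exact: jet2D j1 j2.
  rewrite mxdotD add0r mxdotZ -(scaleN1r 2%:M) mxdotZ mxdot_scalar.
  have := mulr_gt0 del0 (elliptic_trace_gt0 ellG); lra.
have := dotvv_ge0 x1; have : 0 <= del * dotv x1 x1 by rewrite mulr_ge0 ?dotvv_ge0 // ltW.
rewrite /vd subr0 mulrBr !mulNr delE /e; lra.
Qed.

Lemma subsolution_jet v x : C_on 2 (exterior D) v ->
  (forall y, exterior D y -> 0 <= mxdot G (hessian v y)) ->
  exterior D x -> exists p H, jet2 v x p H /\ 0 <= mxdot G H.
Proof.
move=> hv hG ex; exists (gradient v x), (hessian v x); split; last exact: hG.
exact: C2_jet oE hv ex.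
Qed.

(** Grow a ball around [z0] until it first meets the set where the maximum [m] is
    attained.  At the contact point the gradient vanishes, against Hopf's lemma. *)
Lemma touching_ball v (m : R) y0 z0 : C_on 2 (exterior D) v ->
  (forall y, exterior D y -> 0 <= mxdot G (hessian v y)) ->
  (forall y, exterior D y -> v y <= m) -> v z0 < m -> v y0 = m ->
  (forall x, dotv (x - z0) (x - z0) <= dotv (y0 - z0) (y0 - z0) -> exterior D x) -> False.
Proof.
move=> hv hG v0 vz vy ball; pose B := [set x | dotv (x - z0) (x - z0) <= dotv (y0 - z0) (y0 - z0)].
have cvB : {within B, continuous v}.
  apply: continuous_in_subspaceT => x /set_mem /ball ex.
  exact: C_on_continuous hv ex.
have cvm : {within B, continuous (fun x => v x - m)}.
  by move=> x; apply: cvgB; [exact: cvB|exact: cvg_cst].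
have cZ := zero_set_compact (@closed_ball_compact R n z0 (dotv (y0 - z0) (y0 - z0))) cvm.
have cs : {within B `&` [set x | v x - m = 0], continuous (fun x => dotv (x - z0) (x - z0))}.
  by apply: continuous_subspaceT => z; exact: continuous_sqr_dist.
have [|xi [/= Bxi vxi] hxi] := min_within _ cZ cs; first by exists y0; split; rewrite /= ?vy ?subrr.
pose r := enorm (xi - z0); have r2 : r ^+ 2 = dotv (xi - z0) (xi - z0) := sqr_enorm _.
have r0 : 0 < r.
  rewrite enorm_gt0 subr_eq0; apply/eqP => E; move: vz vxi; rewrite E; lra.
have inB x : dotv (x - z0) (x - z0) <= r ^+ 2 -> B x by rewrite r2 /B /= => /le_trans; apply.
have [|||c c0 [t0 t00 hc]] := @hopf _ _ _ ellG (fun x => v x - m) z0 r r0.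
- by apply: continuous_subspaceW cvm => x; exact: inB.
- move=> x xr; have Bx := inB x (ltW xr); split; last first.
    have [p [H [hj hp]]] := subsolution_jet hv hG (ball x Bx).
    by exists p, H; split=> //; exact: jet2_shift.
  rewrite lt_neqAle subr_le0 v0 ?andbT; last exact: ball.
  by apply/eqP => vx; have := hxi x (conj Bx vx); rewrite -r2 leNgt xr.
- by move=> x xr; rewrite subr_le0; apply: v0; apply: ball; apply: inB; rewrite xr.
have exi : exterior D xi by exact: ball.
pose w := z0 - xi; have w0 : 0 < `|w| + 1 by rewrite ltr_wpDl.
pose e := c / 4 / (`|w| + 1); have e0 : 0 < e by rewrite !divr_gt0.
have [d d0 hd] := C1_expansion oE (C_on_le (leqnSn 1) hv) exi e0.
have [d' d'0 hd'] := open_eps oE exi.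
pose mt : R := Num.min t0 (Num.min (d / (`|w| + 1)) (d' / (`|w| + 1))).
have mt0 : 0 < mt by rewrite !lt_min t00 !divr_gt0.
pose t := mt / 2; have tt0 : 0 < t by rewrite divr_gt0.
have : t < mt by rewrite /t; lra.
rewrite !lt_min !ltr_pdivlMr // => /and3P[tt td td'].
have tw : `|t *: w| <= t * (`|w| + 1) by rewrite normrZ gtr0_norm // ler_pM2l // lerDl.
have ew : e * `|t *: w| <= c / 4 * t.
  apply: (@le_trans _ _ (e * (t * (`|w| + 1)))); first by rewrite ler_pM2l.
  by have -> : e * (t * (`|w| + 1)) = c / 4 * t by rewrite /e; field; rewrite gt_eqF.
have := hc xi t; rewrite tt0 tt -/w => /(_ isT (esym r2)) h1.
have Dp := hd _ (le_lt_trans tw td).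
have Dm := hd (- (t *: w)); rewrite normrN in Dm; have {}Dm := Dm (le_lt_trans tw td).
have vm : v (xi - t *: w) <= m by apply: v0; apply: hd'; rewrite normrN; exact: le_lt_trans tw td'.
move: Dp Dm; rewrite dotvNr !ler_norml => /andP[Dp _] /andP[Dm _].
have := mulr_gt0 c0 tt0; lra.
Qed.

End Comparison.

(** Rays from a star center leave the domain transversally, so they do not come
    back. *)
Lemma exterior_ray x0 x : D x0 ->
  (forall y, boundary D y -> 0 < dotv (y - x0) (unit_normal D y)) ->
  exterior D x -> forall t : R, 1 <= t -> exterior D (x0 + t *: (x - x0)).
Proof.
move=> Dx0 star ex t t1 ct; set v := x - x0 in ct.
pose T := `[1, t] `&` (fun s : R => x0 + s *: v) @^-1` closure D.
have cT : compact T.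
  apply: compact_closedI; first exact: segment_compact.
  by apply: preimage_closed => [s _|]; [exact: line_continuous|exact: closed_closure].
have [||s /set_mem[/= s1 cs] hs] := @compact_EVT_min _ _ (fun s : R => s) T _ cT.
- by exists t; split => //=; rewrite in_itv /= t1 lexx.
- by apply: continuous_subspaceT => s.
move: s1; rewrite in_itv /= => /andP[s1 st].
have before r : 1 <= r < s -> ~ closure D (x0 + r *: v).
  move=> /andP[r1 rs] cr; have := hs r; rewrite leNgt rs => h.
  suff : false by []; apply: h; apply/mem_set; split=> //=.
  by rewrite in_itv /= r1 (le_trans (ltW rs)).
have {}s1 : 1 < s.
  rewrite lt_neqAle s1 andbT; apply/eqP => E; apply: ex.
  by move: cs; rewrite /= -E scale1r /v addrC subrK.
have v1 : 0 < `|v| + 1 by rewrite ltr_wpDl.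
set xi := x0 + s *: v in cs.
have bxi : boundary D xi.
  split=> // /nbhs_eps[d d0 hd].
  pose m : R := Num.min (s - 1) (d / (`|v| + 1)).
  have m0 : 0 < m by rewrite lt_min subr_gt0 s1 divr_gt0.
  have : m / 2 < m by lra.
  rewrite lt_min ltr_pdivlMr // => /andP[ms md].
  apply: (before (s - m / 2)); first by apply/andP; split; lra.
  apply: subset_closure; have -> : x0 + (s - m / 2) *: v = xi + (- (m / 2)) *: v.
    by rewrite scalerDl addrA.
  apply: hd; rewrite normrZ normrN gtr0_norm ?divr_gt0 //; apply: le_lt_trans md.
  by rewrite ler_pM2l ?divr_gt0 // lerDl.
have [U [rho [Ux hrho]]] := sbD bxi; have r0 := defining_boundary oD hrho bxi Ux.
have [|d d0 hd] := @defining_direction_neg _ _ _ _ _ hrho xi (- v) Ux r0.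
  rewrite (gradient_normal oD bxi Ux hrho) dotvNr dotvZl oppr_lt0.
  rewrite mulr_gt0 ?(gradient_enorm_gt0 hrho Ux) //.
  have := star xi bxi; rewrite /xi addrAC subrr add0r dotvZl dotvC pmulr_rgt0 //; lra.
pose m : R := Num.min (s - 1) d.
have m0 : 0 < m by rewrite lt_min subr_gt0 s1.
have : m / 2 < m by lra.
rewrite lt_min => /andP[ms md].
have [|Um rm] := hd (m / 2); first by rewrite divr_gt0.
apply: (before (s - m / 2)); first by apply/andP; split; lra.
apply: subset_closure; have -> : x0 + (s - m / 2) *: v = xi + (m / 2) *: (- v).
  by rewrite scalerN -scaleNr /xi scalerDl addrA.
by apply: (defining_neg hrho).
Qed.

End ExteriorDomain.

(** * Strong maximum principle and the exterior potential *)

Section ExteriorPotential.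
Variables (R : realType) (n : nat) (D : set 'rV[R]_n.+1).
Hypothesis hD : smooth_bounded_domain D.
Implicit Types (x y z xi : 'rV[R]_n.+1) (f v h : 'rV[R]_n.+1 -> R).

Let oD : open D. Proof. by case: hD. Qed.
Let sbD : smooth_boundary D. Proof. by case: hD. Qed.
Let oE : open (exterior D) := exterior_open (D := D).

Section StrongMaximum.
Variable G : 'M[R]_n.+1.
Hypothesis ellG : elliptic G.

(** The last point of a ray at which the maximum is attained is touched by a
    ball centered further out on the ray. *)
Lemma strong_maximum v (m : R) x0 : D x0 ->
  (forall y, boundary D y -> 0 < dotv (y - x0) (unit_normal D y)) ->
  C_on 2 (exterior D) v -> (forall y, exterior D y -> 0 <= mxdot G (hessian v y)) ->
  (forall y, exterior D y -> v y <= m) ->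
  (exists r : R, forall x, r < enorm x -> exterior D x -> v x < m) ->
  forall x, exterior D x -> v x < m.
Proof.
move=> Dx0 star hv hG vm [r hr] x ex; rewrite lt_neqAle vm // andbT; apply/eqP => vx.
set w := x - x0; pose y (t : R) := x0 + t *: w.
have ey (t : R) : 1 <= t -> exterior D (y t) by exact: (exterior_ray hD Dx0 star ex).
have w0 : 0 < `|w|.
  rewrite normr_gt0 subr_eq0; apply/eqP => E; apply: ex; rewrite E; exact: subset_closure.
pose T := [set t : R | 1 <= t /\ v (y t) = m].
have T1 : T 1 by split=> //; rewrite /y scale1r /w addrC subrK.
have hT : has_sup T.
  split; first by exists 1.
  exists ((`|r| + `|x0| + 1) / `|w|) => t [t1 vt]; rewrite ler_pdivlMr // leNgt; apply/negP => tw.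
  suff : v (y t) < m by rewrite vt ltxx.
  apply: hr; last exact: ey.
  apply: lt_le_trans (norm_le_enorm _).
  have := ler_normB (y t) x0; rewrite /y addrAC subrr add0r normrZ ger0_norm; last by lra.
  have := ler_norm r; lra.
pose s := sup T; have s1 : 1 <= s by apply: sup_upper_bound T1.
have vs : v (y s) = m.
  apply/eqP; rewrite eq_le vm /=; last exact: ey.
  rewrite leNgt; apply/negP => vs.
  have e0 : 0 < (m - v (y s)) / 2 by rewrite divr_gt0 // subr_gt0.
  have [d d0 hd] := continuous_eps (C_on_continuous hv (ey s s1)) e0.
  have [t [t1 vt] st] := @sup_adherent _ T _ (divr_gt0 d0 w0) hT.
  have ts : t <= s by apply: sup_upper_bound => //; split.
  have := hd ((t - s) *: w); rewrite normrZ ler0_norm ?subr_le0 // -ltr_pdivlMr //.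
  have -> : y s + (t - s) *: w = y t by rewrite /y -addrA -scalerDl [s + _]addrC subrK.
  rewrite vt => /(_ _); rewrite ger0_norm ?subr_ge0 ?vm //; last exact: ey.
  have -> : - (t - s) < d / `|w| by rewrite -/s in st; lra.
  by move=> /(_ isT); lra.
have ew : 0 < enorm w by rewrite enorm_gt0 -normr_gt0.
have [d d0 hd] := open_eps oE (ey s s1).
pose del := d / (4 * enorm w); have del0 : 0 < del by rewrite divr_gt0 // mulr_gt0.
have delE : del * enorm w = d / 4 by rewrite /del; field; rewrite gt_eqF.
have ds : y s - y (s + del) = (- del) *: w by rewrite /y; apply/rowP => i; rewrite !mxE; ring.
apply: (touching_ball ellG hv hG vm (z0 := y (s + del)) _ vs).
  rewrite lt_neqAle vm ?andbT; last by apply: ey; lra.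
  apply/eqP => vd; have : s + del <= s.
    by apply: sup_upper_bound => //; split=> //; lra.
  lra.
move=> z hz; have -> : z = y s + (z - y s) by rewrite addrC subrK.
apply: hd; have -> : z - y s = (z - y (s + del)) - (y s - y (s + del)) by rewrite opprB addrA subrK.
apply: le_lt_trans (ler_normB _ _) _.
have h1 : enorm (y s - y (s + del)) = d / 4.
  by rewrite ds enormZ normrN gtr0_norm.
have h2 : enorm (z - y (s + del)) <= d / 4.
  by rewrite -h1 /enorm ler_wsqrtr.
have := norm_le_enorm (y s - y (s + del)); have := norm_le_enorm (z - y (s + del)); lra.
Qed.

End StrongMaximum.

(** On a ball of radius [r] tangent from outside, [|z|^2 <= 2 r (z . nu)].  For small
    [r] the linear term of a defining function thus dominates the quadratic one. *)
Lemma exterior_ball xi : boundary D xi -> exists2 r : R, 0 < r & forall x,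
  dotv (x - (xi + r *: unit_normal D xi)) (x - (xi + r *: unit_normal D xi)) <= r ^+ 2 ->
  x != xi -> exterior D x.
Proof.
move=> bx; have [U [rho [Ux hrho]]] := sbD bx; set nu := unit_normal D xi.
have r0 := defining_boundary oD hrho bx Ux.
have nn : dotv nu nu = 1 := unit_normal_norm hD bx.
have [d d0 hd] := defining_jet oD bx Ux hrho ltr01.
have [d' d'0 hd'] := defining_regular Ux hrho.
have a0 := gradient_enorm_gt0 hrho Ux; set a := enorm _ in hd a0; set H := hessian _ _ in hd.
have [K K0 hK] := mulmx_norm_bound H.
pose r : R := Num.min (d / 4) (Num.min (d' / 4) (a / (2 * (K + 2)))).
have rr0 : 0 < r by rewrite !lt_min !divr_gt0 // mulr_gt0 // addr_gt0.
have rd : r <= d / 4 by rewrite ge_min lexx.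
have rd' : r <= d' / 4 by rewrite !ge_min lexx orbT.
have ra : r * (2 * (K + 2)) <= a.
  by rewrite -ler_pdivlMr ?mulr_gt0 ?addr_gt0 // !ge_min lexx !orbT.
exists r => // x; suff main z : z != 0 -> dotv (z - r *: nu) (z - r *: nu) <= r ^+ 2 ->
    exterior D (xi + z).
  move=> hx xne; rewrite -(subrK xi x) addrC; apply: main; first by rewrite subr_eq0.
  by rewrite -addrA -opprD.
move=> z0; rewrite !(dotvBl, dotvBr, dotvZl, dotvZr) nn (dotvC nu z).
set q := dotv z nu; set Z := dotv z z => hz.
have Z0 : 0 < Z by rewrite dotvv_gt0.
have hq : Z <= 2 * r * q by move: hz; rewrite expr2; lra.
have r20 : 0 < 2 * r by rewrite mulr_gt0.
have q0 : 0 < q by have := lt_le_trans Z0 hq; rewrite (pmulr_rgt0 _ r20).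
have qZ : q ^+ 2 <= Z by have := dotv_cauchy_schwarz z nu; rewrite nn mulr1.
have q2 : q <= 2 * r by rewrite -(ler_pM2r q0) -expr2; exact: le_trans hq.
have zZ : `|z| ^+ 2 <= Z := sqr_norm_le z.
have z2r : `|z| <= 2 * r.
  rewrite -(@ler_pXn2r _ 2) ?nnegrE ?mulr_ge0 ?(ltW rr0) //.
  apply: le_trans zZ _; apply: le_trans hq _; rewrite expr2 ler_pM2l ?mulr_gt0 //.
have := hd z; have := hd' z; rewrite r0 subr0.
move=> h1 h2; apply: h1; first by lra.
have {}h2 := h2 (_ : `|z| < d); move: (h2); rewrite ler_norml => h3.
have /h3/andP[h4 _] : `|z| < d by lra.
move: h4; rewrite mul1r dotvZl (dotvC nu z) -/q => h4.
have h5 := hK z z; have h6 : `|dotv (z *m H) z| <= K * Z.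
  by apply: le_trans h5 _; rewrite -mulrA -expr2 ler_pM2l.
have h7 : (K + 2) * Z <= a * q.
  apply: (@le_trans _ _ ((K + 2) * (2 * r * q))); first by rewrite ler_pM2l // addr_gt0.
  have -> : (K + 2) * (2 * r * q) = r * (2 * (K + 2)) * q by ring.
  by rewrite ler_pM2r.
move: h6; rewrite ler_norml => /andP[h6 _].
have KZ : 0 < K * Z by rewrite mulr_gt0.
lra.
Qed.

(** The continuous extensions of gradient and Hessian that [C_upto] provides. *)
Definition boundary_jet f (P : 'rV[R]_n.+1 -> 'rV[R]_n.+1) (H : 'rV[R]_n.+1 -> 'M[R]_n.+1) :=
  [/\ forall i, {within closure (exterior D), continuous (fun y => P y 0 i)},
      forall i j, {within closure (exterior D), continuous (fun y => H y i j)},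
      forall x, exterior D x -> P x = gradient f x &
      forall x, exterior D x -> H x = hessian f x].

Lemma boundary_jet_exists f : C_upto 2 (exterior D) f -> exists P H, boundary_jet f P H.
Proof.
move=> [_ _ h].
have /choice[p hp] : forall i : 'I_n.+1, exists g : 'rV[R]_n.+1 -> R,
    {within closure (exterior D), continuous g} /\
    forall x, exterior D x -> g x = partial [:: i] f x by move=> i; exact: (h [:: i]).
have /choice[q hq] : forall ij : 'I_n.+1 * 'I_n.+1, exists g : 'rV[R]_n.+1 -> R,
    {within closure (exterior D), continuous g} /\
    forall x, exterior D x -> g x = partial [:: ij.1; ij.2] f x.
  by move=> ij; exact: (h [:: ij.1; ij.2]).
exists (fun y => \row_i p i y), (fun y => \matrix_(i, j) q (i, j) y); split=> [i|i j|x ex|x ex].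
- have -> : (fun y => (\row_i p i y) 0 i) = p i by apply/funext => y; rewrite mxE.
  by case: (hp i).
- have -> : (fun y => (\matrix_(i, j) q (i, j) y) i j) = q (i, j) by apply/funext => y; rewrite mxE.
  by case: (hq (i, j)).
- by apply/rowP => i; rewrite !mxE; case: (hp i) => _ ->.
- by apply/matrixP => i j; rewrite !mxE; case: (hq (i, j)) => _ ->.
Qed.

Section BoundaryJet.
Variables (f : 'rV[R]_n.+1 -> R) (P : 'rV[R]_n.+1 -> 'rV[R]_n.+1)
  (H : 'rV[R]_n.+1 -> 'M[R]_n.+1) (xi : 'rV[R]_n.+1).
Hypotheses (hf : C_upto 2 (exterior D) f) (hPH : boundary_jet f P H) (bxi : boundary D xi).

Lemma boundary_gradient_limit : gradient_limit (exterior D) f xi (P xi).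
Proof.
move=> v e e0; case: hPH => cP _ hP _.
have cv : {within closure (exterior D), continuous (fun y => dotv (P y) v)}.
  by move=> y; apply: continuous_dotv => i; [exact: cP|exact: cst_continuous].
have [d d0 hd] := within_continuous_eps cv (boundary_closure_exterior hD bxi) e0.
exists d => // z zd ez; rewrite -hP //; apply: hd; last exact: subset_closure.
by rewrite addrAC subrr add0r.
Qed.

Lemma boundary_hessian_limit : hessian_limit (exterior D) f xi (H xi).
Proof.
move=> v e e0; case: hPH => _ cH _ hH.
have cv : {within closure (exterior D), continuous (fun y => dotv (v *m H y) v)}.
  move=> y; apply: (@continuous_dotv (subspace (closure (exterior D))) R _ (fun y => v *m H y) (fun=> v)) => i; last exact: cst_continuous.
  by apply: continuous_mulmx => [j|j l]; [exact: cst_continuous|exact: cH].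
have [d d0 hd] := within_continuous_eps cv (boundary_closure_exterior hD bxi) e0.
exists d => // z zd ez; rewrite -hH //; apply: hd; last exact: subset_closure.
by rewrite addrAC subrr add0r.
Qed.

Lemma boundary_limit_along : limit_along (exterior D) f xi.
Proof.
move=> e e0; case: hf => cf _ _.
have [d d0 hd] := within_continuous_eps cf (boundary_closure_exterior hD bxi) e0.
exists d => // z zd ez; apply: hd; last exact: subset_closure.
by rewrite addrAC subrr add0r.
Qed.

Lemma normal_difference (e : R) : 0 < e -> exists2 d : R, 0 < d & forall t, 0 < t < d ->
  `|f (xi + t *: unit_normal D xi) - f xi - t * dotv (P xi) (unit_normal D xi)| <= t * e.
Proof.
move=> e0; set nu := unit_normal D xi; have [d d0 hd] := boundary_gradient_limit nu e0.
have [d' d'0 hd'] := normal_exterior hD bxi.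
have v1 : 0 < `|nu| + 1 by rewrite ltr_wpDl.
exists (Num.min d' (d / (`|nu| + 1))) => [|t /andP[t0]]; first by rewrite lt_min d'0 divr_gt0.
rewrite lt_min ltr_pdivlMr // => /andP[td' td].
have C2 : C_on 2 (exterior D) f by case: hf.
apply: (normal_increment oE C2 boundary_limit_along t0) => r /andP[r0 rt].
have er : exterior D (xi + r *: nu) by apply: hd'; rewrite r0 (le_lt_trans rt).
split=> //; apply: hd => //; rewrite normrZ gtr0_norm //; apply: le_lt_trans td.
apply: (@le_trans _ _ (t * `|nu|)); first by rewrite ler_wpM2r.
by rewrite ler_pM2l // lerDl.
Qed.

Lemma normal_derivativeE : normal_derivative D f xi = dotv (P xi) (unit_normal D xi).
Proof.
apply: cvg_lim => //; apply/cvgrPdist_le => e e0.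
have [d d0 hd] := normal_difference e0.
near=> t; have t0 : 0 < t by near: t; exact: nbhs_right_gt.
have td : t < d by near: t; exact: nbhs_right_lt.
have := hd t; rewrite t0 td => /(_ isT); set F := f _ - f _; set m := dotv _ _ => h.
have -> : m - t^-1 * F = - (t^-1 * (F - t * m)) by field; rewrite gt_eqF.
by rewrite normrN normrM gtr0_norm ?invr_gt0 // ler_pdivrMl.
Unshelve. all: by end_near.
Qed.

End BoundaryJet.

Lemma unit_normal_continuous i : {within boundary D, continuous (fun y => unit_normal D y 0 i)}.
Proof.
apply: eps_within_continuous => x bx e e0; have [U [rho [Ux hrho]]] := sbD bx.
pose g y := (enorm (gradient rho y))^-1 * gradient rho y 0 i.
have cg : {for x, continuous g}.
  apply: continuousM; last exact: continuous_gradient hrho _.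
  apply: continuousV; last exact: continuous_gradient_enorm hrho.
  by rewrite gt_eqF // (gradient_enorm_gt0 hrho).
have [d d0 hd] := continuous_eps cg e0.
have oU : open U by case: hrho.
have [d' d'0 hd'] := open_eps oU Ux.
exists (Num.min d d') => [|y]; first by rewrite lt_min d0.
rewrite lt_min => /andP[yd yd'] by_.
have Uy : U y by have := hd' _ yd'; rewrite addrC subrK.
have -> : unit_normal D x 0 i = g x by rewrite (unit_normalE oD bx Ux hrho) mxE.
have -> : unit_normal D y 0 i = g y by rewrite (unit_normalE oD by_ Uy hrho) mxE.
by have := hd _ yd; rewrite [x + _]addrC subrK.
Qed.

Lemma at_infinity_eps f (l : R) : f @ at_infinity --> l -> forall e : R, 0 < e ->
  exists r : R, forall x, r < enorm x -> `|f x - l| <= e.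
Proof.
move=> /cvgrPdist_le h e /h[r _ hr]; exists r => x /hr; by rewrite distrC.
Qed.

Section Potential.
Variables (k : nat) (A : 'M[R]_n.+1) (h : 'rV[R]_n.+1 -> R).
Hypotheses (hk : (1 <= k <= n.+1)%N) (cA : calA k A) (star : strictly_star_shaped D).
Hypothesis hh : exterior_potential k D A h.

Let ellG : elliptic (linearized k A) := linearized_elliptic hk cA.

Let C2h : C_on 2 (exterior D) h.
Proof. by case: hh => sh _ _ _; case: (sh 2%N). Qed.

Let Lh y : exterior D y -> mxdot (linearized k A) (hessian h y) = 0.
Proof. by case: hh => _ h0 _ _; exact: h0. Qed.

Let Lh_ge0 y : exterior D y -> 0 <= mxdot (linearized k A) (hessian h y).
Proof. by move=> /Lh ->. Qed.

Lemma potential_le1 x : exterior D x -> h x <= 1.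
Proof.
move=> ex; rewrite -subr_le0; apply: (exterior_comparison ellG (v := fun y => h y - 1) _ _ _ _ ex) => [|y ey|y by_|e e0].
- case: hh => sh _ _ _; case: (sh 2%N) => ch _ _ y.
  by apply: cvgB; [exact: ch|exact: cvg_cst].
- have [p [H [hj hp]]] := subsolution_jet C2h Lh_ge0 ey.
  by exists p, H; split=> //; exact: jet2_shift.
- by case: hh => _ _ hb _; rewrite hb // subrr.
case: hh => _ _ _ /at_infinity_eps/(_ _ ltr01)[r hr]; exists r => y /hr.
rewrite subr0 ler_norml; lra.
Qed.

Lemma potential_lt1 x : exterior D x -> h x < 1.
Proof.
have [x0 [Dx0 star0]] := star.
apply: (strong_maximum ellG Dx0 star0 C2h Lh_ge0 potential_le1).
have half : (0 : R) < 1 / 2 by lra.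
case: hh => _ _ _ /at_infinity_eps/(_ _ half)[r hr]; exists r => y /hr.
rewrite subr0 ler_norml; lra.
Qed.

Variables (P : 'rV[R]_n.+1 -> 'rV[R]_n.+1) (H : 'rV[R]_n.+1 -> 'M[R]_n.+1).
Hypothesis hPH : boundary_jet h P H.

(** Hopf's lemma in a ball touching the boundary, inside which [h < 1]. *)
Lemma potential_normal_lt0 xi : boundary D xi -> dotv (P xi) (unit_normal D xi) < 0.
Proof.
move=> bxi; set nu := unit_normal D xi; have [r r0 hr] := exterior_ball bxi.
set z0 := xi + r *: nu in hr.
have hC : C_upto 2 (exterior D) h by case: hh => sh _ _ _.
have xz : xi - z0 = (- r) *: nu by rewrite /z0 opprD addrA subrr sub0r scaleNr.
have xiS : dotv (xi - z0) (xi - z0) = r ^+ 2.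
  by rewrite xz dotvZl dotvZr (unit_normal_norm hD bxi); ring.
have hxi : h xi = 1 by case: hh => _ _ hb _; exact: hb.
have inE x : dotv (x - z0) (x - z0) <= r ^+ 2 -> closure (exterior D) x.
  move=> hx; have [->|ne] := eqVneq x xi; first exact: boundary_closure_exterior hD _ bxi.
  by apply: subset_closure; exact: hr.
have [|||c c0 [t0 t00 hc]] := @hopf _ _ _ ellG (fun x => h x - 1) z0 r r0.
- apply: (continuous_subspaceW inE) => x; apply: cvgB; last exact: cvg_cst.
  by case: hC => ch _ _; exact: ch.
- move=> x xr; have ex : exterior D x.
    by apply: hr; rewrite ?(ltW xr) //; apply/eqP => E; move: xr; rewrite E xiS ltxx.
  split; first by rewrite subr_lt0 potential_lt1.
  have [p [H' [hj hp]]] := subsolution_jet C2h Lh_ge0 ex.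
  by exists p, H'; split=> //; exact: jet2_shift.
- move=> x xr; rewrite subr_le0; have [->|ne] := eqVneq x xi; first by rewrite hxi.
  by apply: potential_le1; apply: hr; rewrite ?xr.
have e0 : 0 < c / (2 * r) by rewrite divr_gt0 // mulr_gt0.
have [d d0 hd] := normal_difference hC hPH bxi e0.
pose m : R := Num.min t0 (d / r); have m0 : 0 < m by rewrite lt_min t00 divr_gt0.
pose t := m / 2; have tt0 : 0 < t by rewrite divr_gt0.
have : t < m by rewrite /t; lra.
rewrite lt_min ltr_pdivlMr // => /andP[tt td].
have := hc xi t; rewrite tt0 tt => /(_ isT xiS).
have -> : t *: (z0 - xi) = (t * r) *: nu by rewrite -opprB xz scaleNr opprK scalerA.
move=> h1; have tr0 : 0 < t * r by rewrite mulr_gt0.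
have := hd (t * r); rewrite tr0 td hxi => /(_ isT) h2.
have h3 : t * r * (c / (2 * r)) = t * c / 2 by field; rewrite gt_eqF.
move: h2; rewrite h3 ler_norml => /andP[h2 _].
have tc : 0 < t * c by rewrite mulr_gt0.
by rewrite -(pmulr_rlt0 _ tr0); rewrite -/nu in h1 h2; lra.
Qed.

(** The normal derivative is continuous on the compact boundary, so that the infimum
    is a minimum. *)
Lemma gamma_attained : 0 < gamma D h /\
  forall xi, boundary D xi -> gamma D h <= - dotv (P xi) (unit_normal D xi).
Proof.
have hC : C_upto 2 (exterior D) h by case: hh => sh _ _ _.
pose f y := - dotv (P y) (unit_normal D y).
have cf : {within boundary D, continuous f}.
  move=> y; apply: cvgN; apply: (@continuous_dotv (subspace (boundary D)) R _ P (unit_normal D)) => i.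
    case: hPH => cP _ _ _; apply: (continuous_subspaceW _ (cP i)) => z.
    exact: boundary_closure_exterior.
  exact: unit_normal_continuous.
have [x bx hx] := min_within (boundary_nonempty hD) (boundary_compact hD) cf.
have fE y : boundary D y -> - normal_derivative D h y = f y.
  by move=> by_; rewrite (normal_derivativeE hC hPH by_).
have lb : lbound [set - normal_derivative D h xi | xi in boundary D] (f x).
  by move=> _ [y by_ <-]; rewrite (fE y by_); exact: hx.
split=> [|y by_].
  apply: (@lt_le_trans _ _ (f x)); first by rewrite oppr_gt0 potential_normal_lt0.
  by apply: lb_le_inf => //; exists (f x), x => //; exact: fE.
by rewrite -[leRHS]/(f y) -(fE y by_); apply: ge_inf; [exists (f x)|exists y].
Qed.

End Potential.

End ExteriorPotential.

(** * Nonexistence *)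

Section Quadratic.
Variables (R : realType) (n : nat) (A : 'M[R]_n.+1) (b : 'rV[R]_n.+1).
Implicit Types (x z : 'rV[R]_n.+1).

Lemma quadratic_expansion c x z : A^T = A -> quadratic A b c (x + z) =
  quadratic A b c x + dotv (x *m A + b) z + 2^-1 * dotv (z *m A) z.
Proof.
move=> sA; rewrite /quadratic mulmxDl !(dotvDl, dotvDr).
have -> : dotv (z *m A) x = dotv (x *m A) z by rewrite -dotv_mulmxT sA.
by field.
Qed.

Lemma quadratic_shift c x : quadratic A b c x = quadratic A b 0 x + c.
Proof. by rewrite /quadratic addr0. Qed.

Lemma quadratic_continuous c x : {for x, continuous (quadratic A b c)}.
Proof.
have c1 (i : 'I_n.+1) : {for x, continuous (fun y : 'rV[R]_n.+1 => y 0 i)} by exact: coord_continuous.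
apply: continuousD; last exact: cst_continuous.
apply: continuousD.
  apply: continuousM; first exact: cst_continuous.
  apply: (@continuous_dotv 'rV[R]_n.+1 R _ (fun y => y *m A) (fun y => y)) => // i.
  by apply: continuous_mulmx => // j l; exact: cst_continuous.
by apply: (@continuous_dotv 'rV[R]_n.+1 R _ (fun=> b) (fun y => y)) => // i; exact: cst_continuous.
Qed.

End Quadratic.

Section TangentTrace.
Variables (R : realType) (n : nat) (D : set 'rV[R]_n.+1).
Hypothesis hD : smooth_bounded_domain D.

Lemma tr_tangent_le_A_plus A xi : boundary D xi -> tr_tangent D xi A <= A_plus D A.
Proof.
move=> bxi; rewrite /A_plus le_max; apply/orP; right; apply: sup_upper_bound; last by exists xi.
split; first by exists (tr_tangent D xi A), xi.
have [K K0 hK] := mulmx_norm_bound A; exists (\tr A + K) => _ [y by_ <-].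
have := hK (unit_normal D y) (unit_normal D y); rewrite -mulrA -expr2 ler_norml => /andP[h1 _].
have : K * `|unit_normal D y| ^+ 2 <= K.
  by rewrite ger_pMr // -(unit_normal_norm hD by_); exact: sqr_norm_le.
rewrite /tr_tangent; lra.
Qed.

(** [Gamma2_trace_bound] holds in the exterior, for the fixed vector [nu], and passes
    to the limit. *)
Lemma boundary_trace_ge0 k u P H xi : (2 <= k <= n.+1)%N -> C_on 2 (exterior D) u ->
  (forall x, exterior D x -> Gamma k (eigenvalues (hessian u x))) ->
  boundary_jet D u P H -> boundary D xi -> 0 <= tr_tangent D xi (H xi).
Proof.
move=> hk hu hG [_ cH _ hH] bxi; set nu := unit_normal D xi.
pose f y := \tr (H y) - dotv (nu *m H y) nu.
have cf : {within closure (exterior D), continuous f}.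
  move=> y; apply: cvgB.
    by apply: (@continuous_sum (subspace (closure (exterior D))) R _ (fun i y => H y i i)) => i; exact: cH.
  apply: (@continuous_dotv (subspace (closure (exterior D))) R _ (fun y => nu *m H y) (fun=> nu)) => i;
    last exact: cst_continuous.
  by apply: continuous_mulmx => [j|j l]; [exact: cst_continuous|exact: cH].
rewrite -[leRHS]/(f xi); apply/ler_addgt0Pr => e e0.
have cxi := boundary_closure_exterior hD bxi.
have [d d0 hd] := within_continuous_eps cf cxi e0.
have [z [zd ez]] := (closure_eps _ _).1 cxi d d0.
have : 0 <= f (xi + z).
  rewrite /f hH // subr_ge0; apply: (Gamma2_trace_bound hk); last exact: unit_normal_norm.
    exact: (hessian_sym (exterior_open (D := D)) hu).
  exact: hG.
have := hd (xi + z); rewrite addrAC subrr add0r => /(_ zd (subset_closure ez)).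
rewrite ler_norml; lra.
Qed.

End TangentTrace.

Section Nonexistence.
Variables (R : realType) (n k : nat) (D : set 'rV[R]_n.+1).
Hypotheses (hk : (2 <= k <= n)%N) (hD : smooth_bounded_domain D).
Hypotheses (hstar : strictly_star_shaped D) (hconv : strictly_convex_boundary k.-1 D).
Variables (A : 'M[R]_n.+1) (b : 'rV[R]_n.+1) (h : 'rV[R]_n.+1 -> R) (c : R) (u : 'rV[R]_n.+1 -> R).
Hypotheses (hA : calA k A) (hh : exterior_potential k D A h).
Hypotheses (hu : C_upto 2 (exterior D) u).
Hypothesis sub : forall x, exterior D x ->
  Gamma k (eigenvalues (hessian u x)) /\ 1 <= sigma k (eigenvalues (hessian u x)).
Hypothesis decay : (fun x => u x - quadratic A b c x) @ at_infinity --> (0 : R).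

Let oD : open D. Proof. by case: hD. Qed.
Let oE : open (exterior D) := exterior_open (D := D).
Let sA : A^T = A. Proof. by case: hA. Qed.
Let hk1 : (1 <= k <= n.+1)%N. Proof. by case/andP: hk => k2 kn; rewrite (ltnW k2) leqW. Qed.
Let hk2 : (2 <= k <= n.+1)%N. Proof. by case/andP: hk => k2 kn; rewrite k2 leqW. Qed.
Let ellG : elliptic (linearized k A) := linearized_elliptic hk1 hA.
Let C2u : C_on 2 (exterior D) u. Proof. by case: hu. Qed.
Let w x := u x - quadratic A b c x.

Lemma excess_continuous : {within closure (exterior D), continuous w}.
Proof.
case: hu => cu _ _ x; apply: cvgB; first exact: cu.
have cq : {within closure (exterior D), continuous (quadratic A b c)}.
  by apply: continuous_subspaceT => y; exact: quadratic_continuous.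
exact: cq.
Qed.

(** Garding's inequality makes the excess over the quadratic a subsolution of the
    linearized equation. *)
Lemma excess_jet x : exterior D x -> exists p H, jet2 w x p H /\ 0 <= mxdot (linearized k A) H.
Proof.
move=> ex; have [gH sH] := sub ex.
have jq : jet2 (quadratic A b c) x (x *m A + b) A.
  by apply: jet2_exact => z; exact: quadratic_expansion.
exists (gradient u x + (-1) *: (x *m A + b)), (hessian u x + (-1) *: A); split.
  apply: (@jet2_eq _ _ (fun y => u y + (-1) * quadratic A b c y)) => [y|].
    by rewrite /w mulN1r.
  exact: jet2D (C2_jet oE C2u ex) (jet2Z (-1) jq).
rewrite scaleN1r; apply: linearized_garding => //.
exact: hessian_sym oE C2u ex.
Qed.

(** Comparison in the exterior domain: [w - M h] is a subsolution, nonpositive on the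
    boundary, and it tends to 0 at infinity. *)
Lemma excess_le_potential (M : R) : 0 < M -> (forall xi, boundary D xi -> w xi <= M) ->
  forall x, exterior D x -> w x <= M * h x.
Proof.
move=> M0 hM x ex; case: (hh) => sh Lh hb hinf.
have C2h : C_on 2 (exterior D) h by case: (sh 2%N).
rewrite -subr_le0; have -> : w x - M * h x = w x + (- M) * h x by ring.
apply: (exterior_comparison ellG (v := fun x => w x + (- M) * h x) _ _ _ _ ex) => [|y ey|y by_|e e0].
- move=> y; apply: cvgD; first exact: excess_continuous.
  apply: cvgM; first exact: cvg_cst.
  by case: (sh 0%N) => ch _ _; exact: ch.
- have [p [H [hj hp]]] := excess_jet ey.
  have jh := C2_jet oE C2h ey.
  do 2?eexists; split; first exact: jet2D hj (jet2Z _ jh).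
  have := Lh y ey; rewrite -[linearized_op _ _ _ _]/(mxdot (linearized k A) (hessian h y)) => L0.
  by rewrite mxdotD mxdotZ L0 mulr0 addr0.
- by rewrite hb // mulr1 subr_le0; exact: hM.
have e1 : 0 < e / 2 by rewrite divr_gt0.
have e2 : 0 < e / (2 * M) by rewrite divr_gt0 // mulr_gt0.
have [r hr] := at_infinity_eps decay e1; have [r' hr'] := at_infinity_eps hinf e2.
exists (Num.max r r') => y; rewrite gt_max => /andP[/hr h1 /hr' h2] _.
move: h1 h2; rewrite !subr0 !ler_norml -/(w y) => /andP[_ h1] /andP[h2 _].
have : M * - (e / (2 * M)) <= M * h y by rewrite ler_pM2l.
have -> : M * - (e / (2 * M)) = - (e / 2) by field; rewrite gt_eqF.
lra.
Qed.

(** At [xi0] the excess [w] equals [M] and lies below [M h], so its normal derivative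
    is at most [- M gamma].  As [w <= M], the second-order comparison applies with
    the quadratic touching [u] at [xi0]; summed over the tangent frame it makes the
    tangential trace of the Hessian of [u] negative, against [boundary_trace_ge0]. *)
Lemma boundary_max_contradiction xi0 : boundary D xi0 ->
  (forall xi, boundary D xi -> w xi <= w xi0) ->
  A_plus D A / (gamma D h * H0 D) < w xi0 -> False.
Proof.
move=> bxi hmax; set M := w xi0.
have [P [H hPH]] := boundary_jet_exists hu.
have hC : C_upto 2 (exterior D) h by case: hh => sh _ _ _.
have [Ph [Hh hPHh]] := boundary_jet_exists hC.
have [g0 hg] := gamma_attained hD hk1 hA hstar hh hPHh.
have hs xi : boundary D xi -> 0 < sigma 1 (principal_curvatures D xi).
  by move=> /hconv; apply; move: hk; lia.
have [H00 hH0] := H0_attained hD hs.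
have gH : 0 < gamma D h * H0 D by rewrite mulr_gt0.
rewrite ltr_pdivrMr // => hM.
have Ap : 0 <= A_plus D A by rewrite /A_plus le_max lexx.
have M0 : 0 < M by rewrite -(pmulr_lgt0 _ gH); exact: le_lt_trans hM.
have wM := excess_le_potential M0 hmax.
have hxi : h xi0 = 1 by case: hh => _ _ hb _; exact: hb.
set nu := unit_normal D xi0; set q := xi0 *m A + b.
have nn : dotv nu nu = 1 := unit_normal_norm hD bxi.
have uE z : u (xi0 + z) = w (xi0 + z) + quadratic A b c xi0 + dotv q z + 2^-1 * dotv (z *m A) z.
  by rewrite /w quadratic_expansion // -/q; ring.
have uxi : u xi0 = M + quadratic A b c xi0 by rewrite /M /w; ring.
have below z : exterior D (xi0 + z) -> u (xi0 + z) <= u xi0 + dotv q z + 2^-1 * dotv (z *m A) z.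
  move=> ez; rewrite uE uxi !lerD2r; apply: le_trans (wM _ ez) _.
  by rewrite ger_pMr //; exact: (potential_le1 hk1 hA hh).
have slope : dotv (P xi0) nu - dotv q nu <= - (M * gamma D h).
  have : M * gamma D h <= M * - dotv (Ph xi0) nu by rewrite ler_pM2l //; exact: hg.
  suff : dotv (P xi0) nu <= dotv q nu + M * dotv (Ph xi0) nu by lra.
  apply/ler_addgt0Pr => e e0.
  pose B := dotv (nu *m A) nu; have B1 : 0 < `|B| + 1 by rewrite ltr_wpDl.
  have M1 : 0 < 1 + M by rewrite addr_gt0.
  have e1 : 0 < e / 2 / (1 + M) by rewrite !divr_gt0.
  have [d1 d10 h1] := normal_difference hD hu hPH bxi e1.
  have [d2 d20 h2] := normal_difference hD hC hPHh bxi e1.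
  have [d3 d30 h3] := normal_exterior hD bxi.
  pose m : R := Num.min (Num.min d1 d2) (Num.min d3 (e / (`|B| + 1))).
  have m0 : 0 < m by rewrite !lt_min d10 d20 d30 divr_gt0.
  pose t := m / 2; have t0 : 0 < t by rewrite divr_gt0.
  have : t < m by rewrite /t; lra.
  rewrite !lt_min ltr_pdivlMr // => /andP[/andP[t1 t2] /andP[t3 t4]].
  have := h1 t; rewrite t0 t1 => /(_ isT); have := h2 t; rewrite t0 t2 => /(_ isT).
  have := h3 t; rewrite t0 t3 => /(_ isT) et; have := wM _ et.
  rewrite hxi -/nu uE uxi -scalemxAl !(dotvZl, dotvZr) -/B !ler_norml => hw /andP[_ k2] /andP[k1 _].
  set ph := dotv (Ph xi0) nu in k2 *; set pu := dotv (P xi0) nu in k1 *; set qn := dotv q nu in k1 *.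
  set hx := h _ in hw k2; set wx := w _ in hw k1.
  have k3 : M * hx <= M * (1 + t * ph + t * (e / 2 / (1 + M))) by rewrite ler_pM2l //; lra.
  have k4 : t * (e / 2 / (1 + M)) + M * (t * (e / 2 / (1 + M))) = t * (e / 2).
    by field; rewrite gt_eqF.
  have k5 : t * B <= t * (`|B| + 1) by rewrite ler_pM2l //; have := ler_norm B; lra.
  have k6 : t * (t * B) <= t * e by rewrite ler_pM2l //; lra.
  rewrite -(ler_pM2l t0); lra.
have sb : smooth_boundary D by case: hD.
have [U [rho [Ux hrho]]] := sb xi0 bxi.
have [EE En sE] := mean_curvature_frame oD bxi Ux hrho (hs _ bxi).
set E := tangent_frame D xi0 in EE En sE; set a := enorm _ in sE.
have a0 : 0 < a := gradient_enorm_gt0 hrho Ux.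
have second i : dotv (row i E *m H xi0) (row i E) - dotv (row i E *m A) (row i E) <=
    dotv (row i E *m hessian rho xi0) (row i E) / a * (dotv (P xi0) nu - dotv q nu).
  have nt : dotv nu (row i E) = 0 by rewrite dotvC /dotv -row_mul En !mxE.
  apply: (boundary_second_order oE nn nt a0 (defining_jet oD bxi Ux hrho)
    (defining_boundary oD hrho bxi Ux) (defining_regular Ux hrho) C2u _ _ _ below).
  - exact: (boundary_limit_along hD hu bxi).
  - exact: (boundary_gradient_limit hD hPH bxi).
  - exact: (boundary_hessian_limit hD hPH bxi).
have sum : tr_tangent D xi0 (H xi0) - tr_tangent D xi0 A <=
    sigma 1 (principal_curvatures D xi0) * (dotv (P xi0) nu - dotv q nu).
  rewrite /tr_tangent -!(frame_trace _ EE En nn) -sumrB sE mulr_suml.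
  by apply: ler_sum => i _; exact: second.
have t1 := boundary_trace_ge0 hD hk2 C2u (fun x ex => (sub ex).1) hPH bxi.
have t2 := tr_tangent_le_A_plus hD A bxi.
have s0 := hs _ bxi; have s1 := hH0 _ bxi; set s := sigma 1 _ in sum s0 s1.
have t3 : s * (dotv (P xi0) nu - dotv q nu) <= s * - (M * gamma D h) by rewrite ler_pM2l.
have t4 : M * gamma D h * H0 D <= M * gamma D h * s by rewrite ler_pM2l // mulr_gt0.
have t5 : s * - (M * gamma D h) = - (M * gamma D h * s) by ring.
have t6 : M * (gamma D h * H0 D) = M * gamma D h * H0 D by ring.
lra.
Qed.

End Nonexistence.

Theorem proposition6p1 (R : realType) (n k : nat)
    (hn : (3 <= n)%N) (hk : (2 <= k <= n.-1)%N)
    (D : set 'rV[R]_n)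
    (hD : smooth_bounded_domain D)
    (hstar : strictly_star_shaped D)
    (hconv : strictly_convex_boundary k.-1 D)
    (phi : 'rV[R]_n -> R) (hphi : smooth_on_boundary D phi)
    (A : 'M[R]_n) (hA : calA k A)
    (b : 'rV[R]_n)
    (h : 'rV[R]_n -> R) (hh : exterior_potential k D A h)
    (c : R) (hc : c < c_lower D phi A b h) :
  ~ exists u : 'rV[R]_n -> R,
    [/\ C_upto 2 (exterior D) u,
        forall x, exterior D x ->
          Gamma k (eigenvalues (hessian u x)) /\
          1 <= sigma k (eigenvalues (hessian u x)),
        forall x, boundary D x -> u x = phi x &
        (fun x => u x - quadratic A b c x) @ at_infinity --> (0 : R)].
Proof.
case: n hn hk D hD hstar hconv phi hphi A hA b h hh hc => // n hn hk D hD hstar hconv phi hphi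
  A hA b h hh hc [u [hu sub bu decay]].
pose w x := u x - quadratic A b c x.
have cw : {within boundary D, continuous w}.
  apply: (@continuous_subspaceW _ _ _ (closure (exterior D))); last exact: excess_continuous.
  by move=> x; exact: boundary_closure_exterior.
have [xi0 bxi hmax] := max_within (boundary_nonempty hD) (boundary_compact hD) cw.
apply: (boundary_max_contradiction hk hD hstar hconv hA hh hu sub decay bxi hmax).
have : sup [set phi xi - quadratic A b 0 xi | xi in boundary D] <= w xi0 + c.
  apply: ge_sup => [|_ [xi bx <-]]; first by exists (phi xi0 - quadratic A b 0 xi0), xi0.
  by rewrite -(bu xi bx) -lerBlDr; apply: le_trans (hmax xi bx); rewrite /w (quadratic_shift A b c); lra.
move: hc; rewrite /c_lower /w; lra.
Qed.
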